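(* Let $\mathbf r_2=(r_2^{\mathtt v},r_2^e,r_2^f)\ge-1$ be an integer vector satisfying one of (i) $r_2^f\ge0$, $r_2^e\ge2r_2^f+1$, $r_2^{\mathtt v}\ge2r_2^e$; (ii) $r_2^f=-1$, $r_2^e\ge1$, $r_2^{\mathtt v}\ge2r_2^e$; (iii) $r_2^f=-1$, $r_2^e\in\{0,-1\}$, $r_2^{\mathtt v}\ge2r_2^e+1$; let $\mathbf r_3=(r_3^{\mathtt v},r_3^e,r_3^f)\ge\mathbf r_2\ominus1$ be a valid smoothness vector, and let $k\ge\max\{2r_2^{\mathtt v}+1,2r_3^{\mathtt v}+2,1\}$ be such that, for the tetrahedron $T$, $\dim\mathbb B_{k-1}(T;\mathbf r_3)\ge1$ and $\dim\mathbb B_k(f;(r_2^{\mathtt v},r_2^e))\ge1$ for $f\in\Delta_2(T)$. Then the following degrees of freedom, for each $\mathtt v\in\Delta_0(T)$, $e\in\Delta_1(T)$, $f\in\Delta_2(T)$, are unisolvent for $\mathbb P_k(T;\mathbb R^3)$: (D1) $\nabla^iv(\mathtt v)$, $0\le i\le r_2^{\mathtt v}$; (D2) $\nabla^j\operatorname{div}v(\mathtt v)$, $\max\{r_2^{\mathtt v},0\}\le j\le r_3^{\mathtt v}$; (D3) $\int_e\partial_{n_1}^j(v\cdot n_2)q\,ds$, $q\in\mathbb P_{k-2(r_2^{\mathtt v}+1)+j}(e)$, $0\le j\le r_2^e$; (D4) $\int_e\frac{\partial^j(v\cdot t)}{\partial n_1^i\partial n_2^{j-i}}q\,ds$, $q\in\mathbb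 P_{k-2(r_2^{\mathtt v}+1)+j}(e)$, $0\le i\le j\le r_2^e$; (D5) $\int_e\frac{\partial^j(v\cdot n_1)}{\partial n_1^i\partial n_2^{j-i}}q\,ds$, $q\in\mathbb P_{k-2(r_2^{\mathtt v}+1)+j}(e)$, $0\le i\le j\le r_2^e$; (D6) $\int_e\frac{\partial^j(\operatorname{div}v)}{\partial n_1^i\partial n_2^{j-i}}q\,ds$, $q\in\mathbb P_{k-1-2(r_3^{\mathtt v}+1)+j}(e)$, $0\le i\le j\le r_3^e$; (D7) $\int_fv\cdot n\,q\,dS$, $q\in\mathbb P_0(f)\oplus\mathbb B_k(f;(r_2^{\mathtt v},r_2^e))/\mathbb R$; (D8) $\int_f\partial_n^j(v\cdot t_\ell)q\,dS$, $q\in\mathbb B_{k-j}(f;(r_2^{\mathtt v}-j,r_2^e-j))$, $0\le j\le r_2^f$, $\ell=1,2$; (D9) $\int_f\partial_n^j(\operatorname{div}v)q\,dS$, $q\in\mathbb B_{k-1-j}(f;(r_3^{\mathtt v}-j,r_3^e-j))$, $0\le j\le r_3^f$; (D10) $\int_T\operatorname{div}v\,q\,dx$, $q\in\mathbb B_{k-1}(T;\mathbf r_3)/\mathbb R$; (D11) $\int_Tv\cdot q\,dx$, $q\in\mathbb B^{\mathrm{div}}_k(T;\mathbf r_2)\cap\ker(\operatorname{div})$.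
   Context: $T$ is a tetrahedron and $\Delta_\ell(T)$ the set of its $\ell$-dimensional subsimplices. An integer vector $\mathbf r=(r^{\mathtt v},r^e,r^f)$ is a valid smoothness vector if $r^f\ge-1$, $r^e\ge\max\{2r^f,-1\}$, $r^{\mathtt v}\ge\max\{2r^e,-1\}$. Inequalities between vectors are componentwise and $r\ominus1:=\max\{r-1,-1\}$ (componentwise). $\mathbb P_m(K)$ is the space of polynomials of degree $\le m$ on $K$, equal to $\{0\}$ for $m<0$. For a function space $W$ on $K$, $W/\mathbb R:=W\cap L^2_0(K)$ (zero mean). $\nabla^j$ is the tensor of all $j$-th order partial derivatives. For each edge $e$ a tangent vector $t$ and two linearly independent normal vectors $n_1,n_2$ are fixed; for each face $f$ a unit normal $n$ and two linearly independent tangent vectors $t_1,t_2$. With barycentric coordinates $\lambda_0,\dots,\lambda_3$ of $T$, let $\mathbb T_k^3=\{\alpha\in\mathbb N^{4}:|\alpha|=k\}$, $\lambda^\alpha=\prod\lambda_i^{\alpha_i}$; identifying a subsimplex $g$ with its set of vertex indices, put $\operatorname{dist}(\alpha,g)=\sum_{i\notin g}\alpha_i$. Then $\mathbb B_k(T;\mathbf r)=\operatorname{span}\{\lambda^\alpha:\alpha\in\mathbb T_k^3,\ \operatorname{dist}(\alpha,\mathtt v)>r^{\mathtt v},\ \operatorname{dist}(\alpha,e)>r^e,\ \operatorname{dist}(\alpha,f)>r^f$ for all vertices $\mathtt v$, edges $e$, faces $f$ of $T\}$. For a triangle $f$, $\mathbb B_k(f;(a,b))$ is the span of the degree $k$ monomials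 $\lambda_f^{\alpha}$ in the barycentric coordinates of $f$ with $\operatorname{dist}(\alpha,\mathtt v)>a$ for all vertices and $\operatorname{dist}(\alpha,e)>b$ for all edges of $f$ (dist taken within $f$). $\mathbb B_k^{\mathrm{div}}(T;\mathbf r)=\{v\in\mathbb B_k(T;\mathbf r)^3:v\cdot n=0\text{ on }\partial T\}$. Unisolvent means: taking bases of the test spaces and counting the distinct partial derivatives (for (D2), (D6) and (D9), derivatives of the scalar $\operatorname{div}v$), the number of DoFs equals $\dim\mathbb P_k(T;\mathbb R^3)$, and a function in $\mathbb P_k(T;\mathbb R^3)$ for which all DoFs vanish is zero. *)

(* Defs.v *)
From HB Require Import structures.
From mathcomp Require Import all_boot all_order all_algebra.
From mathcomp Require Import mpoly.
From mathcomp Require Import boolp classical_sets reals.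
From mathcomp Require Import measure lebesgue_measure lebesgue_integral.

Set Implicit Arguments.
Unset Strict Implicit.
Unset Printing Implicit Defensive.
Import Order.TTheory GRing.Theory Num.Theory.
Local Open Scope ring_scope.
Local Open Scope classical_set_scope.

(* Conventions.
   - A polynomial on the tetrahedron T (which has nonempty interior) is an
     element of {mpoly R[3]} in the Cartesian coordinates of R^3.
   - A d-simplex K is given by its vertices y : 'I_d.+1 -> 'rV[R]_3.  For an
     edge or a face K, a polynomial on K is an element of {mpoly R[d]} in the
     affine coordinates s of the parametrization [affpt y] of K by the standard
     simplex {s >= 0, s_0 + ... + s_(d-1) <= 1}; its barycentric coordinates are
     then 1 - \sum_j s_j, s_0, ..., s_(d-1).
   - A subsimplex of T is the set of the indices of its vertices. *)

Section Linear.
Context {R : realType} {V : lmodType R}.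
Implicit Types (A W : set V) (b : seq V).

Definition lspan A : set V :=
  [set w | exists n (c : 'I_n -> R) (a : 'I_n -> V),
     (forall i, A (a i)) /\ w = \sum_(i < n) c i *: a i].

Definition is_basis W b : Prop :=
  [/\ forall i : 'I_(size b), W b`_i,
      forall c : 'I_(size b) -> R,
        \sum_(i < size b) c i *: b`_i = 0 -> forall i, c i = 0
    & forall w, W w ->
        exists c : 'I_(size b) -> R, w = \sum_(i < size b) c i *: b`_i].

(* A chosen basis of a finite-dimensional subspace W; it is [::], and ldim W is
   0, if W has no finite basis, a case that does not occur below. *)
Definition lbasis W : seq V := xget [::] [set b | is_basis W b].

Definition ldim W : nat := size (lbasis W).

Lemma lbasisP W b : is_basis W b -> is_basis W (lbasis W).
Proof. by move=> Wb; rewrite /lbasis; case: xgetP => [c -> //|/(_ b)]. Qed.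

Lemma is_basis_leq W b b' : is_basis W b -> is_basis W b' ->
  (size b' <= size b)%N.
Proof.
move=> [_ _ gen] [Wb' free' _]; rewrite leqNgt; apply/negP => lt_bb'.
have /choice[C CE] : forall j : 'I_(size b'),
  exists c : 'I_(size b) -> R, b'`_j = \sum_(i < size b) c i *: b`_i.
  by move=> j; exact: gen.
pose A : 'M[R]_(size b', size b) := \matrix_(j, i) C j i.
have /rowV0Pn[u /sub_kermxP uA0 u0] : kermx A != 0.
  rewrite kermx_eq0 /row_free neq_ltn (leq_ltn_trans (rank_leq_col A)) //.
case/eqP: u0; apply/rowP => j; rewrite mxE.
apply: (free' (fun j => u 0 j)).
under eq_bigr do rewrite CE scaler_sumr.
rewrite exchange_big big1 //= => i _.
under eq_bigr do rewrite scalerA.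
rewrite -scaler_suml; move/rowP/(_ i): uA0; rewrite !mxE.
by under eq_bigr do rewrite mxE; move=> ->; rewrite scale0r.
Qed.

Lemma ldim_basis W b : is_basis W b -> ldim W = size b.
Proof.
move=> Wb; apply/eqP; rewrite eqn_leq.
by rewrite (is_basis_leq Wb (lbasisP Wb)) (is_basis_leq (lbasisP Wb) Wb).
Qed.

End Linear.

Record smoothness := Smoothness { rv : int; re : int; rf : int }.

Definition valid_smoothness (r : smoothness) : Prop :=
  [/\ -1 <= rf r, Num.max (2 * rf r) (-1) <= re r
    & Num.max (2 * re r) (-1) <= rv r].

Definition le_smoothness (r r' : smoothness) : Prop :=
  [/\ rv r <= rv r', re r <= re r' & rf r <= rf r'].

Definition ominus1 (r : smoothness) : smoothness :=
  Smoothness (Num.max (rv r - 1) (-1)) (Num.max (re r - 1) (-1))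
             (Num.max (rf r - 1) (-1)).

Section Geometry.
Context {R : realType}.
Implicit Types x : 'I_4 -> 'rV[R]_3.

Definition dotv (u w : 'rV[R]_3) : R := \sum_c u 0 c * w 0 c.

Definition Delta (l : nat) : seq {set 'I_4} :=
  enum [set g : {set 'I_4} | #|g| == l.+1]%SET.

(* The a-th vertex, in increasing order of indices, of a subsimplex g. *)
Definition vtx x l (g : {set 'I_4}) : 'I_l.+1 -> 'rV[R]_3 :=
  fun a => x (nth ord0 (enum g) a).

Definition edge_mx d (y : 'I_d.+1 -> 'rV[R]_3) : 'M[R]_(d, 3) :=
  \matrix_(j < d) (y (lift ord0 j) - y ord0).

Definition tetrahedron x : Prop := row_free (edge_mx x).

Definition tangent_to d (y : 'I_d.+1 -> 'rV[R]_3) (t : 'rV[R]_3) : Prop :=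
  (t <= edge_mx y)%MS.

Definition normal_to d (y : 'I_d.+1 -> 'rV[R]_3) (n : 'rV[R]_3) : Prop :=
  forall j, dotv n (y (lift ord0 j) - y ord0) = 0.

Record frames := Frames {
  et : {set 'I_4} -> 'rV[R]_3;
  en1 : {set 'I_4} -> 'rV[R]_3;
  en2 : {set 'I_4} -> 'rV[R]_3;
  fn : {set 'I_4} -> 'rV[R]_3;
  ft1 : {set 'I_4} -> 'rV[R]_3;
  ft2 : {set 'I_4} -> 'rV[R]_3 }.

Definition frames_of x (F : frames) : Prop :=
  (forall e, e \in Delta 1 ->
     [/\ tangent_to (@vtx x 1 e) (et F e), et F e != 0,
         normal_to (@vtx x 1 e) (en1 F e), normal_to (@vtx x 1 e) (en2 F e)
       & free [:: en1 F e; en2 F e]]) /\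
  (forall f, f \in Delta 2 ->
     [/\ normal_to (@vtx x 2 f) (fn F f), dotv (fn F f) (fn F f) = 1,
         tangent_to (@vtx x 2 f) (ft1 F f), tangent_to (@vtx x 2 f) (ft2 F f)
       & free [:: ft1 F f; ft2 F f]]).

Definition affpt d (y : 'I_d.+1 -> 'rV[R]_3) (s : 'I_d -> R) : 'rV[R]_3 :=
  y ord0 + \sum_j s j *: (y (lift ord0 j) - y ord0).

(* Iterated integral over {s >= 0, s_0 + ... + s_(d-1) <= h}. *)
Fixpoint std_int (d : nat) (h : R) (F : seq R -> R) : R :=
  if d is d'.+1 then
    \int[lebesgue_measure]_(s in `[0, h]%classic)
       std_int d' (h - s) (fun z => F (s :: z))
  else F [::].

(* The integral over a simplex with respect to its d-dimensional measure
   (dx, dS or ds) of a function of the affine coordinates: the Jacobian of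
   [affpt y] is the square root of the Gram determinant. *)
Definition simplex_int d (y : 'I_d.+1 -> 'rV[R]_3) (F : ('I_d -> R) -> R) : R :=
  Num.sqrt (\det (edge_mx y *m (edge_mx y)^T)) *
  std_int d 1 (fun s => F (fun j => s`_j)).

End Geometry.

Section Polynomials.
Context {R : realType}.
Local Notation poly3 := {mpoly R[3]}.
Local Notation vpoly := {ffun 'I_3 -> {mpoly R[3]}}.

Implicit Types (x : 'I_4 -> 'rV[R]_3) (p : poly3) (v : vpoly).

Definition ev p (a : 'rV[R]_3) : R := p.@[fun c => a 0 c].

Definition dderiv (n : 'rV[R]_3) p : poly3 := \sum_c n 0 c *: p^`M(c).

Definition divg v : poly3 := \sum_c (v c)^`M(c).

Definition dotc v (n : 'rV[R]_3) : poly3 := \sum_c n 0 c *: v c.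

Definition dotp v (w : vpoly) : poly3 := \sum_c v c * w c.

(* Polynomials in n variables of degree at most m; msize is degree + 1. *)
Definition Pol (n : nat) (m : int) : set {mpoly R[n]} :=
  [set p | p = 0 \/ (msize p)%:Z <= m + 1].

Definition VPol (m : int) : set vpoly := [set v : vpoly | forall c, Pol m (v c)].

(* Barycentric coordinates from the affine coordinates, which are the
   barycentric coordinates other than the 0-th one. *)
Definition bary_of n d (c : 'I_d -> {mpoly R[n]}) (i : 'I_d.+1) :
    {mpoly R[n]} :=
  if unlift ord0 i is Some j then c j else 1 - \sum_j c j.

Definition bary_std d : 'I_d.+1 -> {mpoly R[d]} :=
  bary_of (fun j : 'I_d => 'X_j).

Definition bary x : 'I_4 -> poly3 :=
  bary_of (fun j : 'I_3 =>
    \sum_c invmx (edge_mx x) c j *: ('X_c - (x ord0 0 c)%:MP)).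

Lemma bary_vertex x (i j : 'I_4) : tetrahedron x ->
  ev (bary x i) (x j) = (i == j)%:R.
Proof.
rewrite /tetrahedron row_free_unit => xT.
have locE (l : 'I_3) : ev (\sum_c invmx (edge_mx x) c l *:
    ('X_c - (x ord0 0 c)%:MP)) (x j) = (lift ord0 l == j)%:R.
  transitivity (((x j - x ord0) *m invmx (edge_mx x)) 0 l).
    rewrite /ev raddf_sum mxE; apply: eq_bigr => c _ /=.
    by rewrite mevalZ mevalB mevalXU mevalC !mxE mulrC.
  case: (unliftP ord0 j) => [j'|] ->; last first.
    by rewrite subrr mul0mx mxE -(inj_eq val_inj).
  have -> : x (lift ord0 j') - x ord0 = row j' (edge_mx x) by rewrite rowK.
  by rewrite -row_mul mulmxV // !mxE (inj_eq lift_inj) eq_sym.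
rewrite /bary /bary_of; case: unliftP => [i'|] ->; first exact: locE.
rewrite /ev mevalB meval1 (raddf_sum (meval _)) /= (eq_bigr _ (fun l _ => locE l)).
case: (unliftP ord0 j) => [j'|] ->.
  rewrite (bigD1 j') //= eqxx big1 ?addr0 ?subrr //.
  by move=> l /negPf; rewrite (inj_eq lift_inj) => ->.
by rewrite big1 ?subr0 ?eqxx // => l _; rewrite eq_sym (negPf (neq_lift _ _)).
Qed.

(* Span of the monomials of degree m in barycentric coordinates lam whose
   exponent a satisfies dist(a, g) > r_l for every l-dimensional proper
   subsimplex g, where r = [:: r_0; ...; r_(d-1)]. *)
Definition bubble n d (lam : 'I_d.+1 -> {mpoly R[n]}) (m : int) (r : seq int) :
    set {mpoly R[n]} :=
  lspan [set p | exists a : 'X_{1..d.+1},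
    [/\ (mdeg a)%:Z = m,
        forall g : {set 'I_d.+1}, (0 < #|g| <= d)%N ->
          nth (-1) r #|g|.-1 < (\sum_(i | i \notin g) a i)%N%:Z
      & p = \prod_i lam i ^+ a i]].

Definition bubbleT x (m : int) (r : smoothness) : set poly3 :=
  bubble (bary x) m [:: rv r; re r; rf r].

(* In affine coordinates this space is the same for all triangles. *)
Definition bubbleF (m a b : int) : set {mpoly R[2]} :=
  bubble (bary_std (d := 2)) m [:: a; b].

Definition bubbleDiv x (F : frames) (m : int) (r : smoothness) : set vpoly :=
  [set v : vpoly | (forall c, bubbleT x m r (v c)) /\
    forall f, f \in Delta 2 -> forall s : 'I_2 -> R,
      (forall j, 0 <= s j) -> \sum_j s j <= 1 ->
      ev (dotc v (fn F f)) (affpt (@vtx R x 2 f) s) = 0].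

Definition cell_int x p : R := simplex_int x (fun s => ev p (affpt x s)).

(* Integral over the simplex y of p times a polynomial q on that simplex. *)
Definition pairing d (y : 'I_d.+1 -> 'rV[R]_3) p (q : {mpoly R[d]}) : R :=
  simplex_int y (fun s => ev p (affpt y s) * q.@[s]).

Definition bubbleT0 x (m : int) (r : smoothness) : set poly3 :=
  [set q | bubbleT x m r q /\ cell_int x q = 0].

Definition bubbleF0 (y : 'I_3 -> 'rV[R]_3) (m a b : int) : set {mpoly R[2]} :=
  [set q | bubbleF m a b q /\ simplex_int y (fun s => q.@[s]) = 0].

Definition dof := vpoly -> R.

Definition moments (V : lmodType R) (W : set V) (l : vpoly -> V -> R) :
    seq dof :=
  [seq (fun v => l v q) | q <- lbasis W].

Definition unisolvent (W : set vpoly) (L : seq dof) : Prop :=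
  size L = ldim W /\
  forall v, W v -> all (fun l : dof => l v == 0) L -> v = 0.

(* The j : nat such that lo <= j <= hi. *)
Definition irange (lo hi : int) : seq nat :=
  [seq j <- iota 0 `|hi|%N.+1 | lo <= j%:Z <= hi].

(* The pairs (i, j) such that 0 <= i <= j <= hi. *)
Definition itriangle (hi : int) : seq (nat * nat) :=
  [seq (i, j) | j <- irange 0 hi, i <- iota 0 j.+1].

(* The partial derivatives in R^3 of order between lo and hi. *)
Definition partials (lo hi : int) : seq 'X_{1..3} :=
  flatten [seq [seq bmnm a | a : 'X_{1..3 < j.+1} <- enum predT & mdeg a == j]
          | j <- irange lo hi].

(* d^j p / d n1^i d n2^(j - i) for ij = (i, j). *)
Definition dnormal (n1 n2 : 'rV[R]_3) (ij : nat * nat) p : poly3 :=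
  iter ij.1 (dderiv n1) (iter (ij.2 - ij.1)%N (dderiv n2) p).

Section DoFs.
Variables (x : 'I_4 -> 'rV[R]_3) (F : @frames R) (k : int).
Variables (r2 r3 : smoothness).

Local Notation vertex g := (@vtx R x 0 g ord0).
Local Notation edge g := (@vtx R x 1 g).
Local Notation face g := (@vtx R x 2 g).

Definition D1 : seq dof :=
  [seq (fun v => ev ((v ac.2)^`M[ac.1]) (vertex g))
  | g <- Delta 0, ac <- [seq (a, c) | a <- partials 0 (rv r2), c <- enum 'I_3]].

Definition D2 : seq dof :=
  [seq (fun v => ev ((divg v)^`M[a]) (vertex g))
  | g <- Delta 0, a <- partials (Num.max (rv r2) 0) (rv r3)].

Definition D3 : seq dof := flatten
  [seq moments (@Pol 1 (k - 2 * (rv r2 + 1) + j%:Z))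
         (fun v => pairing (edge e) (iter j (dderiv (en1 F e)) (dotc v (en2 F e))))
  | e <- Delta 1, j <- irange 0 (re r2)].

Definition D4 : seq dof := flatten
  [seq moments (@Pol 1 (k - 2 * (rv r2 + 1) + ij.2%:Z))
         (fun v => pairing (edge e)
            (dnormal (en1 F e) (en2 F e) ij (dotc v (et F e))))
  | e <- Delta 1, ij <- itriangle (re r2)].

Definition D5 : seq dof := flatten
  [seq moments (@Pol 1 (k - 2 * (rv r2 + 1) + ij.2%:Z))
         (fun v => pairing (edge e)
            (dnormal (en1 F e) (en2 F e) ij (dotc v (en1 F e))))
  | e <- Delta 1, ij <- itriangle (re r2)].

Definition D6 : seq dof := flatten
  [seq moments (@Pol 1 (k - 1 - 2 * (rv r3 + 1) + ij.2%:Z))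
         (fun v => pairing (edge e) (dnormal (en1 F e) (en2 F e) ij (divg v)))
  | e <- Delta 1, ij <- itriangle (re r3)].

Definition D7 : seq dof := flatten
  [seq moments [set q | exists q0 q1, [/\ @Pol 2 0 q0,
                  bubbleF0 (face f) k (rv r2) (re r2) q1 & q = q0 + q1]]
         (fun v => pairing (face f) (dotc v (fn F f)))
  | f <- Delta 2].

Definition D8 : seq dof := flatten
  [seq moments (bubbleF (k - jt.1%:Z) (rv r2 - jt.1%:Z) (re r2 - jt.1%:Z))
         (fun v => pairing (face f)
            (iter jt.1 (dderiv (fn F f)) (dotc v (jt.2 f))))
  | f <- Delta 2, jt <- [seq (j, t) | j <- irange 0 (rf r2),
                                      t <- [:: ft1 F; ft2 F]]].

Definition D9 : seq dof := flatten
  [seq moments (bubbleF (k - 1 - j%:Z) (rv r3 - j%:Z) (re r3 - j%:Z))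
         (fun v => pairing (face f) (iter j (dderiv (fn F f)) (divg v)))
  | f <- Delta 2, j <- irange 0 (rf r3)].

Definition D10 : seq dof :=
  moments (bubbleT0 x (k - 1) r3) (fun v q => cell_int x (divg v * q)).

Definition D11 : seq dof :=
  moments [set w | bubbleDiv x F k r2 w /\ divg w = 0]
    (fun v w => cell_int x (dotp v w)).

Definition dofs : seq dof :=
  D1 ++ D2 ++ D3 ++ D4 ++ D5 ++ D6 ++ D7 ++ D8 ++ D9 ++ D10 ++ D11.

End DoFs.
End Polynomials.

(* Main.v *)
(* Unisolvence is the vanishing of every v that kills the degrees of freedom,
   together with the bound of their number by dim P_k(T; R^3).  If all degrees of
   freedom of v vanish, div v vanishes to the orders given by r3 on vertices,
   edges and faces, so it is a bubble; it has mean zero by the divergence theorem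
   and (D7), hence div v = 0 by (D10).  In a frame adapted to an edge or a face,
   div v = 0 then expresses the normal derivatives of the normal component that
   are not prescribed by those that are, so that v is a divergence-free bubble
   with v.n = 0 on the boundary, and v = 0 by (D11).

   For the number, the monomials lam^a of degree m are sorted according to the
   vertex, edge or face they are close to, the others being those of B_m(T; r);
   this is applied to P_k with r2 and to P_(k-1) with r3 and with r2 - 1.  The
   kernel of the divergence is bounded by exhibiting enough divergences:
   edge-directed fields (x_j - x_i) lam^a belong to B^div and their divergences
   are differences of two neighbouring normalized monomials of B_(k-1)(T; r2 - 1),
   and any two such monomials are linked by a chain of these differences. *)
Require Import Defs.
From HB Require Import structures.
From mathcomp Require Import all_boot all_order all_algebra.
From mathcomp Require Import mpoly.
From mathcomp Require Import boolp classical_sets reals.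
From mathcomp Require Import measure lebesgue_measure lebesgue_integral.
From mathcomp Require Import topology normedtype derive realfun ftc.
From mathcomp Require Import zify ring lra.
Set Implicit Arguments.
Unset Strict Implicit.
Unset Printing Implicit Defensive.
Import Order.TTheory GRing.Theory Num.Theory.
Import numFieldNormedType.Exports.
Local Open Scope ring_scope.

(** * Integration over simplices *)

Section Univariate.
Context {R : realType}.
Implicit Types (p q : {poly R}) (h a b : R).

(** Only inequalities between dimensions are used. Linear functionals without a common nonzero zero
    are at least as many as the dimension, so their number has only to be bounded by the size of a
    free family of [P_k]. Test spaces then need spanning families, and kernels are bounded by
    vectors dual to suitable functionals.

    The delicate family is (D11). The divergences exhibited in [B^div] are counted with [r2 - 1],
    whereas (D2), (D6), (D9) and (D10) follow [r3]; both counts belong to partitions of the same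
    space [P_(k-1)], which allows their exchange. The three alternatives for [r2] keep the chains of
    monomials inside the bubbles: for [r2 = (0, 0, -1)], which they exclude, a power of a single
    barycentric coordinate could not be moved.

    Polynomials on T are represented by forms in four variables, where vanishing to some order on a
    subsimplex means that the coefficients near it are zero. Orders are shifted by one: [A], [B],
    [C] stand for the orders at vertices, edges and faces plus one, and [k = K + 1], so that all
    bounds are natural numbers. *)

Lemma poly_zero_on_interval h p : 0 < h ->
  (forall s, 0 < s < h -> p.[s] = 0) -> p = 0.
Proof.
move=> h0 p0; pose rs := [seq h / (i.+2)%:R | i <- iota 0 (size p)].
apply: (@roots_geq_poly_eq0 _ p rs); last by rewrite size_map size_iota.
  apply/allP => _ /mapP[i _ ->]; apply/rootP/p0.
  rewrite divr_gt0 ?ltr0n //= ltr_pdivrMr ?ltr0n // ltr_pMr // ltr1n //.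
rewrite map_inj_uniq ?iota_uniq // => i j /(mulfI (lt0r_neq0 h0)) /invr_inj.
by move=> /eqP; rewrite eqr_nat => /eqP[].
Qed.

Lemma Rintegral_deriv a b p : a <= b ->
  \int[lebesgue_measure]_(s in `[a, b]%classic) p^`().[s] = p.[b] - p.[a].
Proof.
rewrite le_eqVlt => /predU1P[->|ab].
  by rewrite subrr set_interval.set_itv1 Rintegral_set1.
rewrite /Rintegral (@continuous_FTC2 _ _ (horner p)) //.
- by apply: continuous_in_subspaceT => x _; exact: continuous_horner.
- split=> [x _||].
  + exact: derivable_horner.
  + by apply: cvg_at_right_filter; exact: continuous_horner.
  + by apply: cvg_at_left_filter; exact: continuous_horner.
- by move=> x _; rewrite derivE.
Qed.

Definition prim p : {poly R} :=
  \sum_(i < size p) (p`_i / i.+1%:R) *: 'X^(i.+1).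

Lemma prim_deriv p : (prim p)^`() = p.
Proof.
rewrite /prim raddf_sum -[RHS]coefK poly_def /=; apply: eq_bigr => i _.
by rewrite derivZ derivXn -scalerMnr scalerMnl -mulr_natr mulfVK ?pnatr_eq0.
Qed.

Lemma prim_at0 p : (prim p).[0] = 0.
Proof.
rewrite /prim horner_sum big1 // => i _.
by rewrite hornerZ hornerXn expr0n mulr0.
Qed.

Definition int0 h p : R :=
  \int[lebesgue_measure]_(s in `[0, h]%classic) p.[s].

Lemma int0E h p : 0 <= h -> int0 h p = (prim p).[h].
Proof.
by move=> h0; rewrite -[X in int0 h X]prim_deriv /int0 Rintegral_deriv // prim_at0 subr0.
Qed.

Lemma int0_deriv h p : 0 <= h -> int0 h p^`() = p.[h] - p.[0].
Proof. exact: Rintegral_deriv. Qed.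

(** Linearity is read off primitives by the fundamental theorem of calculus, without any
    integrability condition. *)
Lemma int0_lin h c p q : 0 <= h -> int0 h (c *: p + q) = c * int0 h p + int0 h q.
Proof.
move=> h0; rewrite -[in LHS](prim_deriv p) -[in LHS](prim_deriv q).
rewrite -derivZ -derivD int0_deriv // !int0E // !hornerE !prim_at0; ring.
Qed.

Lemma int00 h : 0 <= h -> int0 h 0 = 0.
Proof. by move=> h0; rewrite int0E // /prim size_poly0 big_ord0 horner0. Qed.

Lemma int0Z h c p : 0 <= h -> int0 h (c *: p) = c * int0 h p.
Proof.
by move=> h0; rewrite -[c *: p]addr0 int0_lin // int00 // addr0.
Qed.

Lemma int0_sum h (I : finType) (c : I -> R) (p : I -> {poly R}) : 0 <= h ->
  int0 h (\sum_i c i *: p i) = \sum_i c i * int0 h (p i).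
Proof.
move=> h0; elim/big_rec2: _ => [|i y x _ <-].
  by rewrite int00.
exact: int0_lin.
Qed.

(** The primitive that vanishes at 0 is nondecreasing on [0, h] and vanishes at h as well, so it is
    zero on the interval. *)
Lemma int0_eq0 h p : 0 < h -> (forall s, 0 <= s <= h -> 0 <= p.[s]) ->
  int0 h p = 0 -> p = 0.
Proof.
move=> h0 p0 ip; have h0' := ltW h0.
have mono a b : 0 <= a -> a <= b -> b <= h -> (prim p).[a] <= (prim p).[b].
  move=> a0 ab bh; rewrite -subr_ge0 -Rintegral_deriv // prim_deriv.
  apply: Rintegral_ge0 => s /=; rewrite in_itv /= => /andP[sa sb].
  by apply: p0; rewrite (le_trans a0 sa) (le_trans sb bh).
rewrite int0E // in ip.
rewrite -(prim_deriv p).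
suff -> : prim p = 0 by rewrite raddf0.
apply: (poly_zero_on_interval h0) => s /andP[/ltW s0 /ltW sh].
apply/eqP; rewrite eq_le -{1}ip mono //= -(prim_at0 p) mono //.
Qed.

(** Euler's Beta integral, by induction on m: integration by parts moves one power from [h - s] to
    [s]. *)
Lemma int0_beta h (a m : nat) : 0 <= h ->
  int0 h ('X^a * (h%:P - 'X) ^+ m) =
  a`!%:R * m`!%:R / (a + m).+1`!%:R * h ^+ (a + m).+1.
Proof.
move=> h0; elim: m a => [|m IH] a.
  have D : ((a.+1)%:R^-1 *: 'X^(a.+1) : {poly R})^`() = 'X^a * (h%:P - 'X) ^+ 0.
    rewrite derivZ derivXn -scalerMnr scalerMnl -mulr_natr mulVf ?pnatr_eq0 //.
    by rewrite scale1r expr0 mulr1.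
  rewrite -D int0_deriv // !hornerZ !hornerXn addn0 factS natrM fact0 mulr1 expr0n mulr0 subr0.
  have : a`!%:R != 0 :> R by rewrite pnatr_eq0 -lt0n fact_gt0.
  have : a.+1%:R != 0 :> R by rewrite pnatr_eq0.
  by move=> a1 a2; rewrite invfM mulrCA mulfV ?mulr1.
have D : ('X^(a.+1) * (h%:P - 'X) ^+ m.+1)^`() =
   (a.+1%:R : R) *: ('X^a * (h%:P - 'X) ^+ m.+1) +
   (- m.+1%:R : R) *: ('X^(a.+1) * (h%:P - 'X) ^+ m).
  rewrite derivM derivXn deriv_exp derivB derivC derivX sub0r /=.
  rewrite scaleNr !scaler_nat mulrnAl mulN1r -mulNrn mulrnAr mulrN mulNrn.
  by congr (_ + _); rewrite -mulNrn.
have := congr1 (int0 h) D; rewrite int0_deriv // int0_lin // int0Z // IH.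
rewrite !hornerM !hornerXn !horner_exp !hornerD !hornerN !hornerC !hornerX subrr !expr0n mulr0 mul0r.
have -> : (a.+1 + m = a + m.+1)%N by rewrite addSnnS.
rewrite !(factS a) !(factS m) !natrM.
have ? : (a + m.+1).+1`!%:R != 0 :> R by rewrite pnatr_eq0 -lt0n fact_gt0.
have a1 : a.+1%:R != 0 :> R by rewrite pnatr_eq0.
rewrite subr0 => E; apply: (mulfI a1); move: E.
move: (int0 _ _) (h ^+ _) ((_ : R)^-1) (a`!%:R : R) (m`!%:R : R) (a.+1%:R : R) (m.+1%:R : R) => I H F A M a' m' E.
rewrite [RHS](_ : _ = m' * (a' * A * M * F * H)); last by ring.
by move: E; lra.
Qed.
End Univariate.

Section Eval.
Context {n : nat} {R : comNzRingType}.
Implicit Types (s : 'I_n -> R) (p : {mpoly R[n]}).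

Lemma meval_exp s p m : (p ^+ m).@[s] = p.@[s] ^+ m.
Proof. exact: (rmorphXn (meval s)). Qed.

Lemma meval_prod s (I : Type) (r : seq I) (P : pred I) (F : I -> {mpoly R[n]}) :
  (\prod_(i <- r | P i) F i).@[s] = \prod_(i <- r | P i) (F i).@[s].
Proof. exact: (rmorph_prod (meval s)). Qed.

Lemma meval_sum s (I : Type) (r : seq I) (P : pred I) (F : I -> {mpoly R[n]}) :
  (\sum_(i <- r | P i) F i).@[s] = \sum_(i <- r | P i) (F i).@[s].
Proof. exact: (raddf_sum (meval s)). Qed.

End Eval.

(** * Dirichlet's formula and positivity on the standard simplex *)

Section SimplexIntegral.
Context {R : realType}.

(* The weight z ^ a (h - |z|) ^ b on the simplex {z >= 0, |z| <= h}. *)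
Definition sw d h b (a : nat -> nat) (z : seq R) : R :=
  (h - \sum_(j < d) z`_j) ^+ b * \prod_(j < d) z`_j ^+ a j.

(** Dirichlet's integral: the value of [std_int d 1] on the weight [sw d 1 b a]. *)
Definition dir d b (a : nat -> nat) : R :=
  b`!%:R * \prod_(j < d) (a j)`!%:R / (b + \sum_(j < d) a j + d)`!%:R.

Lemma std_int_cons d h (F : seq R -> R) :
  std_int d.+1 h F = \int[lebesgue_measure]_(s in `[0, h]%classic)
    std_int d (h - s) (fun z => F (s :: z)).
Proof. by []. Qed.

Lemma sw_cons d h b a s z :
  sw d.+1 h b a (s :: z) = s ^+ a 0%N * sw d (h - s) b (fun j => a j.+1) z.
Proof. by rewrite /sw !big_ord_recl /= opprD addrA mulrCA. Qed.


Section Step.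
Variables (d : nat) (h : R) (I : finType) (c : I -> R) (b : I -> nat) (a : I -> nat -> nat).
Let m i := (b i + \sum_(j < d) a i j.+1 + d)%N.

(** Integrating all variables but the first leaves a polynomial in the first one, s: each weight
    contributes a power of [h - s] whose exponent [m i] is its degree on the slice plus d. *)
Definition slice_poly : {poly R} :=
  \sum_i (c i * dir d (b i) (fun j => a i j.+1)) *:
   ('X^(a i 0%N) * (h%:P - 'X) ^+ m i).

Hypothesis IH : forall h (c : I -> R) (a : I -> nat -> nat), 0 <= h ->
  std_int d h (fun z => \sum_i c i * sw d h (b i) (a i) z) =
  \sum_i c i * (dir d (b i) (a i) * h ^+ (b i + \sum_(j < d) a i j + d)).

Lemma slice_polyE_aux s : 0 <= s <= h ->
  std_int d (h - s) (fun z => \sum_i c i * sw d.+1 h (b i) (a i) (s :: z)) =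
  slice_poly.[s].
Proof.
case/andP=> s0 sh.
transitivity (std_int d (h - s) (fun z =>
  \sum_i (c i * s ^+ a i 0%N) * sw d (h - s) (b i) (fun j => a i j.+1) z)).
  congr std_int; apply: funext => z; apply: eq_bigr => i _.
  by rewrite sw_cons mulrA.
rewrite IH ?subr_ge0 // horner_sum; apply: eq_bigr => i _.
rewrite hornerZ hornerM hornerXn horner_exp hornerD hornerN hornerC hornerX.
rewrite -/(m i); move: (_ ^+ m i) (s ^+ _) (dir _ _ _) => X Y Z.
by ring.
Qed.

Lemma int0_slice_poly : 0 <= h ->
  int0 h slice_poly =
  \sum_i c i * (dir d.+1 (b i) (a i) * h ^+ (b i + \sum_(j < d.+1) a i j + d.+1)).
Proof.
move=> h0; rewrite int0_sum //; apply: eq_bigr => i _; rewrite int0_beta // -mulrA.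
congr (_ * _); rewrite !mulrA.
have Em : (b i + \sum_(j < d.+1) a i j + d.+1 = (a i 0%N + m i).+1)%N.
  rewrite big_ord_recl /m.
  rewrite (eq_bigr (fun j : 'I_d => a i j.+1)) //.
  by move: (\sum_(_ < d) _)%N => S /=; lia.
rewrite Em /dir Em big_ord_recl -/(m i).
rewrite (eq_bigr (fun j : 'I_d => (a i j.+1)`!%:R)) //=.
have : (m i)`!%:R != 0 :> R by rewrite pnatr_eq0 -lt0n fact_gt0.
have : (a i 0%N + m i).+1`!%:R != 0 :> R by rewrite pnatr_eq0 -lt0n fact_gt0.
move: (h ^+ _) ((b i)`!%:R) ((a i 0%N)`!%:R) (\prod_(_ < d) _)
  ((m i)`!%:R) ((a i 0%N + m i).+1`!%:R) => *.
by field; apply/andP.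
Qed.

End Step.

(** Stated for linear combinations because additivity of the iterated integral is deduced from this
    formula, through [Int_sw]. The induction on d peels off the outermost integral and evaluates it
    by the Beta integral. *)
Lemma std_int_sw d h (I : finType) (c : I -> R) (b : I -> nat) (a : I -> nat -> nat) :
  0 <= h ->
  std_int d h (fun z => \sum_i c i * sw d h (b i) (a i) z) =
  \sum_i c i * (dir d (b i) (a i) * h ^+ (b i + \sum_(j < d) a i j + d)).
Proof.
elim: d h c a => [|d IH] h c a h0.
  rewrite /=; apply: eq_bigr => i _.
  rewrite /sw /dir !big_ord0 subr0 !mulr1 !addn0 mulfV ?mul1r //.
  by rewrite pnatr_eq0 -lt0n fact_gt0.
rewrite std_int_cons -int0_slice_poly //.
apply: eq_Rintegral => s /set_mem /=; rewrite in_itv /=.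
exact: slice_polyE_aux.
Qed.

Lemma slice_polyE d h (I : finType) (c : I -> R) (b : I -> nat)
    (a : I -> nat -> nat) s : 0 <= s <= h ->
  std_int d (h - s) (fun z => \sum_i c i * sw d.+1 h (b i) (a i) (s :: z)) =
  (slice_poly d h c b a).[s].
Proof. by apply: slice_polyE_aux => *; exact: std_int_sw. Qed.

Definition in_simplex d h (z : seq R) :=
  (forall j, (j < d)%N -> 0 <= z`_j) /\ \sum_(j < d) z`_j <= h.

Lemma in_simplex_cons d h s z : 0 <= s ->
  in_simplex d (h - s) z -> in_simplex d.+1 h (s :: z).
Proof.
move=> s0 [z0 zh]; split=> [[|j] //=|]; first by rewrite ltnS => /z0.
by rewrite big_ord_recl /= addrC -lerBrDr.
Qed.

Lemma std_int_ge0 d h F : 0 <= h ->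
  (forall z, in_simplex d h z -> 0 <= F z) -> 0 <= std_int d h F.
Proof.
elim: d h F => [|d IH] h F h0 F0.
  by apply: F0; split=> //; rewrite big_ord0.
rewrite std_int_cons; apply: Rintegral_ge0 => s /=; rewrite in_itv /= => /andP[s0 sh].
by apply: IH; rewrite ?subr_ge0 // => z /(in_simplex_cons s0); exact: F0.
Qed.

(** The integral over the slice at s is a polynomial in s, nonnegative on [0, h] and of zero
    integral, hence zero; every slice then has zero integral and the induction applies to it. *)
Lemma std_int_eq0 d h (I : finType) (c : I -> R) (b : I -> nat)
    (a : I -> nat -> nat) (F := fun z => \sum_i c i * sw d h (b i) (a i) z) :
  0 < h -> (forall z, in_simplex d h z -> 0 <= F z) -> std_int d h F = 0 ->
  forall z, (forall j, (j < d)%N -> 0 < z`_j) -> \sum_(j < d) z`_j < h -> F z = 0.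
Proof.
rewrite {}/F; elim: d h c a => [|d IH] h c a h0 F0.
  move=> /= E z _ _; rewrite -[RHS]E; apply: eq_bigr => i _.
  by rewrite /sw !big_ord0.
have h0' := ltW h0.
rewrite std_int_sw // -int0_slice_poly // => /int0_eq0 P0.
move=> z z0 zh; have s0 := z0 0%N isT.
have zE : forall i, sw d.+1 h (b i) (a i) z = sw d.+1 h (b i) (a i) (z`_0 :: behead z).
  move=> i; rewrite /sw; congr ((_ - _) ^+ _ * _); apply: eq_bigr => -[[|j] ?] _ //=;
  by rewrite nth_behead.
under eq_bigr do rewrite zE.
have zh' : \sum_(j < d) (behead z)`_j < h - z`_0.
  move: zh; rewrite big_ord_recl /= addrC -ltrBrDr.
  by rewrite (eq_bigr (fun j : 'I_d => (behead z)`_j)) // => j _; rewrite nth_behead.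
have z0' j : (j < d)%N -> 0 < (behead z)`_j by rewrite nth_behead; exact: (z0 j.+1).
have sh : 0 < h - z`_0.
  apply: le_lt_trans zh'; apply: sumr_ge0 => j _; exact/ltW/z0'.
have sI : 0 <= z`_0 <= h by rewrite (ltW s0) -subr_ge0 ltW.
have E w : \sum_i c i * sw d.+1 h (b i) (a i) (z`_0 :: w) =
    \sum_i (c i * z`_0 ^+ a i 0%N) * sw d (h - z`_0) (b i) (fun j => a i j.+1) w.
  by apply: eq_bigr => i _; rewrite sw_cons mulrA.
rewrite E; apply: IH => //.
  by move=> w /(in_simplex_cons (ltW s0)) /F0; rewrite E.
under eq_fun do rewrite -E.
rewrite slice_polyE // P0 ?horner0 // => s /andP[s1 s2].
rewrite -slice_polyE ?s1 //; apply: std_int_ge0; first by rewrite subr_ge0.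
by move=> w /(in_simplex_cons s1) /F0.
Qed.

Definition Int d (q : {mpoly R[d]}) : R := std_int d 1 (fun s => q.@[fun j => s`_j]).

Lemma meval_sw d w (q : {mpoly R[d]}) (z : seq R) : (msize q <= w)%N ->
  q.@[fun j => z`_j] =
  \sum_(m : 'X_{1..d < w}) q@_m * sw d 1 0 (nth 0%N (val m)) z.
Proof.
move=> qw; rewrite /meval (mmapE w) //; apply: eq_bigr => m _ /=.
rewrite /sw expr0 mul1r; congr (_ * _); apply: eq_bigr => j _.
by rewrite -mnm_nth.
Qed.

Lemma Int_sw d w (q : {mpoly R[d]}) : (msize q <= w)%N ->
  Int q = \sum_(m : 'X_{1..d < w}) q@_m * dir d 0 (nth 0%N (val m)).
Proof.
move=> qw; rewrite /Int.
under eq_fun do rewrite (meval_sw _ qw).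
by rewrite std_int_sw //; apply: eq_bigr => m _; rewrite expr1n mulr1.
Qed.

Lemma Int_is_linear d : scalar (@Int d).
Proof.
move=> c p q; pose w := maxn (msize (c *: p + q)) (maxn (msize p) (msize q)).
rewrite !(@Int_sw _ w) ?leq_max ?leqnn ?orbT //.
rewrite mulr_sumr -big_split /=; apply: eq_bigr => m _.
rewrite mcoeffD mcoeffZ.
by ring.
Qed.

HB.instance Definition _ d :=
  GRing.isLinear.Build R {mpoly R[d]} R *%R (@Int d) (@Int_is_linear d).

Lemma meval_bary_std d (s : 'I_d -> R) i : (@bary_std R d i).@[s] =
  (if unlift ord0 i is Some j then s j else 1 - \sum_j s j) :> R.
Proof.
rewrite /bary_std /bary_of; case: unlift => [j|]; first by rewrite mevalXU.
rewrite mevalB meval1 meval_sum; congr (_ - _).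
by apply: eq_bigr => j _; rewrite mevalXU.
Qed.

Lemma Int_bary_std d (a : 'I_d.+1 -> nat) :
  Int (\prod_i @bary_std R d i ^+ a i) =
  (\prod_i (a i)`!)%:R / (\sum_i a i + d)`!%:R.
Proof.
pose a' j := if insub j is Some j' then a (lift ord0 j') else 0%N.
have a'E (j : 'I_d) : a' j = a (lift ord0 j) by rewrite /a' valK.
transitivity (std_int d 1 (fun z => \sum_(i < 1) 1 * sw d 1 (a ord0) a' z) : R).
  congr std_int; apply: funext => z; rewrite big_ord1.
  rewrite mul1r big_ord_recl mevalM meval_prod meval_exp meval_bary_std unlift_none.
  congr (_ * _); apply: eq_bigr => j _.
  by rewrite meval_exp meval_bary_std liftK a'E.
rewrite std_int_sw // big_ord1.
rewrite expr1n mulr1 mul1r /dir !big_ord_recl natrM natr_prod.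
congr (_ * _ / _`!%:R); last congr (_ + _ + _)%N; apply: eq_bigr => j _; by rewrite a'E.
Qed.

End SimplexIntegral.

Lemma base_expansion_inj (N n : nat) (a b : nat -> nat) :
  (forall j, (j < n)%N -> (a j < N)%N /\ (b j < N)%N) ->
  (\sum_(j < n) a j * N ^ j = \sum_(j < n) b j * N ^ j)%N ->
  forall j, (j < n)%N -> a j = b j.
Proof.
elim: n a b => [//|n IH] a b ab.
have E (c : nat -> nat) : (\sum_(j < n.+1) c j * N ^ j = c 0 + (\sum_(j < n) c j.+1 * N ^ j) * N)%N.
  rewrite big_ord_recl expn0 muln1 big_distrl; congr (_ + _)%N.
  by apply: eq_bigr => j _; rewrite /= -mulnA -expnSr.
rewrite !E => eqab; have [a0 b0] := ab 0%N isT.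
have N0 : (0 < N)%N by case: (N) a0.
have e0 : a 0%N = b 0%N.
  by have := congr1 (modn^~ N) eqab; rewrite addnC modnMDl addnC modnMDl !modn_small.
case=> [//|j] jn; apply: (IH (fun j => a j.+1) (fun j => b j.+1)) => //.
  by move=> i; exact: (ab i.+1).
by move/eqP: eqab; rewrite e0 eqn_add2l eqn_pmul2r // => /eqP.
Qed.

Section MpolyVanish.
Context {R : realType} {n : nat}.
Implicit Types Q : {mpoly R[n]}.

(* Kronecker's substitution s_j = e t ^ (N ^ j) keeps the monomials apart. *)
Lemma mpoly_eq0_box (e : R) Q : 0 < e ->
  (forall s : 'I_n -> R, (forall j, 0 < s j < e) -> Q.@[s] = 0) -> Q = 0.
Proof.
move=> e0 Q0; pose N := (msize Q).+1.
pose kr (m : 'X_{1..n}) := (\sum_(j < n) m j * N ^ j)%N.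
pose p : {poly R} := \sum_(m <- msupp Q) (Q@_m * e ^+ mdeg m) *: 'X^(kr m).
have p0 : p = 0.
  apply: (poly_zero_on_interval ltr01) => t /andP[t0 t1].
  rewrite horner_sum -[RHS](Q0 (fun j => e * t ^+ (N ^ j))) => [|j]; last first.
    rewrite mulr_gt0 ?exprn_gt0 //= gtr_pMr // exprn_ilt1 ?expn_eq0 //.
    exact: ltW.
  rewrite mevalE; apply: eq_bigr => m _; rewrite hornerZ hornerXn -mulrA.
  congr (_ * _); rewrite mdegE /kr -!prodrXr -big_split; apply: eq_bigr => j _ /=.
  by rewrite exprMn mulnC exprM.
apply/mpolyP => m; rewrite mcoeff0; apply/eqP; apply: contraT.
rewrite -mcoeff_msupp => mQ; have := congr1 (fun p : {poly R} => p`_(kr m)) p0.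
rewrite coef0 /p coef_sum (bigD1_seq m) ?msupp_uniq //= big_seq_cond big1 => [|m' /andP[m'Q m'm]].
  rewrite addr0 coefZ coefXn eqxx mulr1 => /eqP; rewrite mulf_eq0.
  by rewrite expf_eq0 (gt_eqF e0) andbF orbF mcoeff_eq0 mQ.
rewrite coefZ coefXn; case: eqP => [km|]; last by rewrite mulr0.
have bd (k : 'X_{1..n}) (j : 'I_n) : k \in msupp Q -> (k j < N)%N.
  move=> kQ; rewrite ltnS ltnW // (leq_trans _ (msize_mdeg_lt kQ)) //.
  by rewrite ltnS mdegE (bigD1 j) //= leq_addr.
case/eqP: m'm; apply/mnmP => j; rewrite !(mnm_nth 0%N).
apply: (base_expansion_inj (N := N) (n := n)) => //.
  move=> i im; pose i' := Ordinal im.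
  by rewrite -[i]/(val i') -!mnm_nth !bd.
transitivity (kr m'); first by apply: eq_bigr => i _; rewrite -mnm_nth.
by rewrite -km; apply: eq_bigr => i _; rewrite -mnm_nth.
Qed.

Lemma mpoly_eq0 Q : (forall s : 'I_n -> R, Q.@[s] = 0) -> Q = 0.
Proof. by move=> Q0; apply: (mpoly_eq0_box ltr01) => s _. Qed.

Lemma mpoly_eq0_simplex Q :
  (forall s : 'I_n -> R, (forall j, 0 < s j) -> \sum_j s j < 1 -> Q.@[s] = 0) ->
  Q = 0.
Proof.
(* The open box of side [1 / (n + 1)] at the origin lies in the open simplex. *)
move=> Q0; apply: (mpoly_eq0_box (e := n.+1%:R^-1)); first by rewrite invr_gt0.
move=> s s0; apply: Q0 => [j|]; first by case/andP: (s0 j).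
apply: (@le_lt_trans _ _ (\sum_(j < n) n.+1%:R^-1)).
  by apply: ler_sum => j _; case/andP: (s0 j) => _ /ltW.
by rewrite sumr_const card_ord -[_ *+ _]mulr_natr mulrC ltr_pdivrMr // mul1r ltr_nat.
Qed.

End MpolyVanish.

Section IntPositive.
Context {R : realType} {d : nat}.
Implicit Types q w : {mpoly R[d]}.

Lemma Int_eq0 q :
  (forall s : 'I_d -> R, (forall j, 0 <= s j) -> \sum_j s j <= 1 -> 0 <= q.@[s]) ->
  Int q = 0 -> q = 0.
Proof.
move=> q0; rewrite /Int.
under eq_fun do rewrite (meval_sw _ (leqnn _)).
move=> I0; apply: mpoly_eq0_simplex => s s0 s1.
pose z := [seq s j | j <- enum 'I_d].
have zE (j : 'I_d) : z`_j = s j.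
  by rewrite (nth_map j) ?size_enum_ord // nth_ord_enum.
rewrite (meval_eq (v2 := fun j => z`_j)) => [|j]; last by rewrite zE.
rewrite (meval_sw _ (leqnn _)); apply: (std_int_eq0 ltr01 _ I0).
- move=> z' [z'0 z'1]; rewrite -meval_sw //; apply: q0 => // j; exact: z'0.
- by move=> j jd; rewrite -[j]/(val (Ordinal jd)) zE.
- by under eq_bigr do rewrite zE.
Qed.

(** Polynomials form an integral domain, so a weight that vanishes on part of the boundary can still
    be cancelled. In [edge_dof] it is the product of barycentric coordinates divided out of a
    trace. *)
Lemma Int_weighted_sqr_eq0 w q :
  (forall s : 'I_d -> R, (forall j, 0 <= s j) -> \sum_j s j <= 1 -> 0 <= w.@[s]) ->
  w != 0 -> Int (w * q ^+ 2) = 0 -> q = 0.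
Proof.
move=> w0 wn0 /Int_eq0 E; apply/eqP.
have /eqP : w * q ^+ 2 = 0.
  by apply: E => s s0 s1; rewrite mevalM meval_exp mulr_ge0 ?sqr_ge0 ?w0.
by rewrite mulf_eq0 (negPf wn0) sqrf_eq0.
Qed.

Lemma Int_sqr_eq0 q : Int (q ^+ 2) = 0 -> q = 0.
Proof.
by rewrite -[q ^+ 2]mul1r; apply: Int_weighted_sqr_eq0 => [s _ _|]; rewrite ?meval1 ?oner_neq0.
Qed.

End IntPositive.

(** * Spans, bases and functionals *)

Section LinearAlgebra.
Local Open Scope classical_set_scope.

Section AllP.
Context {T : Type} (P : T -> Prop).

(** [all] for a property in [Prop], here the linearity of every functional of a list. *)
Fixpoint AllP (s : seq T) : Prop := if s is x :: s' then P x /\ AllP s' else True.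

Lemma AllP_nth x0 s : AllP s -> forall i, (i < size s)%N -> P (nth x0 s i).
Proof. by elim: s => [//|x s IH] /= [Px Ps] [|i] // /IH; apply. Qed.

Lemma AllP_cat s1 s2 : AllP s1 -> AllP s2 -> AllP (s1 ++ s2).
Proof. by elim: s1 => [//|x s IH] /= [Px Ps] s2P; split=> //; exact: IH. Qed.

Lemma AllP_map (S : Type) (f : S -> T) s : (forall x, P (f x)) -> AllP (map f s).
Proof. by move=> Pf; elim: s => //= x s IH. Qed.

End AllP.

Lemma AllP_flatten (T : Type) (P : T -> Prop) ss : AllP (AllP P) ss -> AllP P (flatten ss).
Proof. by elim: ss => //= s ss IH [sP /IH]; exact: AllP_cat. Qed.

Lemma AllP_allpairs (S T U : Type) (P : U -> Prop) (f : S -> T -> U) s t :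
  (forall x y, P (f x y)) -> AllP P (allpairs f s t).
Proof.
by move=> Pf; apply: AllP_flatten; apply: AllP_map => x; apply: AllP_map.
Qed.

Section Families.
Context {R : realType} {V : lmodType R}.
Implicit Types (W : set V) (b : seq V) (I J : finType).

Definition freeF I (f : I -> V) :=
  forall c : I -> R, \sum_i c i *: f i = 0 -> forall i, c i = 0.

Definition spanF J (u : J -> V) : set V :=
  [set w | exists c : J -> R, w = \sum_j c j *: u j].

Definition lin_closed W := W 0 /\ forall a v w, W v -> W w -> W (a *: v + w).

Lemma spanF_gen J (u : J -> V) j : spanF u (u j).
Proof.
exists (fun i => (i == j)%:R); rewrite (bigD1 j) //= eqxx scale1r big1 ?addr0 //.
by move=> i /negPf ->; rewrite scale0r.
Qed.

Lemma spanF_lin J (u : J -> V) : lin_closed (spanF u).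
Proof.
split; first by exists (fun _ => 0); rewrite big1 // => j _; rewrite scale0r.
move=> a _ _ [c ->] [c' ->]; exists (fun j => a * c j + c' j).
rewrite scaler_sumr -big_split; apply: eq_bigr => j _.
by rewrite scalerDl scalerA.
Qed.

Lemma lin_closedZ W a v : lin_closed W -> W v -> W (a *: v).
Proof. by move=> [W0 WD] Wv; rewrite -[_ *: _]addr0; exact: WD. Qed.

Lemma lin_closedD W v w : lin_closed W -> W v -> W w -> W (v + w).
Proof. by move=> [W0 WD] Wv Ww; rewrite -[v]scale1r; exact: WD. Qed.

Lemma lin_closed_sum W (I : Type) (r : seq I) (P : pred I) (F : I -> V) :
  lin_closed W -> (forall i, P i -> W (F i)) -> W (\sum_(i <- r | P i) F i).
Proof.
move=> Wl WF; elim/big_ind: _ => [|v w|//]; first by case: Wl.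
exact: lin_closedD.
Qed.

Lemma lin_closed_lincomb W (I : finType) (c : I -> R) (F : I -> V) :
  lin_closed W -> (forall i, W (F i)) -> W (\sum_i c i *: F i).
Proof. by move=> Wl WF; apply: lin_closed_sum => // i _; exact: lin_closedZ. Qed.

Lemma free_span_leq I J (f : I -> V) (u : J -> V) :
  freeF f -> (forall i, spanF u (f i)) -> (#|I| <= #|J|)%N.
Proof.
move=> ff /choice[C CE]; rewrite leqNgt; apply/negP => lt_JI.
pose A : 'M[R]_(#|I|, #|J|) := \matrix_(i, j) C (enum_val i) (enum_val j).
have /rowV0Pn[w /sub_kermxP wA0 w0] : kermx A != 0.
  by rewrite kermx_eq0 /row_free neq_ltn (leq_ltn_trans (rank_leq_col A)).
case/eqP: w0; apply/rowP => i; rewrite mxE -[i]enum_valK.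
apply: (ff (fun i => w 0 (enum_rank i))).
under eq_bigr do rewrite CE scaler_sumr.
rewrite exchange_big big1 //= => j _.
under eq_bigr do rewrite scalerA.
rewrite -scaler_suml; move/rowP/(_ (enum_rank j)): wA0; rewrite !mxE.
move=> wA0; rewrite (reindex_onto enum_val enum_rank) => [|? _]; last exact: enum_rankK.
rewrite (eq_bigl xpredT) => [|l]; last by rewrite enum_valK eqxx.
rewrite [X in X *: _](_ : _ = 0) ?scale0r // -[RHS]wA0; apply: eq_bigr => l _.
by rewrite enum_valK mxE enum_rankK.
Qed.

Lemma ldim_leq_span J (u : J -> V) W : W `<=` spanF u -> (ldim W <= #|J|)%N.
Proof.
move=> Wu; rewrite /ldim /lbasis; case: xgetP => [b _ [Wb fb _]|_] //.
rewrite -[size b]card_ord.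
by apply: (free_span_leq (f := fun i : 'I_(size b) => b`_i)) => // i; exact/Wu.
Qed.

Lemma basis_span W b : is_basis W b ->
  W `<=` spanF (fun i : 'I_(size b) => b`_i).
Proof. by move=> [_ _ gen] w /gen. Qed.

Lemma free_leq_ldim W b I (f : I -> V) :
  is_basis W b -> freeF f -> (forall i, W (f i)) -> (#|I| <= ldim W)%N.
Proof.
move=> Wb ff Wf; rewrite (ldim_basis Wb) -[X in (_ <= X)%N]card_ord.
by apply: (free_span_leq ff) => i; exact/(basis_span Wb).
Qed.

(** A free family of maximal size inside W generates W, and sizes are bounded by that of the
    spanning family. This is what excludes the default value [[::]] of [lbasis] for the spaces at
    hand. *)
Lemma basis_exists J (u : J -> V) W : lin_closed W -> W `<=` spanF u ->
  is_basis W (lbasis W).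
Proof.
move=> Wl Wu.
pose P n := `[< exists b : seq V, [/\ size b = n, forall i : 'I_(size b), W b`_i
  & freeF (fun i : 'I_(size b) => b`_i)] >].
have P0 : exists n, P n.
  by exists 0%N; apply/asboolP; exists [::]; split=> // [[]|c _ []].
have Pmax n : P n -> (n <= #|J|)%N.
  move=> /asboolP[b [<- Wb fb]]; rewrite -[size b]card_ord.
  by apply: (free_span_leq fb) => i; exact/Wu/Wb.
case: (ex_maxnP P0 Pmax) => n /asboolP[b [nb Wb fb]] mx.
apply: (@lbasisP _ _ _ b); split=> // w Ww.
apply: contrapT => nw; suff /mx : P n.+1 by rewrite ltnn.
apply/asboolP; exists (w :: b); split; [by rewrite /= nb | |].
  by case=> -[|i] //= ib; exact: (Wb (Ordinal (ib : (i < size b)%N))).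
move=> c; rewrite big_ord_recl /= => E.
have c0 : c ord0 = 0.
  apply: contrapT => /eqP c0; apply: nw.
  exists (fun i => - (c ord0)^-1 * c (lift ord0 i)).
  under eq_bigr do rewrite -scalerA.
  rewrite -scaler_sumr; apply: (scalerI c0); rewrite scalerA mulrN mulfV //.
  by rewrite scaleN1r; apply/eqP; rewrite -addr_eq0; apply/eqP.
move: E; rewrite c0 scale0r add0r => /fb E i.
by case: (unliftP ord0 i) => [j|] ->.
Qed.

Lemma scalar0 (l : V -> R) : scalar l -> l 0 = 0.
Proof. by move=> ll; have := ll (-1) 0 0; rewrite scaler0 addr0 mulN1r addNr. Qed.

Lemma scalarZ (l : V -> R) c v : scalar l -> l (c *: v) = c * l v.
Proof. by move=> ll; rewrite -[_ *: _]addr0 ll scalar0 // addr0. Qed.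

Lemma scalarD (l : V -> R) v w : scalar l -> l (v + w) = l v + l w.
Proof. by move=> ll; rewrite -[v]scale1r ll mul1r scale1r. Qed.

Lemma scalarB (l : V -> R) v w : scalar l -> l (v - w) = l v - l w.
Proof. by move=> ll; rewrite addrC -scaleN1r ll mulN1r addrC. Qed.

Lemma scalar_lincomb (l : V -> R) I (c : I -> R) (F : I -> V) : scalar l ->
  l (\sum_i c i *: F i) = \sum_i c i * l (F i).
Proof.
by move=> ll; elim/big_rec2: _ => [|i y x _ <-]; [exact: scalar0|exact: ll].
Qed.

(** A basis of K together with the vectors [z i] is free: applying [L i] to a relation kills the
    part in K and isolates the coefficient of [z i]. Both kernel bounds, [ldim_Bdiv] and
    [ldim_kerdiv], rest on this. *)
Lemma kernel_codim J (u : J -> V) W K I (L : I -> V -> R) (z : I -> V) :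
  (forall i, scalar (L i)) -> W `<=` spanF u -> lin_closed K -> K `<=` W ->
  (forall i v, K v -> L i v = 0) -> (forall i, W (z i)) ->
  (forall i j, L i (z j) = (i == j)%:R) -> (ldim K + #|I| <= #|J|)%N.
Proof.
move=> Ll Wu Kl KW LK Wz Lz.
have Kb := basis_exists Kl (subset_trans KW Wu); set b := lbasis K in Kb.
pose f (i : 'I_(size b) + I) := match i with inl j => b`_j | inr i => z i end.
have -> : (ldim K + #|I| = #|{: 'I_(size b) + I}|)%N by rewrite card_sum card_ord.
case: Kb => Kb fb _.
apply: (free_span_leq (f := f)) => [c|[j|i]]; last 2 first.
- exact: (Wu _ (KW _ (Kb j))).
- exact: (Wu _ (Wz i)).
rewrite big_sumType /= => E.
have c0 i : c (inr i) = 0.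
  have := congr1 (L i) E; rewrite scalar0 // scalarD //.
  rewrite !scalar_lincomb // big1 ?add0r => [|j _]; last by rewrite LK ?mulr0.
  rewrite (bigD1 i) //= Lz eqxx big1 ?addr0 ?mulr1 // => j ji.
  by rewrite Lz eq_sym (negPf ji) mulr0.
move: E; rewrite [X in _ + X]big1 ?addr0 => [/fb E|i _]; last by rewrite c0 scale0r.
by case.
Qed.

(** With fewer functionals than basis vectors, the matrix of their values has a nonzero kernel
    vector, that is, a nonzero common zero in W. This turns uniqueness into a lower bound for the
    number of degrees of freedom. *)
Lemma ldim_leq_functionals W b (L : seq (V -> R)) :
  is_basis W b -> lin_closed W -> AllP (fun l => scalar l) L ->
  (forall v, W v -> all (fun l => l v == 0) L -> v = 0) -> (ldim W <= size L)%N.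
Proof.
move=> Wb Wl Ll L0; rewrite (ldim_basis Wb) leqNgt; apply/negP => lt_Lb.
pose l j := nth (fun _ => 0) L j.
pose A : 'M[R]_(size b, size L) := \matrix_(i, j) l j b`_i.
have /rowV0Pn[w /sub_kermxP wA0 w0] : kermx A != 0.
  by rewrite kermx_eq0 /row_free neq_ltn (leq_ltn_trans (rank_leq_col A)).
case/eqP: w0; case: Wb => Wb fb gen; apply/rowP => i; rewrite mxE.
apply: (fb (fun i => w 0 i)); apply: L0; first exact: lin_closed_lincomb.
apply/(all_nthP (fun _ => 0)) => j jL.
rewrite (scalar_lincomb _ _ (AllP_nth _ Ll jL)).
move/rowP/(_ (Ordinal jL)): wA0; rewrite !mxE => E.
rewrite -[X in _ == X]E; by apply/eqP/eq_bigr => m _; rewrite mxE.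
Qed.

Lemma basis_functional W b (l : V -> R) :
  is_basis W b -> (forall a v w, W v -> W w -> l (a *: v + w) = a * l v + l w) ->
  lin_closed W -> (forall q, q \in b -> l q = 0) -> forall q, W q -> l q = 0.
Proof.
move=> [Wb fb gen] ll Wl lb q /gen[c ->].
have l0 : l 0 = 0.
  have := ll 1 0 0 (proj1 Wl) (proj1 Wl); rewrite scale1r mul1r addr0 => /eqP.
  by rewrite -subr_eq0 opprD addrA subrr sub0r oppr_eq0 => /eqP.
suff [//] : l (\sum_(i < size b) c i *: b`_i) = 0 /\ W (\sum_(i < size b) c i *: b`_i).
elim/big_rec: _ => [|i y _ [y0 Wy]]; first by split=> //; case: Wl.
split; last by apply: (proj2 Wl) => //; exact: Wb.
by rewrite ll // y0 lb ?mulr0 ?addr0 ?mem_nth.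
Qed.

(** Subtracting from each generator the multiple of [u j0] with the same value under l leaves a
    spanning family with one element less. It is applied to test functions of mean zero. *)
Lemma kernel_span J (u : J -> V) (l : V -> R) j0 :
  scalar l -> l (u j0) != 0 ->
  [set v | spanF u v /\ l v = 0] `<=`
  spanF (fun j : {j | j != j0} => u (val j) - (l (u (val j)) / l (u j0)) *: u j0).
Proof.
move=> ll l0 _ [[c ->]]; rewrite scalar_lincomb // => lc.
set f := fun j : {j | j != j0} => _; pose g j := u j - (l (u j) / l (u j0)) *: u j0.
have -> : \sum_j c j *: u j = \sum_(j | j != j0) c j *: g j.
  have -> : \sum_(j | j != j0) c j *: g j = \sum_j c j *: g j.
    by rewrite [RHS](bigD1 j0) //= /g divff // scale1r subrr scaler0 add0r.
  rewrite /g; under [RHS]eq_bigr do rewrite scalerBr scalerA mulrA.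
  by rewrite sumrB -scaler_suml -mulr_suml lc mul0r scale0r subr0.
apply: lin_closed_sum; first exact: spanF_lin.
move=> j jj0; apply: lin_closedZ; first exact: spanF_lin.
exact: (spanF_gen f (exist _ j jj0)).
Qed.

End Families.

End LinearAlgebra.

(** * Polynomials in barycentric coordinates *)

Section Homogeneous.
Context {R : realType} {n : nat}.
Implicit Types (P : {mpoly R[n]}) (g : {set 'I_n}) (m : 'X_{1..n}).

Definition dist g m := (\sum_(i | i \notin g) m i)%N.

Lemma dist_eq0 g m : (dist g m == 0%N) = [forall i, (i \notin g) ==> (m i == 0%N)].
Proof. by rewrite /dist sum_nat_eq0. Qed.

Lemma meval_homog k P (c : R) (y : 'I_n -> R) : P \is k.-homog ->
  P.@[fun i => c * y i] = c ^+ k * P.@[y].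
Proof.
move=> /dhomogP Pk; rewrite !mevalE mulr_sumr; apply: eq_big_seq => m mP.
have mk : mdeg m = k := Pk _ mP.
rewrite mulrCA; congr (_ * _); rewrite -mk mdegE -prodrXr -big_split.
by apply: eq_bigr => i _; rewrite exprMn.
Qed.

Lemma homog_deriv k P i : P \is k.-homog -> P^`M(i) \is k.-1.-homog.
Proof.
move=> /dhomogP Pk; apply/dhomogP => m; rewrite mcoeff_msupp mcoeff_deriv => mP.
have : (m + U_(i))%MM \in msupp P.
  by rewrite mcoeff_msupp; apply: contraNneq mP => ->; rewrite mul0rn.
by move=> /Pk; rewrite /= mdegD mdeg1 addn1 => <-.
Qed.

(** The part [Pg] of P in the variables of g, times the sum [L] of these variables, vanishes
    everywhere: where the sum is nonzero, homogeneity scales the point to sum 1, and elsewhere [L]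
    itself is zero. As [L] is a nonzero polynomial, [Pg] is zero. *)
Lemma homog_coef_on_face k P g : P \is k.-homog -> g != finset.set0 ->
  (forall y : 'I_n -> R, (forall i, i \notin g -> y i = 0) -> \sum_i y i = 1 ->
     P.@[y] = 0) ->
  forall m, dist g m = 0%N -> P@_m = 0.
Proof.
move=> Pk /finset.set0Pn[i0 i0g] P0 m mg.
pose Pg := \sum_(m <- msupp P | dist g m == 0%N) P@_m *: 'X_[m].
have Pg0 : Pg = 0.
  pose L : {mpoly R[n]} := \sum_(i in g) 'X_i.
  have L0 : L != 0.
    apply/eqP => /(congr1 (mcoeff U_(i0)%MM)); rewrite mcoeff0 /L raddf_sum /=.
    rewrite (bigD1 i0) //= mcoeffXU eqxx big1 ?addr0 => [/eqP|i /andP[_ /negPf ii0]].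
      by rewrite oner_eq0.
    by rewrite mcoeffXU ii0.
  apply/eqP; have : Pg * L == 0; last by rewrite mulf_eq0 (negPf L0) orbF.
  apply/eqP/mpoly_eq0 => y; rewrite mevalM.
  pose yg i := if i \in g then y i else 0.
  have -> : Pg.@[y] = P.@[yg].
    rewrite /Pg meval_sum mevalE [RHS](bigID (fun m => dist g m == 0%N)) /=.
    rewrite [X in _ + X]big1 ?addr0 => [|m' ].
      apply: eq_bigr => m'; rewrite dist_eq0 => /forallP m'g; rewrite mevalZ mevalX.
      congr (_ * _); apply: eq_bigr => i _; rewrite /yg; case: ifPn => // ig.
      by have := m'g i; rewrite ig /= => /eqP ->; rewrite !expr0.
    rewrite dist_eq0 negb_forall => /existsP[i]; rewrite negb_imply => /andP[ig m'i].
    by rewrite (bigD1 i) //= /yg (negPf ig) expr0n (negPf m'i) mul0r mulr0.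
  have -> : L.@[y] = \sum_i yg i.
    rewrite meval_sum big_mkcond; apply: eq_bigr => i _; rewrite /yg; case: ifP => // _.
    by rewrite mevalXU.
  case: (eqVneq (\sum_i yg i) 0) => [->|s0]; first by rewrite mulr0.
  set s := \sum_i yg i in s0 *.
  rewrite [P.@[yg]](_ : _ = P.@[fun i => s * (s^-1 * yg i)]); last first.
    by apply: meval_eq => i; rewrite mulrA mulfV // mul1r.
  rewrite (meval_homog _ _ Pk) P0 ?mulr0 ?mul0r //.
    by move=> i /negPf ig; rewrite /yg ig mulr0.
  by rewrite -mulr_sumr mulVf.
have := congr1 (mcoeff m) Pg0; rewrite mcoeff0 /Pg raddf_sum /= => E.
have [mP|/memN_msupp_eq0 //] := boolP (m \in msupp P).
rewrite -[RHS]E big_mkcond (bigD1_seq m) ?msupp_uniq //= mg eqxx.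
rewrite mcoeffZ mcoeffX eqxx mulr1 big1 ?addr0 // => m' /negPf m'm.
by case: ifP => _; rewrite ?mcoeff0 // mcoeffZ mcoeffX m'm mulr0.
Qed.

Lemma homog_zero_on_face P g :
  (forall m, dist g m = 0%N -> P@_m = 0) ->
  forall y : 'I_n -> R, (forall i, i \notin g -> y i = 0) -> P.@[y] = 0.
Proof.
move=> P0 y y0; rewrite mevalE big1 // => m _.
have [/eqP/P0 ->|] := boolP (dist g m == 0%N); first by rewrite mul0r.
rewrite dist_eq0 negb_forall => /existsP[i]; rewrite negb_imply => /andP[ig mi].
by rewrite (bigD1 i) //= y0 // expr0n (negPf mi) mul0r mulr0.
Qed.

End Homogeneous.

(** * Bernstein form on the tetrahedron *)

Section Bernstein.
Context {R : realType} {x : 'I_4 -> 'rV[R]_3} (xT : tetrahedron x).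
Local Notation poly3 := {mpoly R[3]}.
Local Notation poly4 := {mpoly R[4]}.
Implicit Types (p q : poly3) (P Q : poly4) (g : {set 'I_4}) (n w : 'rV[R]_3).

(** Bernstein form: substitution of the barycentric coordinates into a polynomial in four variables.
    It is not injective, since the coordinates sum to 1, but it is so on forms of a fixed degree
    ([bernstein_inj]). *)
Definition bern P : poly3 := P \mPo [tuple bary x i | i < 4].

Lemma ev_bern P a : ev (bern P) a = P.@[fun i => ev (bary x i) a].
Proof.
rewrite /ev /bern comp_mpoly_meval; apply: meval_eq => i.
by rewrite tnth_mktuple.
Qed.

Lemma bernX m : bern 'X_[m] = \prod_i bary x i ^+ m i.
Proof.
rewrite /bern comp_mpolyX; apply: eq_bigr => i _; by rewrite tnth_mktuple.
Qed.

Lemma bernXU i : bern 'X_i = bary x i.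
Proof. by rewrite /bern comp_mpolyXU -tnth_nth tnth_mktuple. Qed.

Lemma bernM P Q : bern (P * Q) = bern P * bern Q.
Proof. exact: rmorphM. Qed.

Lemma bernD P Q : bern (P + Q) = bern P + bern Q.
Proof. exact: raddfD. Qed.

Lemma bernB P Q : bern (P - Q) = bern P - bern Q.
Proof. exact: raddfB. Qed.

Lemma bernZ c P : bern (c *: P) = c *: bern P.
Proof. exact: linearZ. Qed.

Lemma bern0 : bern 0 = 0.
Proof. exact: raddf0. Qed.

Lemma bern1 : bern 1 = 1.
Proof. exact: rmorph1. Qed.

Lemma bern_sum (I : Type) (r : seq I) (A : pred I) (F : I -> poly4) :
  bern (\sum_(i <- r | A i) F i) = \sum_(i <- r | A i) bern (F i).
Proof. exact: raddf_sum. Qed.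

Definition grad (i : 'I_4) : 'rV[R]_3 :=
  if unlift ord0 i is Some l then \row_c invmx (edge_mx x) c l
  else - \sum_l \row_c invmx (edge_mx x) c l.

Lemma grad_lift (l : 'I_3) :
  grad (lift ord0 l) = \row_c invmx (edge_mx x) c l.
Proof. by rewrite /grad; case: unliftP => [k /lift_inj <-|/eqP] //; rewrite eq_sym (negPf (neq_lift _ _)). Qed.

Lemma grad0 : grad ord0 = - \sum_(l < 3) \row_c invmx (edge_mx x) c l.
Proof. by rewrite /grad unlift_none. Qed.

Lemma bary_lift (l : 'I_3) : bary x (lift ord0 l) =
  \sum_c invmx (edge_mx x) c l *: ('X_c - (x ord0 0 c)%:MP).
Proof. by rewrite /bary /bary_of; case: unliftP => [k /lift_inj <-|/eqP] //; rewrite eq_sym (negPf (neq_lift _ _)). Qed.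

Lemma bary0 : bary x ord0 = 1 - \sum_(l < 3) bary x (lift ord0 l).
Proof.
rewrite [LHS]/bary /bary_of unlift_none; congr (_ - _).
by apply: eq_bigr => l _; rewrite bary_lift.
Qed.

Lemma sum_grad : \sum_i grad i = 0.
Proof.
rewrite big_ord_recl grad0 addrC -sumrB big1 // => l _.
by rewrite grad_lift subrr.
Qed.

Lemma mderiv1 c : (1 : poly3)^`M(c) = 0.
Proof. by rewrite -mpolyC1 mderivC. Qed.

Lemma mderiv_sum c (I : Type) (r : seq I) (A : pred I) (F : I -> poly3) :
  (\sum_(i <- r | A i) F i)^`M(c) = \sum_(i <- r | A i) (F i)^`M(c).
Proof. exact: raddf_sum. Qed.

Lemma deriv_bary i c : (bary x i)^`M(c) = (grad i 0 c)%:MP.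
Proof.
have H l : (\sum_c0 invmx (edge_mx x) c0 l *: ('X_c0 - (x ord0 0 c0)%:MP))^`M(c)
   = (invmx (edge_mx x) c l)%:MP :> poly3.
  rewrite raddf_sum (bigD1 c) //= mderivZ mderivB mderivC subr0 mderivX mnm1E eqxx.
  rewrite scale1r -[X in _ *: 'X_[X] + _](_ : 0%MM = _); last first.
    by apply/mnmP => i'; rewrite mnmBE mnm0E subnn.
  rewrite mpolyX0 alg_mpolyC big1 ?addr0 // => c' /negPf c'c.
  by rewrite mderivZ mderivB mderivC subr0 mderivX mnm1E c'c scale0r scaler0.
case: (unliftP ord0 i) => [l|] ->; first by rewrite bary_lift grad_lift H mxE.
rewrite bary0 grad0 mderivB mderiv_sum mderiv1 sub0r.
under eq_bigr do rewrite bary_lift H.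
rewrite -(raddf_sum (@mpolyC 3 R)) -raddfN /= !mxE summxE; congr (- _)%:MP.
by apply: eq_bigr => l _; rewrite mxE.
Qed.

Lemma deriv_bern P c : (bern P)^`M(c) = \sum_l grad l 0 c *: bern P^`M(l).
Proof.
pose A P := (bern P)^`M(c) = \sum_l grad l 0 c *: bern P^`M(l).
have AM P1 P2 : A P1 -> A P2 -> A (P1 * P2).
  rewrite /A bernM mderivM => -> ->; rewrite mulr_suml mulr_sumr -big_split.
  apply: eq_bigr => l _ /=; rewrite mderivM bernD !bernM scalerDr.
  by rewrite scalerAl scalerAr.
have A1 : A 1.
  rewrite /A bern1 -mpolyC1 mderivC big1 // => l _.
  by rewrite -mpolyC1 mderivC bern0 scaler0.
have AX i : A 'X_i.
  rewrite /A bernXU deriv_bary (bigD1 i) //= big1 ?addr0 => [|l li].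
    rewrite mderivX mnm1E eqxx scale1r -[X in 'X_[X]](_ : 0%MM = _).
      by rewrite mpolyX0 bern1 alg_mpolyC.
    by apply/mnmP => i'; rewrite mnmBE mnm0E subnn.
  by rewrite mderivX mnm1E eq_sym (negPf li) scale0r bern0 scaler0.
have AE P1 k : A P1 -> A (P1 ^+ k).
  by move=> AP; elim: k => [|k IH]; rewrite ?expr0 // exprS; exact: AM.
rewrite -/(A P) (mpolyE P); elim/big_ind: _ => [|P1 P2|m _].
- by rewrite /A bern0 raddf0 big1 // => l _; rewrite raddf0 bern0 scaler0.
- rewrite /A bernD mderivD => -> ->; rewrite -big_split; apply: eq_bigr => l _ /=.
  by rewrite mderivD bernD scalerDr.
- have : A 'X_[m] by rewrite mpolyXE_id; elim/big_ind: _ => // i _; exact: AE.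
  rewrite /A bernZ mderivZ => ->; rewrite scaler_sumr; apply: eq_bigr => l _.
  by rewrite mderivZ bernZ !scalerA mulrC.
Qed.

Lemma dderiv_bern n P : dderiv n (bern P) = \sum_l dotv n (grad l) *: bern P^`M(l).
Proof.
rewrite /dderiv; under eq_bigr do rewrite deriv_bern scaler_sumr.
rewrite exchange_big; apply: eq_bigr => l _; under eq_bigr do rewrite scalerA.
by rewrite -scaler_suml.
Qed.

Lemma evD p q a : ev (p + q) a = ev p a + ev q a. Proof. exact: mevalD. Qed.
Lemma evB p q a : ev (p - q) a = ev p a - ev q a. Proof. exact: mevalB. Qed.
Lemma evZ c p a : ev (c *: p) a = c * ev p a. Proof. exact: mevalZ. Qed.
Lemma ev0 a : ev (0 : poly3) a = 0. Proof. exact: meval0. Qed.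
Lemma ev_sum (I : Type) (r : seq I) (A : pred I) (F : I -> poly3) a :
  ev (\sum_(i <- r | A i) F i) a = \sum_(i <- r | A i) ev (F i) a.
Proof. exact: meval_sum. Qed.

Lemma sum_bary : \sum_i bary x i = 1.
Proof.
by rewrite big_ord_recl bary0 subrK.
Qed.

Lemma ev_bary_sub i a b : ev (bary x i) a - ev (bary x i) b = dotv (a - b) (grad i).
Proof.
have H l : ev (\sum_c invmx (edge_mx x) c l *: ('X_c - (x ord0 0 c)%:MP)) a -
   ev (\sum_c invmx (edge_mx x) c l *: ('X_c - (x ord0 0 c)%:MP)) b =
   dotv (a - b) (\row_c invmx (edge_mx x) c l).
  rewrite !ev_sum -sumrB; apply: eq_bigr => c _.
  rewrite !evZ !evB /ev !mevalXU !mevalC !mxE; ring.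
case: (unliftP ord0 i) => [l|] ->; first by rewrite bary_lift grad_lift H.
rewrite bary0 grad0 !evB /ev !meval1 -!/(ev _ _) !ev_sum opprD opprK addrACA subrr add0r.
transitivity (- \sum_(l < 3) (ev (bary x (lift ord0 l)) a - ev (bary x (lift ord0 l)) b)).
  by rewrite sumrB opprB addrC.
under eq_bigr do rewrite bary_lift H.
rewrite /dotv exchange_big -sumrN; apply: eq_bigr => c _ /=.
by rewrite -mulr_sumr -mulrN; congr (_ * _); rewrite !mxE summxE.
Qed.

Lemma dotv_grad_edge i a b : dotv (x a - x b) (grad i) = (i == a)%:R - (i == b)%:R.
Proof. by rewrite -ev_bary_sub !bary_vertex. Qed.

Lemma ev_bary_comb i (y : 'I_4 -> R) : \sum_j y j = 1 ->
  ev (bary x i) (\sum_j y j *: x j) = y i.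
Proof.
move=> y1; have := ev_bary_sub i (\sum_j y j *: x j) (x i).
rewrite bary_vertex // eqxx /= => /eqP; rewrite subr_eq => /eqP ->.
have -> : \sum_j y j *: x j - x i = \sum_j y j *: (x j - x i).
  under [RHS]eq_bigr do rewrite scalerBr.
  by rewrite sumrB -scaler_suml y1 scale1r.
have -> : dotv (\sum_j y j *: (x j - x i)) (grad i) = \sum_j y j * dotv (x j - x i) (grad i).
  rewrite /dotv; under [RHS]eq_bigr do rewrite mulr_sumr.
  rewrite exchange_big; apply: eq_bigr => c _ /=; rewrite summxE mulr_suml.
  by apply: eq_bigr => j _; rewrite mxE mulrA.
under eq_bigr do rewrite dotv_grad_edge eqxx mulrBr mulr1.
rewrite sumrB y1 (bigD1 i) //= eqxx mulr1 big1 => [|j /negPf]; first by ring.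
by rewrite eq_sym => ->; rewrite mulr0.
Qed.

Lemma ev_bern_comb P (y : 'I_4 -> R) : \sum_j y j = 1 ->
  ev (bern P) (\sum_j y j *: x j) = P.@[y].
Proof.
by move=> y1; rewrite ev_bern; apply: meval_eq => i; exact: ev_bary_comb.
Qed.

Lemma bary_comb a : \sum_i ev (bary x i) a *: x i = a.
Proof.
have : \sum_i ev (bary x i) a = 1.
  by rewrite -ev_sum sum_bary /ev meval1.
rewrite big_ord_recl => E; rewrite big_ord_recl.
have {E} -> : ev (bary x ord0) a = 1 - \sum_(l < 3) ev (bary x (lift ord0 l)) a.
  by rewrite -E addrK.
rewrite scalerBl scale1r scaler_suml -addrA [X in _ + X]addrC -sumrB.
under eq_bigr do rewrite -scalerBr.
have L (l : 'I_3) : ev (bary x (lift ord0 l)) a = ((a - x ord0) *m invmx (edge_mx x)) 0 l.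
  rewrite bary_lift ev_sum mxE; apply: eq_bigr => c _.
  by rewrite evZ evB /ev mevalXU mevalC !mxE mulrC.
have -> : \sum_(i < 3) ev (bary x (lift ord0 i)) a *: (x (lift ord0 i) - x ord0) =
  (a - x ord0) *m invmx (edge_mx x) *m edge_mx x.
  by rewrite mulmx_sum_row; apply: eq_bigr => l _; rewrite L rowK.
move: xT; rewrite /tetrahedron row_free_unit => xu.
by rewrite -mulmxA mulVmx // mulmx1 addrC subrK.
Qed.

(** Degree at most k (see [bernstein_msize]), witnessed by a form: this gives access to
    coefficients, and degrees add up under products, zero included. *)
Definition bernstein k p := exists2 P : poly4, P \is k.-homog & p = bern P.

Lemma bernsteinM a b p q : bernstein a p -> bernstein b q -> bernstein (a + b) (p * q).
Proof.
by move=> [P Pa ->] [Q Qb ->]; exists (P * Q); rewrite ?bernM // dhomogM.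
Qed.

Lemma bernsteinD k p q : bernstein k p -> bernstein k q -> bernstein k (p + q).
Proof.
by move=> [P Pa ->] [Q Qb ->]; exists (P + Q); rewrite ?bernD // dhomogD.
Qed.

Lemma bernsteinZ k c p : bernstein k p -> bernstein k (c *: p).
Proof. by move=> [P Pa ->]; exists (c *: P); rewrite ?bernZ // dhomogZ. Qed.

Lemma bernstein0 k : bernstein k 0.
Proof. by exists 0; rewrite ?bern0 // dhomog0. Qed.

Lemma bernstein_sum k (I : Type) (r : seq I) (A : pred I) (F : I -> poly3) :
  (forall i, A i -> bernstein k (F i)) -> bernstein k (\sum_(i <- r | A i) F i).
Proof.
move=> FB; elim/big_ind: _ => //; [exact: bernstein0 | exact: bernsteinD].
Qed.

Lemma bernstein_bary i : bernstein 1 (bary x i).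
Proof. by exists 'X_i; rewrite ?bernXU // dhomogX /= mdeg1. Qed.

(** Degree elevation: 1 is the sum of the barycentric coordinates. *)
Lemma bernstein1 k : bernstein k 1.
Proof.
elim: k => [|k IH]; first by exists 1; rewrite ?bern1 ?dhomog1.
rewrite -[1]mulr1 -[in X in X * _]sum_bary -add1n; apply: bernsteinM => //.
by apply: bernstein_sum => i _; exact: bernstein_bary.
Qed.

Lemma bernstein_exp a p k : bernstein a p -> bernstein (a * k) (p ^+ k).
Proof.
move=> Bp; elim: k => [|k IH]; first by rewrite muln0 expr0; exact: bernstein1.
by rewrite exprS mulnS; exact: bernsteinM.
Qed.

Lemma coordE c : 'X_c = \sum_i x i 0 c *: bary x i :> poly3.
Proof.
apply/eqP; rewrite -subr_eq0; apply/eqP/mpoly_eq0 => s.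
pose a : 'rV[R]_3 := \row_j s j.
rewrite (meval_eq (v2 := fun j => a 0 j)) => [|j]; last by rewrite mxE.
rewrite -/(ev _ a) evB ev_sum /ev mevalXU -{1}(bary_comb a) summxE -sumrB big1 // => i _.
by rewrite mxE mevalZ mulrC subrr.
Qed.

Lemma bernstein_X c : bernstein 1 'X_c.
Proof.
rewrite coordE.
by apply: bernstein_sum => i _; apply/bernsteinZ/bernstein_bary.
Qed.

Lemma bernstein_prod (I : Type) (r : seq I) (e : I -> nat) (F : I -> poly3) :
  (forall i, bernstein (e i) (F i)) ->
  bernstein (\sum_(i <- r) e i) (\prod_(i <- r) F i).
Proof.
move=> FB; elim/big_rec2: _ => [|i n y _]; first exact: bernstein1.
exact: bernsteinM.
Qed.

Lemma bernstein_msize k p : (msize p <= k.+1)%N -> bernstein k p.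
Proof.
move=> pk; rewrite (mpolyE p) big_seq; apply: bernstein_sum => m mp.
have mk : (mdeg m <= k)%N by rewrite -ltnS (leq_trans (msize_mdeg_lt mp)).
apply: bernsteinZ; rewrite -['X_[m]]mulr1 -(subnKC mk).
apply: bernsteinM; last exact: bernstein1.
rewrite mpolyXE_id mdegE; apply: bernstein_prod => i.
by rewrite -[X in bernstein X _]mul1n; apply: bernstein_exp; exact: bernstein_X.
Qed.

Lemma msize_bary i : (msize (bary x i) <= 2)%N.
Proof.
have H (l : 'I_3) : (msize (bary x (lift ord0 l)) <= 2)%N.
  rewrite bary_lift (leq_trans (msize_sum _ _ _)) //; apply/bigmax_leqP_seq => c _ _.
  rewrite (leq_trans (msizeZ_le _ _)) // (leq_trans (msizeD_le _ _)) //.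
  by rewrite msizeN msizeX mdeg1 msizeC; case: eqP.
case: (unliftP ord0 i) => [l|] -> //.
rewrite bary0 (leq_trans (msizeD_le _ _)) // msizeN msize1 geq_max /=.
rewrite (leq_trans (msize_sum _ _ _)) //; apply/bigmax_leqP_seq => l _ _ //.
Qed.

Lemma bernstein_inj k P : P \is k.-homog -> bern P = 0 -> P = 0.
Proof.
move=> Pk P0; apply/mpolyP => m; rewrite mcoeff0.
apply: (homog_coef_on_face Pk (g := [set: 'I_4]%SET)) => [|y _ y1|].
- by apply/finset.set0Pn; exists ord0; rewrite finset.inE.
- by rewrite -ev_bern_comb // P0 ev0.
- by rewrite /dist big1 // => i; rewrite finset.inE.
Qed.

End Bernstein.

(** * Vanishing to prescribed order on subsimplices *)

Section DirectionalDerivative.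
Context {R : realType}.
Implicit Types (p q : {mpoly R[3]}) (n m : 'rV[R]_3).

Lemma dderiv_lin n c p q : dderiv n (c *: p + q) = c *: dderiv n p + dderiv n q.
Proof.
rewrite /dderiv scaler_sumr -big_split; apply: eq_bigr => i _ /=.
by rewrite mderivD mderivZ scalerDr !scalerA mulrC.
Qed.

Lemma dderiv0 n : dderiv n 0 = 0 :> {mpoly R[3]}.
Proof. by rewrite /dderiv big1 // => i _; rewrite mderiv0 scaler0. Qed.

Lemma dderivZ n c p : dderiv n (c *: p) = c *: dderiv n p.
Proof. by rewrite -[_ *: p]addr0 dderiv_lin dderiv0 addr0. Qed.

Lemma dderiv_vlin a n m p : dderiv (a *: n + m) p = a *: dderiv n p + dderiv m p.
Proof.
rewrite /dderiv scaler_sumr -big_split; apply: eq_bigr => i _ /=.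
by rewrite !mxE scalerDl scalerA.
Qed.

Lemma dderiv_vD n m p : dderiv (n + m) p = dderiv n p + dderiv m p.
Proof. by rewrite -[n]scale1r dderiv_vlin !scale1r. Qed.

Lemma dderiv_v0 p : dderiv 0 p = 0.
Proof. by rewrite /dderiv big1 // => i _; rewrite mxE scale0r. Qed.

Lemma dderiv_vZ a n p : dderiv (a *: n) p = a *: dderiv n p.
Proof. by rewrite -[_ *: n]addr0 dderiv_vlin dderiv_v0 addr0. Qed.

Lemma dderiv_comm n m p : dderiv n (dderiv m p) = dderiv m (dderiv n p).
Proof.
rewrite /dderiv; under eq_bigr do rewrite mderiv_sum scaler_sumr.
rewrite exchange_big; apply: eq_bigr => i _ /=.
rewrite [in RHS]mderiv_sum [in RHS]scaler_sumr.
apply: eq_bigr => j _; rewrite !mderivZ !scalerA mulrC.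
by rewrite mderiv_comm.
Qed.

End DirectionalDerivative.

Section Vanish.
Context {R : realType} {x : 'I_4 -> 'rV[R]_3} (xT : tetrahedron x).
Local Notation poly3 := {mpoly R[3]}.
Local Notation poly4 := {mpoly R[4]}.
Implicit Types (p q u : poly3) (P Q : poly4) (g : {set 'I_4}) (n m : 'rV[R]_3).
Local Notation bern := (@bern R x).
Local Notation bernstein := (@bernstein R x).

Lemma bernstein_dderiv k n p : bernstein k p -> bernstein k.-1 (dderiv n p).
Proof.
move=> [P Pk ->]; rewrite dderiv_bern; apply: bernstein_sum => l _.
by apply: bernsteinZ; exists (P^`M(l)) => //; exact: homog_deriv.
Qed.

Lemma dderiv_edge_bern i j P : i != j ->
  dderiv (x j - x i) (bern P) = bern (P^`M(j) - P^`M(i)).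
Proof.
move=> ij; rewrite dderiv_bern bernB (bigD1 j) //= (bigD1 i) //= !(dotv_grad_edge xT) !eqxx.
rewrite [j == i]eq_sym (negPf ij) subr0 sub0r scale1r scaleN1r big1 ?addr0 //.
move=> l /andP[lj li]; rewrite !(dotv_grad_edge xT) (negPf lj) (negPf li).
by rewrite subrr scale0r.
Qed.

(** Weights of any sign: the condition is put on the affine span of g, which for a polynomial is
    equivalent to g itself. *)
Definition zero_on g p := forall y : 'I_4 -> R,
  (forall i, i \notin g -> y i = 0) -> \sum_i y i = 1 ->
  ev p (\sum_i y i *: x i) = 0.

(** All derivatives of order less than r vanish on g: r is the smoothness order plus one, and order
    -1 becomes r = 0, no condition. *)
Fixpoint vanish g r p : Prop :=
  if r is r'.+1 then zero_on g p /\ forall n, vanish g r' (dderiv n p) else True.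

Lemma zero_on_lin g c p q : zero_on g p -> zero_on g q -> zero_on g (c *: p + q).
Proof.
by move=> zp zq y yg y1; rewrite evD evZ zp // zq // mulr0 addr0.
Qed.

Lemma zero_on0 g : zero_on g 0.
Proof. by move=> y _ _; rewrite ev0. Qed.

Lemma vanish_lin g r c p q : vanish g r p -> vanish g r q -> vanish g r (c *: p + q).
Proof.
elim: r p q => [//|r IH] p q [zp vp] [zq vq]; split; first exact: zero_on_lin.
by move=> n; rewrite dderiv_lin; apply: IH; [exact: vp|exact: vq].
Qed.

Lemma vanish0 g r : vanish g r 0.
Proof.
elim: r => [//|r IH]; split; first exact: zero_on0.
by move=> n; rewrite dderiv0.
Qed.

Lemma vanishZ g r c p : vanish g r p -> vanish g r (c *: p).
Proof. by move=> vp; rewrite -[_ *: p]addr0; apply: vanish_lin => //; exact: vanish0. Qed.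

Lemma vanishD g r p q : vanish g r p -> vanish g r q -> vanish g r (p + q).
Proof. by move=> vp vq; rewrite -[p]scale1r; exact: vanish_lin. Qed.

Lemma vanish_sum g r (I : Type) (s : seq I) (F : I -> poly3) :
  (forall i, vanish g r (F i)) -> vanish g r (\sum_(i <- s) F i).
Proof. by move=> vF; elim/big_rec: _ => [|i q _]; [exact: vanish0|exact: vanishD]. Qed.

Lemma vanish_dderiv g r n p : vanish g r p -> vanish g r.-1 (dderiv n p).
Proof. by case: r => [//|r] [_ vp]; exact: vp. Qed.

Lemma vanish_iter g r n j p : vanish g r p -> vanish g (r - j) (iter j (dderiv n) p).
Proof.
move=> vp; elim: j => [|j IH]; first by rewrite subn0.
by rewrite iterS subnS; exact: vanish_dderiv.
Qed.

(** Take i in g and j outside g with [m j > 0]. At [m - U_(j)], the derivative along [x j - x i] has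
    coefficient [m j * P@_m] minus a multiple of the coefficient of P at [m - U_(j) + U_(i)]. The
    latter exponent is closer to g, so its coefficient vanishes by the inner induction; that of the
    derivative vanishes by induction on r. *)
Lemma vanish_coef k P g r : g != finset.set0 -> P \is k.-homog ->
  vanish g r (bern P) -> forall m : 'X_{1..4}, (dist g m < r)%N -> P@_m = 0.
Proof.
move=> g0 + + m; move: (m); elim: r k P => [//|r IH] k P {}m Pk [zP vP] mr.
have [i ig] := finset.set0Pn _ g0.
move: mr; have [d] := ubnP (dist g m); elim: d m => [//|d IHd] m md mr.
have [m0|/negP m0] := boolP (dist g m == 0%N).
  apply: (homog_coef_on_face Pk g0) => [y yg y1|]; last exact/eqP.
  by rewrite -(ev_bern_comb xT) //; exact: zP.
have [j jg mj] : exists2 j, j \notin g & (0 < m j)%N.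
  move/negP: m0; rewrite dist_eq0 negb_forall => /existsP[j].
  by rewrite negb_imply -lt0n => /andP[]; exists j.
have ij : i != j by apply: contraNneq jg => <-.
pose m' := (m - U_(j))%MM.
have mE : (m' + U_(j) = m)%MM.
  by rewrite /m' submK //; apply/mnm_lepP => l; rewrite mnm1E; case: eqP => // <-.
have dE : dist g m = (dist g m').+1.
  rewrite /dist (bigD1 j) //= [in RHS](bigD1 j) //= -[in m j]mE mnmDE mnm1E eqxx addn1 addSn.
  congr (_ + _).+1; apply: eq_bigr => l /andP[_ lj].
  by rewrite -mE mnmDE mnm1E eq_sym (negPf lj) addn0.
have dE' : dist g (m' + U_(i))%MM = dist g m'.
  apply: eq_bigr => l lg; rewrite mnmDE mnm1E; case: eqP => [il|]; last by rewrite addn0.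
  by rewrite -il ig in lg.
have := vP (x j - x i); rewrite dderiv_edge_bern //.
have hP : P^`M(j) - P^`M(i) \is k.-1.-homog by apply: rpredB; exact: homog_deriv.
move=> /(IH _ _ m' hP); rewrite dE in mr => /(_ mr).
rewrite mcoeffB !mcoeff_deriv mE (IHd (m' + U_(i))%MM); last 2 first.
- by rewrite dE' -ltnS -dE.
- by rewrite dE' ltnW.
by rewrite mul0rn subr0 => /eqP; rewrite mulrn_eq0 /= => /eqP.
Qed.

Lemma zero_on_bern P g : (forall m : 'X_{1..4}, dist g m = 0%N -> P@_m = 0) -> zero_on g (bern P).
Proof.
by move=> P0 y yg y1; rewrite (ev_bern_comb xT) //; exact: homog_zero_on_face P0 _ yg.
Qed.

(** In the chain rule, a term with l outside g has a zero factor, the gradient of [bary x l] being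
    orthogonal to the edges of g. For l in g the trace on g comes from monomials of P supported in
    g, which are absent. *)
Lemma zero_on_edge_deriv k g u i j : bernstein k u -> zero_on g u -> i \in g -> j \in g ->
  zero_on g (dderiv (x j - x i) u).
Proof.
move=> [P Pk ->] zP ig jg.
have g0 : g != finset.set0 by apply/finset.set0Pn; exists i.
have P0 (m : 'X_{1..4}) : dist g m = 0%N -> P@_m = 0.
  by apply: (homog_coef_on_face Pk g0) => y yg y1; rewrite -(ev_bern_comb xT) //; exact: zP.
rewrite dderiv_bern.
have D l : zero_on g (dotv (x j - x i) (@grad R x l) *: bern P^`M(l)).
  have [lg|lg] := boolP (l \in g).
    rewrite -[_ *: _]addr0; apply: zero_on_lin; last exact: zero_on0.
    apply: zero_on_bern => m; rewrite mcoeff_deriv => m0; rewrite P0 ?mul0rn //.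
    rewrite -[RHS]m0; apply: eq_bigr => l' l'g; rewrite mnmDE mnm1E; case: eqP => [ll|]; last by rewrite addn0.
    by rewrite -ll lg in l'g.
  have nE a : a \in g -> (l == a) = false by move=> ag; apply: contraNF lg => /eqP ->.
  by rewrite (dotv_grad_edge xT) !nE // subrr scale0r; exact: zero_on0.
elim/big_rec: _ => [|l q _ zq]; first exact: zero_on0.
by rewrite -[_ *: _]scale1r; apply: zero_on_lin.
Qed.

End Vanish.

(** * Restriction to subsimplices *)

Section Lspan.
Context {R : realType} {V : lmodType R}.
Implicit Types A : set V.

Lemma lspan_gen A v : A v -> lspan A v.
Proof. by move=> Av; exists 1%N, (fun _ => 1), (fun _ => v); rewrite big_ord1 scale1r. Qed.

Lemma lspan_lin A : lin_closed (lspan A).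
Proof.
split; first by exists 0%N, (fun _ => 0), (fun _ => 0); split; [by case|rewrite big_ord0].
move=> a _ _ [n [c [f [Af ->]]]] [n' [c' [f' [Af' ->]]]].
exists (n + n')%N, (fun i => match split i with inl j => a * c j | inr j => c' j end),
  (fun i => match split i with inl j => f j | inr j => f' j end); split.
  by move=> i; case: split.
rewrite big_split_ord scaler_sumr; congr (_ + _); apply: eq_bigr => i _.
  by rewrite (unsplitK (inl i)) scalerA.
by rewrite (unsplitK (inr i)).
Qed.

Lemma lspan_sub A W : lin_closed W -> (forall v, A v -> W v) -> forall v, lspan A v -> W v.
Proof.
by move=> Wl AW _ [n [c [a [Aa ->]]]]; apply: lin_closed_lincomb => // i; apply/AW/Aa.
Qed.

End Lspan.

Section Restriction.
Context {R : realType} {d : nat}.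
Implicit Types (y : 'I_d.+1 -> 'rV[R]_3) (p : {mpoly R[3]}) (q : {mpoly R[d]}).

Definition restr y p : {mpoly R[d]} := p \mPo
  [tuple (y ord0 0 c)%:MP + \sum_j (y (lift ord0 j) - y ord0) 0 c *: 'X_j | c < 3].

Lemma meval_restr y p s : (restr y p).@[s] = ev p (affpt y s).
Proof.
rewrite /restr comp_mpoly_meval; apply: meval_eq => c.
rewrite tnth_mktuple mevalD mevalC meval_sum /affpt !mxE summxE; congr (_ + _).
by apply: eq_bigr => j _; rewrite mevalZ mevalXU !mxE mulrC.
Qed.

Lemma restr_lin y c p p' : restr y (c *: p + p') = c *: restr y p + restr y p'.
Proof. exact: linearP. Qed.

Lemma restrZ y c p : restr y (c *: p) = c *: restr y p.
Proof. exact: linearZ. Qed.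

Lemma restrM y p p' : restr y (p * p') = restr y p * restr y p'.
Proof. exact: rmorphM. Qed.

Lemma restr_sum y (I : Type) (r : seq I) (A : pred I) (F : I -> {mpoly R[3]}) :
  restr y (\sum_(i <- r | A i) F i) = \sum_(i <- r | A i) restr y (F i).
Proof. exact: raddf_sum. Qed.

Definition gram y : R := Num.sqrt (\det (edge_mx y *m (edge_mx y)^T)).

Lemma simplex_intE y q : simplex_int y (fun s => q.@[s]) = gram y * Int q.
Proof. by []. Qed.

Lemma pairingE y p q : pairing y p q = gram y * Int (restr y p * q).
Proof.
rewrite -simplex_intE /pairing; congr simplex_int.
by apply: funext => s; rewrite mevalM meval_restr.
Qed.

End Restriction.

Lemma cell_intE {R : realType} (x : 'I_4 -> 'rV[R]_3) p :
  cell_int x p = gram x * Int (restr x p).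
Proof.
rewrite -(simplex_intE x (restr x p)) /cell_int; congr simplex_int.
by apply: funext => s; rewrite meval_restr.
Qed.

Section Faces.
Context {R : realType} {x : 'I_4 -> 'rV[R]_3} (xT : tetrahedron x).
Context {d : nat} (gam : 'I_d.+1 -> 'I_4) (gamI : injective gam).
Local Notation bern := (@bern R x).
Local Notation y := (fun a => x (gam a)).
Implicit Types (P : {mpoly R[4]}) (p : {mpoly R[3]}) (m : 'X_{1..4}).

Definition gset := [set gam a | a : 'I_d.+1]%SET.

(** The barycentric weights, with respect to T, of the point of affine coordinates s on the
    subsimplex with vertices [gam]. *)
Definition gwt (s : 'I_d -> R) (i : 'I_4) : R :=
  \sum_(a | gam a == i) (@bary_std R d a).@[s].

Lemma gwt_gam s a : gwt s (gam a) = (bary_std a).@[s].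
Proof. by rewrite /gwt (big_pred1 a) // => b /=; rewrite (inj_eq gamI). Qed.

Lemma gwt_out s i : i \notin gset -> gwt s i = 0.
Proof.
move=> ig; rewrite /gwt big1 // => a /eqP ai.
by case/negP: ig; rewrite -ai; exact: imset_f.
Qed.

Lemma sum_bary_std : \sum_a @bary_std R d a = 1.
Proof.
rewrite big_ord_recl {1}/bary_std /bary_of unlift_none.
rewrite [X in _ + X](eq_bigr (fun j : 'I_d => 'X_j)) ?subrK // => j _.
by rewrite /bary_std /bary_of liftK.
Qed.

Lemma sum_gwt s : \sum_i gwt s i = 1.
Proof.
rewrite /gwt; under eq_bigr do rewrite big_mkcond.
rewrite exchange_big -[RHS](meval1 s) -sum_bary_std meval_sum.
by apply: eq_bigr => a _; rewrite -big_mkcond (big_pred1 (gam a)).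
Qed.

Lemma affpt_gwt s : affpt y s = \sum_i gwt s i *: x i.
Proof.
rewrite /gwt; under [RHS]eq_bigr do rewrite big_mkcond scaler_suml.
rewrite exchange_big.
rewrite (eq_bigr (fun a => (bary_std a).@[s] *: x (gam a))); last first.
  move=> a _; rewrite (bigD1 (gam a)) //= eqxx big1 ?addr0 // => i.
  by rewrite eq_sym => /negPf ->; rewrite scale0r.
rewrite big_ord_recl meval_bary_std unlift_none scalerBl scale1r /affpt.
rewrite [RHS]/= -addrA.
congr (_ + _); rewrite scaler_suml addrC -sumrB; apply: eq_bigr => j _.
by rewrite meval_bary_std liftK scalerBr.
Qed.

Lemma ev_affpt_bern P s : ev (bern P) (affpt y s) = P.@[gwt s].
Proof. by rewrite affpt_gwt (ev_bern_comb xT) // sum_gwt. Qed.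

Lemma restr_bern P : restr y (bern P) =
  \sum_(m <- msupp P | dist gset m == 0%N) P@_m *: \prod_a bary_std a ^+ m (gam a).
Proof.
apply/eqP; rewrite -subr_eq0; apply/eqP/mpoly_eq0 => s.
rewrite mevalB meval_restr ev_affpt_bern meval_sum mevalE.
rewrite (bigID (fun m => dist gset m == 0%N)) /= [X in _ + X - _]big1 ?addr0 => [|m].
  apply/eqP; rewrite subr_eq0; apply/eqP/eq_bigr => m.
  rewrite dist_eq0 => /forallP mg; rewrite mevalZ meval_prod; congr (_ * _).
  rewrite (bigID (mem gset)) /= [X in _ * X]big1 ?mulr1 => [|i ig]; last first.
    by have := mg i; rewrite ig /= => /eqP ->.
  rewrite big_imset /= => [|a b _ _]; last exact: gamI.
  by apply: eq_big => // a _; rewrite gwt_gam meval_exp.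
rewrite dist_eq0 negb_forall => /existsP[i]; rewrite negb_imply => /andP[ig mi].
by rewrite (bigD1 i) //= gwt_out // expr0n (negPf mi) mul0r mulr0.
Qed.

Lemma Int_restr_bern k P : P \is k.-homog -> Int (restr y (bern P)) =
  \sum_(m <- msupp P | dist gset m == 0%N)
    P@_m * (\prod_i (m i)`!)%:R / (k + d)`!%:R.
Proof.
move=> /dhomogP Pk; rewrite restr_bern raddf_sum big_seq_cond [RHS]big_seq_cond.
apply: eq_bigr => m /andP[/Pk /= mk]; rewrite dist_eq0 => /forallP mg.
rewrite linearZ_LR /= Int_bary_std mulrA; congr (_ * _%:R / _`!%:R).
  rewrite [RHS](bigID (mem gset)) /= [X in (_ * X)%N]big1 ?muln1 => [|i ig]; last first.
    by have := mg i; rewrite ig /= => /eqP ->.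
  by rewrite big_imset //= => a b _ _; exact: gamI.
congr (_ + _)%N; rewrite -mk mdegE [RHS](bigID (mem gset)) /= [X in (_ + X)%N]big1 ?addn0.
  by rewrite big_imset //= => a b _ _; exact: gamI.
by move=> i ig; have := mg i; rewrite ig /= => /eqP ->.
Qed.

Lemma restr_bubble k P (r : seq int) : P \is k.-homog ->
  (forall m, P@_m != 0 -> dist gset m = 0%N -> forall g' : {set 'I_d.+1},
    (0 < #|g'| <= d)%N ->
    nth (-1) r #|g'|.-1 < (dist (gam @: g')%SET m)%:Z) ->
  bubble (@bary_std R d) k%:Z r (restr y (bern P)).
Proof.
move=> /dhomogP Pk Pr; rewrite restr_bern big_seq_cond.
apply: lin_closed_sum; first exact: lspan_lin.
move=> m /andP[mP /eqP mg]; apply: lin_closedZ; first exact: lspan_lin.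
have mk : mdeg m = k := Pk _ mP.
have mg0 i : i \notin gset -> m i = 0%N.
  move/eqP: mg; rewrite dist_eq0 => /forallP/(_ i) => + ig.
  by rewrite ig => /eqP.
have distE (g' : {set 'I_d.+1}) :
    (\sum_(a | a \notin g') m (gam a) = dist (gam @: g')%SET m)%N.
  rewrite /dist [RHS](bigID (mem gset)) /= [X in (_ + X)%N]big1 ?addn0; last first.
    by move=> i /andP[_]; exact: mg0.
  rewrite [RHS](eq_bigl (fun i => (i \in gset) && (i \notin gam @: g')%SET)); last first.
    by move=> i; rewrite andbC.
  rewrite big_imset_cond /= => [|a b _ _]; last exact: gamI.
  by apply: eq_bigl => a; rewrite mem_imset.
apply: lspan_gen; exists [multinom m (gam a) | a < d.+1]; split.
- congr Posz; rewrite -mk !mdegE; under eq_bigr do rewrite mnmE.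
  have := distE finset.set0; rewrite imset0 /dist.
  under eq_bigl do rewrite finset.in_set0; under [in RHS]eq_bigl do rewrite finset.in_set0.
  by [].
- move=> g' g'd; under eq_bigr do rewrite mnmE.
  by rewrite distE; apply: Pr => //; rewrite -mcoeff_msupp.
- by apply: eq_bigr => a _; rewrite mnmE.
Qed.

End Faces.

Section Subsimplices.
Context {R : realType} {x : 'I_4 -> 'rV[R]_3} (xT : tetrahedron x).
Context {d : nat} {g : {set 'I_4}} (gD : g \in Delta d).

Definition gam_of (a : 'I_d.+1) : 'I_4 := nth ord0 (enum g) a.

Lemma size_enum_Delta : size (enum g) = d.+1.
Proof. by move: gD; rewrite mem_enum finset.inE -cardE => /eqP. Qed.

Lemma gam_of_inj : injective gam_of.
Proof.
move=> a b /eqP; rewrite nth_uniq ?enum_uniq ?size_enum_Delta //.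
by move=> /eqP; exact: val_inj.
Qed.

Lemma gset_gam_of : gset gam_of = g.
Proof.
apply/setP => i; apply/imsetP/idP => [[a _ ->]|ig].
  by rewrite -mem_enum mem_nth // size_enum_Delta.
have ig' : (index i (enum g) < d.+1)%N by rewrite -size_enum_Delta index_mem mem_enum.
by exists (Ordinal ig'); rewrite // /gam_of nth_index // mem_enum.
Qed.

Lemma Delta_neq0 : g != finset.set0.
Proof. by rewrite -gset_gam_of; apply/finset.set0Pn; exists (gam_of ord0); exact: imset_f. Qed.

Lemma zero_on_restr p : restr (@vtx R x d g) p = 0 -> zero_on (x := x) g p.
Proof.
move=> p0 w wg w1; pose s (j : 'I_d) := w (gam_of (lift ord0 j)).
suff -> : \sum_i w i *: x i = affpt (@vtx R x d g) s.
  by rewrite -meval_restr p0 meval0.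
rewrite (affpt_gwt gam_of); apply: eq_bigr => i _; congr (_ *: _).
have [|ig] := boolP (i \in g); last by rewrite wg // gwt_out // gset_gam_of.
rewrite -{1}gset_gam_of => /imsetP[a _ ->]; rewrite (gwt_gam gam_of_inj) meval_bary_std.
case: (unliftP ord0 a) => [j|] -> //.
rewrite -w1 (bigID (mem g)) /= [X in _ + X - _]big1 ?addr0 => [|l]; last exact: wg.
rewrite -gset_gam_of big_imset /= => [|a' b' _ _]; last exact: gam_of_inj.
by rewrite (eq_bigl xpredT) // big_ord_recl addrK.
Qed.

End Subsimplices.

Section DotProduct.
Context {R : realType}.
Implicit Types u v w n : 'rV[R]_3.

Lemma dotvE u w : dotv u w = (u *m w^T) 0 0.
Proof. by rewrite mxE; apply: eq_bigr => c _; rewrite mxE. Qed.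

Lemma dotvC u w : dotv u w = dotv w u.
Proof. by apply: eq_bigr => c _; rewrite mulrC. Qed.

Lemma dotv_linl a u v w : dotv (a *: u + v) w = a * dotv u w + dotv v w.
Proof. by rewrite !dotvE mulmxDl -scalemxAl !mxE. Qed.

Lemma dotvDl u v w : dotv (u + v) w = dotv u w + dotv v w.
Proof. by rewrite -[u]scale1r dotv_linl !scale1r mul1r. Qed.

Lemma dotv0l w : dotv 0 w = 0.
Proof. by rewrite dotvE mul0mx mxE. Qed.

Lemma dotvZl a u w : dotv (a *: u) w = a * dotv u w.
Proof. by rewrite -[_ *: u]addr0 dotv_linl dotv0l addr0. Qed.

Lemma dotv_suml (I : Type) (r : seq I) (F : I -> 'rV[R]_3) w :
  dotv (\sum_(i <- r) F i) w = \sum_(i <- r) dotv (F i) w.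
Proof.
by elim/big_rec2: _ => [|i y1 y2 _ <-]; [exact: dotv0l|exact: dotvDl].
Qed.

Lemma dotv_ge0 u : 0 <= dotv u u.
Proof. by apply: sumr_ge0 => c _; rewrite -expr2 sqr_ge0. Qed.

Lemma dotv_eq0 u : (dotv u u == 0) = (u == 0).
Proof.
apply/eqP/eqP => [|->]; last exact: dotv0l.
move/psumr_eq0P => u0; apply/rowP => c; rewrite mxE; apply/eqP.
by rewrite -sqrf_eq0 expr2; apply/eqP/u0 => // i _; rewrite -expr2 sqr_ge0.
Qed.

Lemma gram_unit d (A : 'M[R]_(d, 3)) : row_free A -> \det (A *m A^T) != 0.
Proof.
move=> Af; rewrite -unitfE -unitmxE -row_free_unit -kermx_eq0.
apply/rowV0P => u /sub_kermxP uA; apply/eqP; rewrite -(mulmx_free_eq0 _ Af) -dotv_eq0.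
by rewrite dotvE trmx_mul mulmxA -[u *m A *m A^T]mulmxA uA mul0mx mxE.
Qed.

End DotProduct.

Section Gram.
Context {R : realType} {x : 'I_4 -> 'rV[R]_3} (xT : tetrahedron x).

Lemma edge_mx_free d (gam : 'I_d.+1 -> 'I_4) : injective gam ->
  row_free (edge_mx (fun a => x (gam a))).
Proof.
move=> gamI; rewrite -kermx_eq0; apply/rowV0P => u /sub_kermxP; rewrite mulmx_sum_row => uE.
apply/rowP => j; rewrite mxE.
have := congr1 (fun w => dotv w (@grad R x (gam (lift ord0 j)))) uE.
rewrite dotv0l dotv_suml (bigD1 j) //= dotvZl rowK (dotv_grad_edge xT) eqxx.
rewrite (inj_eq gamI) eq_sym (negPf (neq_lift _ _)) subr0 mulr1 big1 ?addr0 // => l lj.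
rewrite dotvZl rowK (dotv_grad_edge xT) !(inj_eq gamI) (inj_eq lift_inj) eq_sym (negPf lj).
by rewrite [_ == ord0]eq_sym (negPf (neq_lift _ _)) subr0 mulr0.
Qed.

(** Positivity matters because the square root of a nonpositive number is 0, which would make every
    moment vanish. The determinant is nonzero by [gram_unit] and is a sum of squares, by Lagrange's
    identity for d = 2 and as a squared determinant for d = 3. *)
Lemma gram_gt0 d (gam : 'I_d.+1 -> 'I_4) : injective gam -> (0 < d < 4)%N ->
  0 < gram (fun a => x (gam a)).
Proof.
move=> gamI d4; rewrite /gram sqrtr_gt0.
have := gram_unit (edge_mx_free gamI); move: (edge_mx _) => A A0.
rewrite lt_def A0 /=; case: d d4 gam gamI A A0 => [|[|[|[|d]]]] // _ _ _ A _.
- rewrite det_mx11; have := dotv_ge0 (row 0 A); rewrite dotvE.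
  by rewrite !mxE; under eq_bigr do rewrite !mxE; under [X in _ -> 0 <= X]eq_bigr do rewrite !mxE.
- rewrite (expand_det_row _ ord0) !big_ord_recl big_ord0 /cofactor !det_mx11 !mxE /=.
  rewrite !big_ord_recl !big_ord0 !mxE /=.
  have -> : lift (lift ord0 ord0) (0 : 'I_1) = ord0 :> 'I_2 by exact/val_inj.
  have -> : lift ord0 (0 : 'I_1) = lift ord0 ord0 :> 'I_2 by exact/val_inj.
  pose i1 : 'I_3 := lift ord0 ord0; pose i2 : 'I_3 := lift ord0 (lift ord0 ord0).
  pose j1 : 'I_2 := lift ord0 ord0; rewrite -/i1 -/i2 -/j1.
  move: (A ord0 ord0) (A ord0 i1) (A ord0 i2) (A j1 ord0) (A j1 i1) (A j1 i2) => a b c a' b' c'.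
  rewrite [leRHS](_ : _ = (a * b' - b * a') ^+ 2 + (a * c' - c * a') ^+ 2 + (b * c' - c * b') ^+ 2).
    by rewrite !addr_ge0 ?sqr_ge0.
  by rewrite /bump /= expr0 expr1; ring.
- by rewrite det_mulmx det_tr -expr2 sqr_ge0.
Qed.

Lemma gram_vtx_gt0 d g : g \in Delta d -> (0 < d < 4)%N -> 0 < gram (@vtx R x d g).
Proof. by move=> gD; exact: (gram_gt0 (gam_of_inj gD)). Qed.

Lemma gram_cell_gt0 : 0 < gram x.
Proof. exact: (@gram_gt0 3 id). Qed.

End Gram.

(** * Test spaces and their moments *)

Section TestSpaces.
Context {R : realType}.

Lemma Pol_lin n m : lin_closed (@Pol R n m).
Proof.
split; first by left.
move=> a p q [->|pm]; first by rewrite scaler0 add0r.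
move=> [->|qm]; right.
  by rewrite addr0; apply: le_trans pm; rewrite lez_nat msizeZ_le.
have : (msize (a *: p + q) <= maxn (msize p) (msize q))%N.
  rewrite (leq_trans (msizeD_le _ _)) // geq_max leq_maxr andbT.
  by rewrite leq_max msizeZ_le.
by rewrite leq_max => /orP[h|h]; [apply: le_trans pm|apply: le_trans qm]; rewrite lez_nat.
Qed.

Lemma Pol_msize n m p : @Pol R n m p -> (msize p <= absz (m + 1)%R)%N.
Proof. by case=> [->|]; [rewrite msize0|lia]. Qed.

Lemma Pol_span n m :
  (@Pol R n m `<=` spanF (fun a : 'X_{1..n < absz (m + 1)} => 'X_[val a]))%classic.
Proof.
move=> p /Pol_msize pm; exists (fun a => p@_(val a)).
by rewrite -(mpolywE pm).
Qed.

Definition bubble_ok d (m : int) (r : seq int) (a : 'X_{1..d.+1}) : bool :=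
  ((mdeg a)%:Z == m) && [forall g : {set 'I_d.+1}, (0 < #|g| <= d)%N ==>
          (nth (-1) r #|g|.-1 < (\sum_(i | i \notin g) a i)%N%:Z)].

Lemma bubble_okP d m r (a : 'X_{1..d.+1}) :
  reflect ((mdeg a)%:Z = m /\ forall g : {set 'I_d.+1}, (0 < #|g| <= d)%N ->
          nth (-1) r #|g|.-1 < (\sum_(i | i \notin g) a i)%N%:Z) (bubble_ok m r a).
Proof.
apply: (iffP andP) => [[/eqP am /forallP ag]|[am ag]]; split=> //.
- by move=> g; apply/implyP.
- exact/eqP.
- by apply/forallP => g; apply/implyP; exact: ag.
Qed.

Definition bubble_idx d (m : int) (r : seq int) :=
  {a : 'X_{1..d.+1 < `|m|.+1} | bubble_ok m r (val a)}.

Definition bubble_gen n d (lam : 'I_d.+1 -> {mpoly R[n]}) m r (a : bubble_idx d m r) :=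
  \prod_i lam i ^+ (val (val a)) i.

Lemma bubble_span n d (lam : 'I_d.+1 -> {mpoly R[n]}) m r p :
  bubble lam m r p -> spanF (@bubble_gen n d lam m r) p.
Proof.
apply: lspan_sub; first exact: spanF_lin.
move=> _ [a [am ag ->]].
have ab : (mdeg a < `|m|.+1)%N by rewrite -am ltnS.
have aok : bubble_ok m r (val (BMultinom ab)) by apply/bubble_okP; split.
by have := spanF_gen (@bubble_gen n d lam m r) (exist _ (BMultinom ab) aok).
Qed.

Lemma bubble_lin n d (lam : 'I_d.+1 -> {mpoly R[n]}) m r : lin_closed (bubble lam m r).
Proof. exact: lspan_lin. Qed.

Lemma lin_closed_ker (V : lmodType R) (W : set V) (l : V -> R) : lin_closed W -> scalar l ->
  lin_closed [set v | W v /\ l v = 0]%classic.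
Proof.
move=> Wl ll; split; first by split; [case: Wl|exact: scalar0].
move=> a v w [Wv lv] [Ww lw]; split; first exact: (proj2 Wl).
by rewrite ll lv lw mulr0 addr0.
Qed.

(** By linearity, the functionals listed for the chosen basis control the whole test space, so that
    later arguments may pick any test function. *)
Lemma moments_zero (V : lmodType R) (J : finType) (u : J -> V) (W : set V)
    (l : {ffun 'I_3 -> {mpoly R[3]}} -> V -> R) v :
  lin_closed W -> (W `<=` spanF u)%classic -> scalar (l v) ->
  all (fun f : dof => f v == 0) (moments W l) -> forall q, W q -> l v q = 0.
Proof.
move=> Wl Wu ll; rewrite all_map => /allP l0.
apply: (basis_functional (basis_exists Wl Wu)) => //; first by move=> a q q' _ _; exact: ll.
by move=> q /l0 /eqP.
Qed.

Lemma size_moments (V : lmodType R) (W : set V)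
    (l : {ffun 'I_3 -> {mpoly R[3]}} -> V -> R) : size (moments W l) = ldim W.
Proof. by rewrite size_map. Qed.

Lemma pairing_scalar d (y : 'I_d.+1 -> 'rV[R]_3) p : scalar (pairing y p).
Proof.
move=> c q q'; rewrite !pairingE mulrDr -scalerAr linearP /=; ring.
Qed.

Lemma cell_int_scalar (x : 'I_4 -> 'rV[R]_3) : scalar (cell_int x).
Proof.
move=> c q q'; rewrite (cell_intE x (c *: q + q')) (cell_intE x q) (cell_intE x q').
by rewrite restr_lin linearP mulrDr mulrCA.
Qed.

End TestSpaces.

Section Degree.
Context {R : realType} {n : nat}.
Implicit Types p q : {mpoly R[n]}.

Lemma msize_mul_leq a b p q : (msize p <= a.+1)%N -> (msize q <= b.+1)%N ->
  (msize (p * q) <= (a + b).+1)%N.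
Proof.
move=> pa qb; have [->|p0] := eqVneq p 0; first by rewrite mul0r msize0.
have [->|q0] := eqVneq q 0; first by rewrite mulr0 msize0.
rewrite msizeM //; move: pa qb; move: (msize p) (msize q) => sp sq.
lia.
Qed.

Lemma msize_exp_leq a k p : (msize p <= a.+1)%N -> (msize (p ^+ k) <= (a * k).+1)%N.
Proof.
move=> pa; elim: k => [|k IH]; first by rewrite expr0 msize1.
by rewrite exprS mulnS; exact: msize_mul_leq.
Qed.

Lemma msize_prod_leq (I : Type) (r : seq I) (e : I -> nat) (F : I -> {mpoly R[n]}) :
  (forall i, (msize (F i) <= (e i).+1)%N) ->
  (msize (\prod_(i <- r) F i) <= (\sum_(i <- r) e i).+1)%N.
Proof.
move=> Fe; elim/big_rec2: _ => [|i m p _]; first by rewrite msize1.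
exact: msize_mul_leq.
Qed.

End Degree.

Lemma homog_mdeg (R : realType) n k (P : {mpoly R[n]}) m :
  P \is k.-homog -> m \in msupp P -> mdeg m = k.
Proof. by move=> /dhomogP Pk; exact: Pk. Qed.

Section StandardSimplex.
Context {R : realType} {d : nat}.

Lemma bary_std_ge0 (s : 'I_d -> R) a : (forall j, 0 <= s j) -> \sum_j s j <= 1 ->
  0 <= (@bary_std R d a).@[s].
Proof. by move=> s0 s1; rewrite meval_bary_std; case: unlift => // ; rewrite subr_ge0. Qed.

Lemma Int_bary_std_gt0 (e : 'I_d.+1 -> nat) :
  0 < Int (\prod_a @bary_std R d a ^+ e a).
Proof.
rewrite Int_bary_std divr_gt0 // ltr0n ?fact_gt0 //.
by apply: prodn_gt0 => i; rewrite fact_gt0.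
Qed.

Lemma bary_std_prod_neq0 (e : 'I_d.+1 -> nat) : \prod_a @bary_std R d a ^+ e a != 0.
Proof. by apply: contraTneq (Int_bary_std_gt0 e) => ->; rewrite raddf0 ltxx. Qed.

Lemma msize_bary_std (a : 'I_d.+1) : (msize (@bary_std R d a) <= 2)%N.
Proof.
rewrite /bary_std /bary_of; case: unlift => [j|]; first by rewrite msizeX mdeg1.
rewrite (leq_trans (msizeD_le _ _)) // msizeN msize1 geq_max /=.
rewrite (leq_trans (msize_sum _ _ _)) //; apply/bigmax_leqP_seq => l _ _ //.
by rewrite msizeX mdeg1.
Qed.

End StandardSimplex.

Lemma ord2_rev (a : 'I_2) : a != rev_ord a.
Proof. by case: a => -[|[|]]. Qed.

Lemma ord2_eq (a c : 'I_2) : c != rev_ord a -> c = a.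
Proof. by case: a c => -[|[|//]] ? [[|[|//]] ?] // _; exact/val_inj. Qed.

(** * Traces determined by their moments *)

Section Dofs.
Context {R : realType} {x : 'I_4 -> 'rV[R]_3} (xT : tetrahedron x).
Implicit Types (u p : {mpoly R[3]}) (e f g : {set 'I_4}) (m : 'X_{1..4}).
Local Notation bernstein := (@bernstein R x).
Local Notation vanish := (@vanish R x).
Local Notation zero_on := (@zero_on R x).

Lemma dist_out g m : dist g m = 0%N -> forall i, i \notin g -> m i = 0%N.
Proof.
by move=> /eqP; rewrite dist_eq0 => /forallP mg i ig; have := mg i; rewrite ig => /eqP.
Qed.

Lemma dist_split d (gam : 'I_d.+1 -> 'I_4) m : injective gam -> dist (gset gam) m = 0%N ->
  mdeg m = (\sum_a m (gam a))%N.
Proof.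
move=> gamI /dist_out m0; rewrite mdegE (bigID (mem (gset gam))) /=.
rewrite [X in (_ + X)%N]big1 ?addn0 => [|i]; last exact: m0.
by rewrite big_imset //= => a b _ _; exact: gamI.
Qed.

(** Vanishing to order S at both ends forces both exponents of every monomial of the trace to be at
    least S. The trace is thus [w * q], where w is the S-th power of the product of the two
    barycentric coordinates and q has degree at most [M - 2S]. So q is an admissible test function,
    and the integral of [w * q ^+ 2] vanishes only for q = 0. *)
Lemma edge_dof e M S u : e \in Delta 1 -> bernstein M u ->
  (forall i, i \in e -> vanish [set i]%SET S u) ->
  (forall q, @Pol R 1 (M%:Z - 2 * S%:Z) q -> pairing (@vtx R x 1 e) u q = 0) ->
  zero_on e u.
Proof.
move=> eD [P PM ->] vP uq; apply: (zero_on_restr eD).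
pose gam := gam_of (d := 1) (g := e); have gamI : injective gam := gam_of_inj eD.
have ge : gset gam = e := gset_gam_of eD.
pose ex m (a : 'I_2) := m (gam a).
have exS m a : P@_m != 0 -> dist e m = 0%N -> (S <= ex m a)%N.
  move=> Pm me; rewrite leqNgt; apply: contraNN Pm => mS.
  pose b : 'I_2 := rev_ord a.
  have ge' : gam b \in e by rewrite -ge; exact: imset_f.
  apply/eqP; apply: (vanish_coef xT (g := [set gam b]%SET) _ PM (vP _ ge')).
    by apply/finset.set0Pn; exists (gam b); rewrite finset.inE.
  apply: leq_trans mS; rewrite ltnS /dist.
  have ba : gam a != gam b.
    by rewrite (inj_eq gamI) ord2_rev.
  rewrite (bigD1 (gam a)) ?finset.inE //= big1 ?addn0 // => i.
  rewrite finset.inE => /andP[ib ia]; apply: (dist_out me).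
  rewrite -ge; apply/imsetP => -[c _ ic]; move: ib ia; rewrite ic !(inj_eq gamI).
  by move=> /ord2_eq ->; rewrite eqxx.
pose q := \sum_(m <- msupp P | dist e m == 0%N) P@_m *: \prod_a @bary_std R 1 a ^+ (ex m a - S).
pose w := \prod_(a < 2) @bary_std R 1 a ^+ S.
have rE : restr (@vtx R x 1 e) (@bern R x P) = w * q.
  rewrite (restr_bern xT gamI) -/gam ge /q mulr_sumr big_seq_cond [RHS]big_seq_cond.
  apply: eq_bigr => m /andP[mP /eqP me]; rewrite -scalerAr; congr (_ *: _).
  rewrite /w -big_split; apply: eq_bigr => a _ /=.
  by rewrite -exprD subnKC // exS // -mcoeff_msupp.
have qP : @Pol R 1 (M%:Z - 2 * S%:Z) q.
  rewrite /q big_seq_cond; apply: lin_closed_sum; first exact: Pol_lin.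
  move=> m /andP[mP /eqP me]; apply: lin_closedZ; first exact: Pol_lin.
  right; have mM : mdeg m = M := homog_mdeg PM mP.
  have := @msize_prod_leq R 1 _ (index_enum _) (fun a : 'I_2 => (1 * (ex m a - S))%N) _
     (fun a => msize_exp_leq (ex m a - S) (msize_bary_std a)).
  have mP' : P@_m != 0 by rewrite -mcoeff_msupp.
  have := exS _ ord0 mP' me; have := exS _ (lift ord0 ord0) mP' me.
  move: mM; rewrite (dist_split gamI); last by rewrite ge.
  rewrite !big_ord_recl !big_ord0 -/(ex m ord0) -/(ex m (lift ord0 ord0)).
  by lia.
have := uq q qP; rewrite pairingE rE => /eqP; rewrite mulf_eq0.
rewrite (gt_eqF (gram_vtx_gt0 xT eD isT)) /= -mulrA -expr2 => /eqP/Int_weighted_sqr_eq0 ->.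
- by rewrite mulr0.
- move=> s s0 s1; rewrite meval_prod; apply: prodr_ge0 => a _; rewrite meval_exp exprn_ge0 //.
  exact: bary_std_ge0.
- exact: (bary_std_prod_neq0 (fun=> S)).
Qed.

Lemma face_bubble f M Sv Se (a b : int) u : f \in Delta 2 -> bernstein M u ->
  (forall i, i \in f -> vanish [set i]%SET Sv u) ->
  (forall e, e \in Delta 1 -> e \subset f -> vanish e Se u) ->
  a < Sv%:Z -> b < Se%:Z ->
  bubbleF M%:Z a b (restr (@vtx R x 2 f) u).
Proof.
move=> fD [P PM ->] vv ve aS bS.
pose gam := gam_of (d := 2) (g := f); have gamI : injective gam := gam_of_inj fD.
have gf : gset gam = f := gset_gam_of fD.
apply: (restr_bubble xT gamI PM) => m Pm _ g' /andP[g0 g2].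
have g'f : (gam @: g' \subset f)%SET.
  by rewrite -gf; apply/fintype.subsetP => _ /imsetP[c _ ->]; exact: imset_f.
have cg : #|(gam @: g')%SET| = #|g'| by rewrite card_imset.
have gn : (gam @: g')%SET != finset.set0 by rewrite -card_gt0 cg.
case: (ltngtP #|g'| 1) g0 g2 => //.
  move=> g1 _ g2; have {g1 g2} g2 : #|g'| = 2 by apply/eqP; rewrite eqn_leq g2.
  rewrite g2 /=; apply: lt_le_trans bS _; rewrite lez_nat leqNgt.
  apply: contraNN Pm => /(vanish_coef xT gn PM _) -> //.
  by apply: ve => //; rewrite mem_enum finset.inE cg g2.
move=> g1 _ _; rewrite g1 /=; apply: lt_le_trans aS _; rewrite lez_nat leqNgt.
apply: contraNN Pm => /(vanish_coef xT gn PM _) -> //.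
have /eqP/cards1P[i gi] : #|(gam @: g')%SET| = 1 by rewrite cg.
rewrite gi; apply: vv; apply: (fintype.subsetP g'f); by rewrite gi finset.inE.
Qed.

(** The trace belongs to the space it is tested against, so its square has zero integral. *)
Lemma face_dof f M a b u : f \in Delta 2 ->
  bubbleF M%:Z a b (restr (@vtx R x 2 f) u) ->
  (forall q, bubbleF M%:Z a b q -> pairing (@vtx R x 2 f) u q = 0) ->
  zero_on f u.
Proof.
move=> fD uB uq; apply: (zero_on_restr fD).
have := uq _ uB; rewrite pairingE => /eqP; rewrite mulf_eq0.
by rewrite (gt_eqF (gram_vtx_gt0 xT fD isT)) /= -expr2 => /eqP/Int_sqr_eq0.
Qed.

Lemma cell_bubble M Sv Se Sf (r : smoothness) u : bernstein M u ->
  (forall i, vanish [set i]%SET Sv u) ->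
  (forall e, e \in Delta 1 -> vanish e Se u) ->
  (forall f, f \in Delta 2 -> vanish f Sf u) ->
  rv r < Sv%:Z -> re r < Se%:Z -> rf r < Sf%:Z ->
  bubbleT x M%:Z r u.
Proof.
move=> [P PM ->] vv ve vf rS eS fS; rewrite (mpolyE P) bern_sum big_seq.
apply: lin_closed_sum; first exact: bubble_lin.
move=> m mP; rewrite bernZ; apply: lin_closedZ; first exact: bubble_lin.
have mM : mdeg m = M := homog_mdeg PM mP.
apply: lspan_gen; exists m; split; [by rewrite mM| |exact: bernX].
have Pm : P@_m != 0 by rewrite -mcoeff_msupp.
move=> g /andP[g0 g3]; have gn : g != finset.set0 by rewrite -card_gt0.
suff : exists S : nat, nth (-1) [:: rv r; re r; rf r] #|g|.-1 < S%:Z /\ vanish g S (@bern R x P).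
  move=> [S [rS' vS]]; apply: lt_le_trans rS' _; rewrite lez_nat leqNgt.
  by apply: contraNN Pm => /(vanish_coef xT gn PM vS) ->.
case gc : #|g| g0 g3 => [|[|[|[|c]]]] //= _ _.
- have /eqP/cards1P[i gi] := gc; exists Sv; split=> //; rewrite gi; exact: vv.
- by exists Se; split=> //; apply: ve; rewrite mem_enum finset.inE gc.
- by exists Sf; split=> //; apply: vf; rewrite mem_enum finset.inE gc.
Qed.

Lemma restr_cell_eq0 p : restr x p = 0 -> p = 0.
Proof.
move=> p0; apply: mpoly_eq0 => s; pose a : 'rV[R]_3 := \row_j s j.
rewrite (meval_eq (v2 := fun j => a 0 j)) => [|j]; last by rewrite mxE.
have := meval_restr x p (fun j => ev (bary x (lift ord0 j)) a).
rewrite p0 meval0 /ev => E; rewrite [RHS]E; congr (meval _ p); apply: funext => c.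
congr (fun_of_matrix _ _ _); rewrite -[LHS](bary_comb xT) big_ord_recl.
have -> : ev (bary x ord0) a = 1 - \sum_(j < 3) ev (bary x (lift ord0 j)) a.
  by rewrite bary0 evB ev_sum /ev meval1.
rewrite scalerBl scale1r /affpt -addrA; congr (_ + _).
rewrite scaler_suml addrC -sumrB; apply: eq_bigr => j _.
by rewrite scalerBr.
Qed.

Lemma cell_eq0 p : cell_int x (p ^+ 2) = 0 -> p = 0.
Proof.
rewrite cell_intE => /eqP; rewrite mulf_eq0 (gt_eqF (gram_cell_gt0 xT)) /=.
by rewrite expr2 restrM -expr2 => /eqP/Int_sqr_eq0/restr_cell_eq0.
Qed.

End Dofs.

(** * Vector fields and divergence *)

Section VectorFields.
Context {R : realType}.
Local Notation vpoly := {ffun 'I_3 -> {mpoly R[3]}}.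
Implicit Types (v w : vpoly) (n m t : 'rV[R]_3) (B : 'M[R]_3).

Lemma dotc_vlin v a n m : dotc v (a *: n + m) = a *: dotc v n + dotc v m.
Proof.
rewrite /dotc scaler_sumr -big_split; apply: eq_bigr => c _.
by rewrite !mxE scalerDl scalerA.
Qed.

Lemma dotc_v0 v : dotc v 0 = 0.
Proof. by rewrite /dotc big1 // => c _; rewrite mxE scale0r. Qed.

Lemma dotc_lin a v w n : dotc (a *: v + w) n = a *: dotc v n + dotc w n.
Proof.
rewrite /dotc scaler_sumr -big_split; apply: eq_bigr => c _.
by rewrite !ffunE scalerDr !scalerA mulrC.
Qed.

Lemma dotc_lincomb v (I : Type) (r : seq I) (a : I -> R) (F : I -> 'rV[R]_3) :
  dotc v (\sum_(i <- r) a i *: F i) = \sum_(i <- r) a i *: dotc v (F i).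
Proof.
by elim/big_rec2: _ => [|i p q _ <-]; [exact: dotc_v0|exact: dotc_vlin].
Qed.

Lemma dderiv_lincomb p (I : Type) (r : seq I) (a : I -> R) (F : I -> 'rV[R]_3) :
  dderiv (\sum_(i <- r) a i *: F i) p = \sum_(i <- r) a i *: dderiv (F i) p.
Proof.
by elim/big_rec2: _ => [|i q q' _ <-]; [exact: dderiv_v0|exact: dderiv_vlin].
Qed.

Lemma dotc_delta v c : dotc v (delta_mx 0 c) = v c.
Proof.
rewrite /dotc (bigD1 c) //= mxE !eqxx scale1r big1 ?addr0 // => i /negPf ic.
by rewrite mxE ic andbF scale0r.
Qed.

Lemma divg_lin a v w : divg (a *: v + w) = a *: divg v + divg w.
Proof.
rewrite /divg scaler_sumr -big_split; apply: eq_bigr => c _.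
by rewrite !ffunE mderivD mderivZ.
Qed.

Lemma row_basis B n : B \in unitmx -> n = \sum_i (n *m invmx B) 0 i *: row i B.
Proof. by move=> Bu; rewrite -mulmx_sum_row mulmxKV. Qed.

Definition dual B : 'M[R]_3 := (invmx B)^T.

Lemma dual_dot B i j : B \in unitmx -> dotv (row i B) (row j (dual B)) = (i == j)%:R.
Proof.
move=> Bu; have := congr1 (fun M : 'M_3 => M i j) (mulmxV Bu).
by rewrite !mxE => <-; apply: eq_bigr => c _; rewrite !mxE.
Qed.

(** Trace of the Jacobian matrix in an arbitrary basis paired with its dual basis: the normals of an
    edge and the tangents of a face are independent but not orthogonal. *)
Lemma divg_frame B v : B \in unitmx ->
  divg v = \sum_i dderiv (row i (dual B)) (dotc v (row i B)).
Proof.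
move=> Bu; rewrite /dderiv /dotc /divg.
transitivity (\sum_c \sum_c' ((invmx B *m B) c c' *: (v c')^`M(c))).
  apply: eq_bigr => c _; rewrite mulVmx // (bigD1 c) //= mxE eqxx scale1r big1 ?addr0 //.
  by move=> c' /negPf cc'; rewrite mxE eq_sym cc' scale0r.
rewrite [RHS]exchange_big; apply: eq_bigr => c _ /=.
under [RHS]eq_bigr do rewrite mderiv_sum scaler_sumr.
rewrite [RHS]exchange_big; apply: eq_bigr => c' _ /=.
rewrite mxE scaler_suml; apply: eq_bigr => i _.
by rewrite mderivZ scalerA !mxE.
Qed.

Definition frame3 (a b c : 'rV[R]_3) : 'M[R]_3 :=
  \matrix_(i < 3) (if i == ord0 then a else if i == lift ord0 ord0 then b else c).

Lemma sum_frame3 (V : lmodType R) (G : 'rV[R]_3 -> V) (F : 'I_3 -> R) a b c :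
  \sum_i F i *: G (row i (frame3 a b c)) =
  F ord0 *: G a + F (lift ord0 ord0) *: G b + F (lift ord0 (lift ord0 ord0)) *: G c.
Proof. by rewrite !big_ord_recl big_ord0 !rowK addr0 addrA. Qed.

Lemma free2 (b c : 'rV[R]_3) p q : free [:: b; c] -> p *: b + q *: c = 0 ->
  p = 0 /\ q = 0.
Proof.
move=> /freeP/(_ (fun i : 'I_2 => if i == ord0 then p else q)) f E.
have {}f := f _; split.
  by have := f _ ord0; apply; rewrite !big_ord_recl big_ord0 addr0.
by have := f _ (lift ord0 ord0); apply; rewrite !big_ord_recl big_ord0 addr0.
Qed.

Lemma frame3_unit a b c : a != 0 -> dotv b a = 0 -> dotv c a = 0 -> free [:: b; c] ->
  frame3 a b c \in unitmx.
Proof.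
move=> a0 ba ca bc; rewrite -row_free_unit -kermx_eq0; apply/rowV0P => u /sub_kermxP.
rewrite mulmx_sum_row (sum_frame3 id) => E.
have u0 : u 0 ord0 = 0.
  have := congr1 (fun n => dotv n a) E.
  rewrite dotv0l !dotvDl !dotvZl ba ca !mulr0 !addr0 => /eqP.
  by rewrite mulf_eq0 dotv_eq0 (negPf a0) orbF => /eqP.
move: E; rewrite u0 scale0r add0r => /(free2 bc)[u1 u2].
apply/rowP => i; rewrite mxE; case: (unliftP ord0 i) => [j|] -> //.
case: (unliftP ord0 j) => [l|] -> //.
by rewrite [l]ord1.
Qed.

(* This is why (D3) prescribes no derivative of v.n2 along n2. *)
Lemma divfree_edge t n1 n2 : t != 0 -> dotv n1 t = 0 -> dotv n2 t = 0 ->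
  free [:: n1; n2] -> exists a m1 m2, forall v, divg v = 0 ->
  dderiv n2 (dotc v n2) =
    a *: dderiv n1 (dotc v n2) + (dderiv m1 (dotc v t) + dderiv m2 (dotc v n1)).
Proof.
move=> t0 n1t n2t nf; have Bu := frame3_unit t0 n1t n2t nf.
set B := frame3 t n1 n2 in Bu.
pose n2' := row (lift ord0 (lift ord0 ord0)) (dual B).
have rB i : row i B = if i == ord0 then t else if i == lift ord0 ord0 then n1 else n2 by rewrite rowK.
have tn2 : dotv t n2' = 0 by have := dual_dot ord0 (lift ord0 (lift ord0 ord0)) Bu; rewrite rB.
have n1n2 : dotv n1 n2' = 0.
  by have := dual_dot (lift ord0 ord0) (lift ord0 (lift ord0 ord0)) Bu; rewrite rB.
have n2n2 : dotv n2 n2' = 1.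
  by have := dual_dot (lift ord0 (lift ord0 ord0)) (lift ord0 (lift ord0 ord0)) Bu; rewrite rB.
have [b0 [b1 [b2 n2E]]] : exists b0 b1 b2, n2' = b0 *: t + b1 *: n1 + b2 *: n2.
  by do 3!eexists; rewrite {1}(row_basis n2' Bu) (sum_frame3 id).
have b00 : b0 = 0.
  apply/eqP; have := tn2; rewrite dotvC n2E !dotvDl !dotvZl n1t n2t !mulr0 !addr0 => /eqP.
  by rewrite mulf_eq0 dotv_eq0 (negPf t0) orbF.
(* [n2'] lies in the span of n1 and n2 and is orthogonal to n1; without a component along n2 it
   would be orthogonal to itself. *)
have b20 : b2 != 0.
  apply: contra_eq_neq (n2n2) => b20.
  have : dotv n2' n2' == 0.
    by rewrite {1}n2E b00 b20 !dotvDl !dotvZl n1n2 !mul0r mulr0 !addr0.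
  by rewrite dotv_eq0 => /eqP ->; rewrite dotvC dotv0l eq_sym oner_neq0.
exists (- (b1 / b2)), (- b2^-1 *: row ord0 (dual B)), (- b2^-1 *: row (lift ord0 ord0) (dual B)).
move=> v; rewrite (divg_frame v Bu) !big_ord_recl big_ord0 addr0 !rB /= -/n2' n2E b00.
rewrite scale0r add0r dderiv_vD !dderiv_vZ.
move: (dderiv n1 (dotc v n2)) (dderiv n2 (dotc v n2)) (dderiv _ (dotc v t))
  (dderiv _ (dotc v n1)) => X Y Z W E.
have {}E : b2 *: Y = - (b1 *: X + (Z + W)).
  rewrite -!mul_mpolyC in E *; apply/eqP; rewrite -subr_eq0; apply/eqP.
  by rewrite -[RHS]E; ring.
apply: (scalerI b20); rewrite E opprD opprD !scalerDr !scalerA !mulrN mulrCA.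
by rewrite !mulfV // mulr1 !scaleNr !scale1r.
Qed.

(** As n is a unit vector orthogonal to t1 and t2, it is its own dual vector, and the other two dual
    vectors are tangential. Zero divergence thus trades the normal derivative of v.n for tangential
    derivatives of tangential components. *)
Lemma divfree_face n t1 t2 : dotv n n = 1 -> dotv t1 n = 0 -> dotv t2 n = 0 ->
  free [:: t1; t2] ->
  exists m1 m2, [/\ exists p q, m1 = p *: t1 + q *: t2, exists p q, m2 = p *: t1 + q *: t2 &
  forall v, divg v = 0 ->
  dderiv n (dotc v n) = dderiv m1 (dotc v t1) + dderiv m2 (dotc v t2)].
Proof.
move=> nn t1n t2n tf.
have n0 : n != 0 by rewrite -dotv_eq0 nn oner_eq0.
have Bu := frame3_unit n0 t1n t2n tf.
set B := frame3 n t1 t2 in Bu.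
have rB i : row i B = if i == ord0 then n else if i == lift ord0 ord0 then t1 else t2 by rewrite rowK.
have tang j : j != ord0 -> exists p q, row j (dual B) = p *: t1 + q *: t2.
  move=> j0; do 2!eexists; rewrite {1}(row_basis (row j (dual B)) Bu) (sum_frame3 id).
  have := dual_dot ord0 j Bu; rewrite rB eqxx eq_sym (negPf j0) dotvC.
  rewrite {1}(row_basis (row j (dual B)) Bu) (sum_frame3 id) !dotvDl !dotvZl nn t1n t2n.
  by rewrite !mulr0 !addr0 mulr1 => ->; rewrite scale0r add0r.
have dot0 j : dotv (row j B) (row ord0 (dual B)) = (j == ord0)%:R by rewrite dual_dot.
have dn : row ord0 (dual B) = n.
  have [b0 [b1 [b2 nE]]] : exists b0 b1 b2, row ord0 (dual B) = b0 *: n + b1 *: t1 + b2 *: t2.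
    by do 3!eexists; rewrite {1}(row_basis (row ord0 (dual B)) Bu) (sum_frame3 id).
  have := dot0 ord0; have := dot0 (lift ord0 ord0); have := dot0 (lift ord0 (lift ord0 ord0)).
  rewrite !rB /= => d2 d1 d0.
  have b01 : b0 = 1.
    by move: d0; rewrite dotvC nE !dotvDl !dotvZl nn t1n t2n !mulr0 !addr0 mulr1.
  set m := row ord0 (dual B) in nE d0 d1 d2 *.
  have mE : m - n = b1 *: t1 + b2 *: t2.
    by rewrite nE b01 scale1r addrC !addrA addNr add0r.
  have mt t : dotv t m = 0 -> dotv t n = 0 -> dotv t (m - n) = 0.
    by move=> tm tn; rewrite dotvC addrC -scaleN1r dotv_linl dotvC tn mulr0 add0r dotvC.
  apply/eqP; rewrite -subr_eq0 -dotv_eq0 {1}mE dotvDl !dotvZl !mt //.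
  by rewrite !mulr0 addr0.
exists (- 1 *: row (lift ord0 ord0) (dual B)), (- 1 *: row (lift ord0 (lift ord0 ord0)) (dual B)).
have tangN t : (exists p q, t = p *: t1 + q *: t2) -> exists p q, - 1 *: t = p *: t1 + q *: t2.
  by move=> [p [q ->]]; exists (- p), (- q); rewrite scalerDr !scalerA !mulN1r.
split; [exact/tangN/tang|exact/tangN/tang|].
move=> v; rewrite (divg_frame v Bu) !big_ord_recl big_ord0 addr0 !rB /= dn => /eqP.
by rewrite addr_eq0 => /eqP ->; rewrite !dderiv_vZ !scaleN1r opprD.
Qed.

End VectorFields.

(** * Vanishing on edges and faces from normal derivatives *)

Section VanishingCriteria.
Context {R : realType} {x : 'I_4 -> 'rV[R]_3} (xT : tetrahedron x).
Local Notation vpoly := {ffun 'I_3 -> {mpoly R[3]}}.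
Implicit Types (u p : {mpoly R[3]}) (v : vpoly) (e f g : {set 'I_4}) (n t : 'rV[R]_3).
Local Notation bernstein := (@bernstein R x).
Local Notation vanish := (@vanish R x).
Local Notation zero_on := (@zero_on R x).

Lemma bernstein_iter k j n p : bernstein k p -> bernstein (k - j) (iter j (dderiv n) p).
Proof.
move=> pk; elim: j => [|j IH]; first by rewrite subn0.
by rewrite iterS subnS; exact: bernstein_dderiv.
Qed.

Lemma iter_dderivC n m j p :
  iter j (dderiv n) (dderiv m p) = dderiv m (iter j (dderiv n) p).
Proof. by elim: j => // j IH; rewrite !iterS IH dderiv_comm. Qed.

Lemma iter_dderiv_lin n j c p q :
  iter j (dderiv n) (c *: p + q) = c *: iter j (dderiv n) p + iter j (dderiv n) q.
Proof. by elim: j => // j IH; rewrite !iterS IH dderiv_lin. Qed.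

Lemma iter_dderiv0 n j : iter j (dderiv n) 0 = 0 :> {mpoly R[3]}.
Proof. by elim: j => // j IH; rewrite iterS IH dderiv0. Qed.

Lemma iter_dderivZ n j c p : iter j (dderiv n) (c *: p) = c *: iter j (dderiv n) p.
Proof. by rewrite -[_ *: p]addr0 iter_dderiv_lin iter_dderiv0 addr0. Qed.

Lemma iter_dderivD n j p q :
  iter j (dderiv n) (p + q) = iter j (dderiv n) p + iter j (dderiv n) q.
Proof. by rewrite -[p]scale1r iter_dderiv_lin !scale1r. Qed.

Lemma zero_onZ g c p : zero_on g p -> zero_on g (c *: p).
Proof. by move=> zp; rewrite -[_ *: p]addr0; apply: zero_on_lin => //; exact: zero_on0. Qed.

Lemma zero_onD g p q : zero_on g p -> zero_on g q -> zero_on g (p + q).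
Proof. by move=> zp zq; rewrite -[p]scale1r; exact: zero_on_lin. Qed.

Lemma zero_on_tangent d g t k u : g \in Delta d -> tangent_to (@vtx R x d g) t ->
  bernstein k u -> zero_on g u -> zero_on g (dderiv t u).
Proof.
move=> gD /submxP[D ->] uk zu; rewrite mulmx_sum_row dderiv_lincomb.
have gin a : nth ord0 (enum g) (a : 'I_d.+1) \in g.
  by rewrite -mem_enum mem_nth // (size_enum_Delta gD).
elim/big_rec: _ => [|j q _ zq]; first exact: zero_on0.
apply: zero_on_lin => //; rewrite rowK.
by apply: (zero_on_edge_deriv xT uk zu); exact: gin.
Qed.

Lemma vertex_vanish i r p :
  (forall m, (mdeg m < r)%N -> ev (p^`M[m]) (x i) = 0) -> vanish [set i]%SET r p.
Proof.
elim: r p => [//|r IH] p pm; split=> [y yi y1|n].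
  have -> : \sum_j y j *: x j = x i.
    have yi1 : y i = 1.
      rewrite -y1 (bigD1 i) //= big1 ?addr0 // => j ji.
      by rewrite yi // finset.inE.
    rewrite (bigD1 i) //= yi1 scale1r big1 ?addr0 // => j ji.
    by rewrite yi ?scale0r // finset.inE.
  by have := pm 0%MM; rewrite mdeg0 mderivm0m; exact.
rewrite /dderiv; apply: vanish_sum => c; apply/vanishZ/IH => m mr.
by rewrite -mderivmU1m -mderivmDm; apply: pm; rewrite mdegD mdeg1 add1n.
Qed.

Section Edge.
Variables (e : {set 'I_4}) (t n1 n2 : 'rV[R]_3).
Hypotheses (eD : e \in Delta 1) (et : tangent_to (@vtx R x 1 e) t).
Local Notation D1 i := (iter i (dderiv n1)).
Local Notation D2 l := (iter l (dderiv n2)).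

(** Only derivatives along the two normals are recorded; those along t preserve vanishing on e,
    which is how [edge_vanish] recovers all directions. *)
Definition edge_zero r p := forall i l, (i + l < r)%N -> zero_on e (D1 i (D2 l p)).

Lemma edge_zero_lin r c p q : edge_zero r p -> edge_zero r q -> edge_zero r (c *: p + q).
Proof.
move=> zp zq i l il; rewrite !iter_dderiv_lin.
by apply: zero_on_lin; [exact: zp|exact: zq].
Qed.

Lemma edge_zero0 r : edge_zero r 0.
Proof.
by move=> i l _; rewrite !iter_dderiv0; exact: zero_on0.
Qed.

Lemma edge_zeroD r p q : edge_zero r p -> edge_zero r q -> edge_zero r (p + q).
Proof. by move=> zp zq; rewrite -[p]scale1r; exact: edge_zero_lin. Qed.

Lemma edge_zeroZ r c p : edge_zero r p -> edge_zero r (c *: p).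
Proof. by move=> zp; rewrite -[_ *: p]addr0; apply: edge_zero_lin => //; exact: edge_zero0. Qed.

Hypothesis Bu : frame3 t n1 n2 \in unitmx.

Lemma edge_zero_dderiv r k n p : bernstein k p ->
  edge_zero r.+1 p -> edge_zero r (dderiv n p).
Proof.
move=> pk zp; rewrite (row_basis n Bu) dderiv_lincomb.
rewrite (sum_frame3 (fun n => dderiv n p)).
apply: edge_zeroD; first apply: edge_zeroD; apply: edge_zeroZ => i l il.
- rewrite !iter_dderivC; apply: (zero_on_tangent eD et); last exact/zp/ltnW.
  by apply: bernstein_iter; apply: bernstein_iter; exact: pk.
- by rewrite iter_dderivC -iterSr; apply: zp; rewrite addSn ltnS.
- by rewrite -iterSr; apply: zp; rewrite addnS.
Qed.

Lemma edge_vanish r k p : bernstein k p -> edge_zero r p -> vanish e r p.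
Proof.
elim: r k p => [//|r IH] k p pk zp; split; first exact: (zp 0%N 0%N).
move=> n; apply: IH; [exact: bernstein_dderiv pk|exact: edge_zero_dderiv pk zp].
Qed.

(** A derivative of order j lowers both the degree k and the order A at the endpoints by j, so that
    [edge_dof] asks for test polynomials of degree [(k - j) - 2 (A - j) = k - 2 A + j]: this is the
    degree in the edge moments. *)
Lemma edge_zero_dofs k A B p : bernstein k p -> (B <= A)%N -> (B <= k.+1)%N ->
  (forall i, i \in e -> vanish [set i]%SET A p) ->
  forall i l, (i + l < B)%N -> (forall q, @Pol R 1 (k%:Z - 2 * A%:Z + (i + l)%N%:Z) q ->
      pairing (@vtx R x 1 e) (D1 i (D2 l p)) q = 0) ->
  zero_on e (D1 i (D2 l p)).
Proof.
move=> pk BA Bk vA i l il uq; apply: (edge_dof xT (M := k - (i + l)) (S := A - (i + l)) eD).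
- by rewrite addnC subnDA; do 2!apply: bernstein_iter.
- by move=> a ae; rewrite addnC subnDA; do 2!apply: vanish_iter; exact: vA.
- move=> q qP; apply: uq; move: qP; congr (Pol _ q); lia.
Qed.

(** Induction on the number l of derivatives along n2: [divfree_edge] replaces one of them by a
    derivative along n1 and by derivatives of v.t and v.n1 of the same order, until only derivatives
    along n1 remain. *)
Lemma edge_zero_divfree B k v : (forall c, bernstein k (v c)) -> divg v = 0 ->
  t != 0 -> dotv n1 t = 0 -> dotv n2 t = 0 -> free [:: n1; n2] ->
  edge_zero B (dotc v t) -> edge_zero B (dotc v n1) ->
  (forall j, (j < B)%N -> zero_on e (D1 j (dotc v n2))) ->
  edge_zero B (dotc v n2).
Proof.
move=> vk dv t0 n1t n2t nf zt z1 z2.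
have dk n : bernstein k (dotc v n) by apply: bernstein_sum => c _; apply: bernsteinZ.
have [a [m1 [m2 /(_ v dv) E]]] := divfree_edge t0 n1t n2t nf.
move=> i l; elim: l i => [|l IH] i il; first by apply: z2; rewrite addn0 in il.
rewrite iterSr E; case: B il zt z1 IH {z2} => [//|r]; rewrite addnS ltnS => il zt z1 IH.
rewrite !iter_dderiv_lin; apply: zero_on_lin.
  by rewrite iter_dderivC -iterSr; apply: IH; rewrite addSn ltnS.
by apply: (edge_zeroD (edge_zero_dderiv m1 (dk t) zt) (edge_zero_dderiv m2 (dk n1) z1)).
Qed.

End Edge.

Section Face.
Variables (f : {set 'I_4}) (n t1 t2 : 'rV[R]_3).
Hypotheses (fD : f \in Delta 2) (ft1 : tangent_to (@vtx R x 2 f) t1)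
  (ft2 : tangent_to (@vtx R x 2 f) t2).
Hypothesis Bu : frame3 n t1 t2 \in unitmx.

Lemma face_vanish r k p : bernstein k p ->
  (forall j, (j < r)%N -> zero_on f (iter j (dderiv n) p)) -> vanish f r p.
Proof.
elim: r k p => [//|r IH] k p pk zp; split; first exact: (zp 0%N).
move=> m; apply: (IH k.-1); first exact: bernstein_dderiv.
move=> j jr; rewrite (row_basis m Bu) dderiv_lincomb.
rewrite (sum_frame3 (fun n => dderiv n p)) !iter_dderivD !iter_dderivZ.
have tang t : tangent_to (@vtx R x 2 f) t -> zero_on f (iter j (dderiv n) (dderiv t p)).
  move=> ft; rewrite iter_dderivC; apply: (zero_on_tangent fD ft); last exact/zp/ltnW.
  by apply: bernstein_iter; exact: pk.
apply: zero_onD; first apply: zero_onD; apply: zero_onZ.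
- by rewrite -iterSr; exact: zp.
- exact: tang.
- exact: tang.
Qed.

(** By [divfree_face], a derivative of v.n of order j + 1 along n becomes a sum of tangential
    derivatives of derivatives of order j of v.t1 and v.t2. Only the value of v.n is left to
    prescribe, which is why (D7) contains no normal derivative. *)
Lemma face_zero_divfree C k v : (forall c, bernstein k (v c)) -> divg v = 0 ->
  dotv n n = 1 -> dotv t1 n = 0 -> dotv t2 n = 0 -> free [:: t1; t2] ->
  zero_on f (dotc v n) ->
  (forall j, (j < C)%N -> zero_on f (iter j (dderiv n) (dotc v t1))) ->
  (forall j, (j < C)%N -> zero_on f (iter j (dderiv n) (dotc v t2))) ->
  forall j, (j < C)%N -> zero_on f (iter j (dderiv n) (dotc v n)).
Proof.
move=> vk dv nn t1n t2n tf zn z1 z2 [//|j] jC.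
have dk m : bernstein k (dotc v m) by apply: bernstein_sum => c _; apply: bernsteinZ.
have [m1 [m2 [[p [q m1E]] [p' [q' m2E]] /(_ v dv) E]]] := divfree_face nn t1n t2n tf.
have tang a b : tangent_to (@vtx R x 2 f) (a *: t1 + b *: t2).
  by rewrite /tangent_to addmx_sub // scalemx_sub.
rewrite iterSr E m1E m2E iter_dderivD; apply: zero_onD; rewrite iter_dderivC;
  apply: (zero_on_tangent fD (tang _ _) (bernstein_iter _ _ (dk _))).
- exact/z1/ltnW.
- exact/z2/ltnW.
Qed.

End Face.

Lemma vanish_components B r g v : B \in unitmx ->
  (forall i, vanish g r (dotc v (row i B))) -> forall c, vanish g r (v c).
Proof.
move=> Bu vB c; rewrite -dotc_delta (row_basis (delta_mx 0 c) Bu) dotc_lincomb.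
by apply: vanish_sum => i; exact: vanishZ.
Qed.

End VanishingCriteria.

(** * Divergence theorem *)

Section Divergence.
Context {R : realType} {x : 'I_4 -> 'rV[R]_3} (xT : tetrahedron x).
Local Notation vpoly := {ffun 'I_3 -> {mpoly R[3]}}.
Local Notation bernstein := (@bernstein R x).
Local Notation bern := (@bern R x).
Local Notation grad := (@grad R x).
Implicit Types (P Q : {mpoly R[4]}) (m : 'X_{1..4}).

Definition mfact m : R := (\prod_i (m i)`!)%:R.

Definition cellI P : R := Int (restr x (bern P)).

Lemma cellI_scalar : scalar cellI.
Proof.
by move=> c P Q; rewrite /cellI bernD bernZ restr_lin linearP.
Qed.

Lemma gset_id : gset (id : 'I_4 -> 'I_4) = [set: 'I_4]%SET.
Proof. by apply/setP => i; rewrite finset.inE; apply/imsetP; exists i. Qed.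

Lemma cellI_homog k P : P \is k.-homog ->
  cellI P = (\sum_(m <- msupp P) P@_m * mfact m) / (k + 3)`!%:R.
Proof.
move=> Pk; apply: etrans (Int_restr_bern xT (@inj_id 'I_4) Pk) _.
rewrite mulr_suml; apply: eq_bigl => m.
by rewrite gset_id /dist big1 // => i; rewrite finset.inE.
Qed.

Lemma cellIX m : cellI 'X_[m] = mfact m / (mdeg m + 3)`!%:R.
Proof.
by rewrite (@cellI_homog (mdeg m)) ?dhomogX // msuppX big_seq1 mcoeffX eqxx mul1r.
Qed.

Lemma submUK m l : m l != 0%N -> (m - U_(l) + U_(l))%MM = m.
Proof.
by move=> ml; apply: submK; apply/mnm_lepP => i; rewrite mnm1E; case: eqP => // <-; rewrite lt0n.
Qed.

Lemma mfact_deriv m l : m l != 0%N -> (m l)%:R * mfact (m - U_(l))%MM = mfact m.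
Proof.
move=> ml; rewrite /mfact -natrM; congr (_%:R).
rewrite (bigD1 l) //= [RHS](bigD1 l) //= mulnA; congr (_ * _)%N.
  by rewrite mnmBE mnm1E eqxx subn1; case: (m l) ml.
by apply: eq_bigr => i il; rewrite mnmBE mnm1E eq_sym (negPf il) subn0.
Qed.

Lemma mfact_neq0 m : mfact m != 0.
Proof. by rewrite /mfact pnatr_eq0 -lt0n prodn_gt0 // => i; rewrite fact_gt0. Qed.

Lemma cellI_deriv k l Q : Q \is k.+1.-homog ->
  cellI Q^`M(l) = (\sum_(m <- msupp Q | m l != 0%N) Q@_m * mfact m) / (k + 3)`!%:R.
Proof.
move=> Qk; rewrite {1}(mpolyE Q) (raddf_sum (mderiv l)) /=.
have -> (r : seq 'X_{1..4}) (F : 'X_{1..4} -> {mpoly R[4]}) :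
    cellI (\sum_(m <- r) F m) = \sum_(m <- r) cellI (F m).
  elim/big_rec2: _ => [|m y p _ <-]; [exact: scalar0 cellI_scalar|].
  exact: scalarD cellI_scalar.
rewrite mulr_suml [RHS]big_mkcond; apply: eq_big_seq => m mQ /=.
rewrite mderivZ mderivX !(scalarZ _ _ cellI_scalar).
have [ml|ml] := eqVneq (m l) 0%N; first by rewrite ml mul0r mulr0.
rewrite cellIX -!mulrA; congr (_ * _).
have -> : mdeg (m - U_(l))%MM = k.
  by have := homog_mdeg Qk mQ; rewrite -{1}(submUK ml) mdegD mdeg1 addn1 => -[].
by rewrite mulrA mfact_deriv.
Qed.

(** The gradient of the coordinate l and n are both orthogonal to the tangents of the face opposite
    to l. This turns conditions on v.n into conditions on v times that gradient, whatever the
    orientation of n. *)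
Lemma normal_grad (F : frames) l (f := (~: [set l])%SET) : frames_of x F ->
  f \in Delta 2 /\ exists c, grad l = c *: fn F f.
Proof.
have fD : f \in Delta 2 by rewrite mem_enum finset.inE cardsC1 card_ord.
move=> [_ /(_ f fD)[nN nn t1T t2T tf]]; split=> //; exists (dotv (grad l) (fn F f)).
set n := fn F f in nN nn *.
have dott t : tangent_to (@vtx R x 2 f) t -> dotv t (grad l) = 0 /\ dotv t n = 0.
  move=> /submxP[D ->]; rewrite mulmx_sum_row !dotv_suml !big1 // => j _; rewrite dotvZl rowK.
    by rewrite dotvC nN mulr0.
  have vf a : nth ord0 (enum f) (a : 'I_3) != l.
    have : nth ord0 (enum f) a \in f.
      by rewrite -mem_enum mem_nth // (size_enum_Delta fD).
    by rewrite !finset.inE.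
  by rewrite (dotv_grad_edge xT) ![l == _]eq_sym !(negPf (vf _)) subrr mulr0.
have [g1 n1] := dott _ t1T; have [g2 n2] := dott _ t2T.
have n0 : n != 0 by rewrite -dotv_eq0 nn oner_eq0.
have Bu := frame3_unit n0 n1 n2 tf.
apply/eqP; rewrite -subr_eq0; set w := _ - _.
have wn t : dotv t w = dotv t (grad l) - dotv (grad l) n * dotv t n.
  by rewrite dotvC /w addrC -scaleNr dotv_linl mulNr addrC dotvC [dotv n t]dotvC.
have : frame3 n (ft1 F f) (ft2 F f) *m w^T = 0.
  apply/matrixP => i j; rewrite ord1 -[LHS]/(((frame3 _ _ _) *m w^T) i 0).
  have -> : (frame3 n (ft1 F f) (ft2 F f) *m w^T) i 0 =
     dotv (row i (frame3 n (ft1 F f) (ft2 F f))) w.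
    by rewrite mxE; apply: eq_bigr => c _; rewrite !mxE.
  rewrite rowK mxE wn; case: ifP => _; first by rewrite nn mulr1 dotvC subrr.
  by case: ifP => _; rewrite ?g1 ?n1 ?g2 ?n2 mulr0 subrr.
move=> /(congr1 (mulmx (invmx (frame3 n (ft1 F f) (ft2 F f))))).
by rewrite mulKmx // mulmx0 => /(congr1 trmx); rewrite trmxK trmx0 => ->.
Qed.

(* The divergence theorem, in Bernstein coordinates: integrals of monomials of
   a given degree are proportional to the products of the factorials of their
   exponents, on the cell as on its faces. *)
Lemma int_divg_eq0 (F : frames) k (v : vpoly) : frames_of x F ->
  (forall c, bernstein k.+1 (v c)) ->
  (forall f, f \in Delta 2 -> Int (restr (@vtx R x 2 f) (dotc v (fn F f))) = 0) ->
  cell_int x (divg v) = 0.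
Proof.
move=> hF vB vf.
have /choice[P PE] c : exists P, P \is k.+1.-homog /\ v c = bern P.
  by have [P Pk ->] := vB c; exists P.
pose Q l := \sum_c grad l 0 c *: P c.
have Qk l : Q l \is k.+1.-homog.
  by apply: rpred_sum => c _; apply: dhomogZ; case: (PE c).
have dQ l : dotc v (grad l) = bern (Q l).
  by rewrite /dotc /Q bern_sum; apply: eq_bigr => c _; rewrite bernZ; case: (PE c) => _ ->.
have divE : divg v = bern (\sum_l (Q l)^`M(l)).
  rewrite /divg; under eq_bigr => c _ do rewrite (proj2 (PE c)) deriv_bern.
  rewrite exchange_big bern_sum; apply: eq_bigr => l _ /=.
  rewrite /Q (raddf_sum (mderiv l)) bern_sum; apply: eq_bigr => c _ /=.
  by rewrite mderivZ bernZ.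
have face0 l : \sum_(m <- msupp (Q l) | m l == 0%N) (Q l)@_m * mfact m = 0.
  have [fD [c gE]] := normal_grad l hF.
  set f := (~: [set l])%SET in fD gE.
  have : Int (restr (@vtx R x 2 f) (bern (Q l))) = 0.
    have -> : bern (Q l) = c *: dotc v (fn F f).
      by rewrite -dQ gE -[c *: fn F f]addr0 dotc_vlin dotc_v0 addr0.
    by rewrite restrZ linearZ_LR /= vf // mulr0.
  have := Int_restr_bern xT (gam_of_inj fD) (Qk l).
  rewrite (gset_gam_of fD) => -> /eqP; rewrite -mulr_suml mulf_eq0 invr_eq0 pnatr_eq0.
  rewrite (gtn_eqF (fact_gt0 _)) orbF => /eqP; apply: etrans.
  apply: eq_bigl => m; rewrite /dist (big_pred1 l) // => i.
  by rewrite !finset.inE negbK.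
(* Since [m l] times the factorials of [m - U_(l)] gives those of m, differentiation only drops the
   monomials with [m l = 0] and changes the denominator from [(k + 4)!] to [(k + 3)!]. The dropped
   sum, proportional to an integral over the face opposite to l, is zero by [face0]. *)
have E l : cellI (Q l)^`M(l) = (k.+1 + 3)%:R * cellI (Q l).
  rewrite (cellI_deriv _ (Qk l)) (cellI_homog (Qk l)).
  rewrite [in RHS](bigID (fun m : 'X_{1..4} => m l == 0%N)) /= face0 add0r.
  by rewrite addSn factS natrM invfM [RHS]mulrCA mulVKf // pnatr_eq0.
rewrite cell_intE divE -/(cellI _).
have cs (F' : 'I_4 -> {mpoly R[4]}) : cellI (\sum_l F' l) = \sum_l cellI (F' l).
  elim/big_rec2: _ => [|m y p _ <-]; [exact: scalar0 cellI_scalar|].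
  exact: scalarD cellI_scalar.
rewrite cs (eq_bigr _ (fun l _ => E l)) -mulr_sumr -cs.
(* The gradients of the barycentric coordinates add up to zero. *)
have -> : \sum_l Q l = 0.
  rewrite /Q exchange_big big1 // => c _; rewrite -scaler_suml.
  by rewrite -summxE sum_grad mxE scale0r.
by rewrite (scalar0 cellI_scalar) !mulr0.
Qed.

End Divergence.

(** * The degrees of freedom determine the vector field *)

Section Ranges.

Lemma mem_irange (lo hi : int) (j : nat) : lo <= j%:Z <= hi -> j \in irange lo hi.
Proof. by move=> h; rewrite mem_filter h mem_iota /=; lia. Qed.

Lemma irange_nat (n : nat) : irange 0 (n%:Z - 1) = iota 0 n.
Proof.
rewrite /irange; case: n => [|n]; first by [].
rewrite (_ : n.+1%:Z - 1 = n%:Z); last by lia.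
rewrite absz_nat.
apply/all_filterP/allP => j; rewrite inE mem_iota; lia.
Qed.

Lemma mem_partials lo hi (m : 'X_{1..3}) : lo <= (mdeg m)%:Z <= hi -> m \in partials lo hi.
Proof.
move=> h; apply/flattenP.
pose s (j : nat) := [seq bmnm a | a : 'X_{1..3 < j.+1} <- enum predT & mdeg a == j].
exists (s (mdeg m)); first by apply/mapP; exists (mdeg m); rewrite ?mem_irange.
apply/mapP; exists (BMultinom (ltnSn (mdeg m))) => //.
by rewrite mem_filter mem_enum /= eqxx.
Qed.

Lemma mem_itriangle (n i l : nat) : (i + l < n)%N -> (i, (i + l)%N) \in itriangle (n%:Z - 1).
Proof.
move=> il; apply/allpairsPdep; exists (i + l)%N, i; split=> //.
  by rewrite irange_nat mem_iota.
by rewrite mem_iota /= add0n ltnS leq_addr.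
Qed.

End Ranges.

Lemma all_flattenE (T : Type) (a : pred T) ss : all a (flatten ss) = all (all a) ss.
Proof. by elim: ss => //= s ss IH; rewrite all_cat IH. Qed.

Lemma all_allpairsE (S T U : Type) (a : pred U) (f : S -> T -> U) s t :
  all a (allpairs f s t) = all (fun x => all (fun y => a (f x y)) t) s.
Proof. by rewrite all_flattenE all_map; apply: eq_all => x /=; rewrite all_map. Qed.

Section SpanMore.
Context {R : realType} {V : lmodType R}.

Lemma lin_closed_add (W1 W2 : set V) : lin_closed W1 -> lin_closed W2 ->
  lin_closed [set q | exists q0 q1, [/\ W1 q0, W2 q1 & q = q0 + q1]]%classic.
Proof.
move=> W1l W2l; split.
  by exists 0, 0; rewrite addr0; split=> //; [case: W1l|case: W2l].
move=> a _ _ [p0 [p1 [P0 P1 ->]]] [q0 [q1 [Q0 Q1 ->]]].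
exists (a *: p0 + q0), (a *: p1 + q1); split; [exact: (proj2 W1l)|exact: (proj2 W2l)|].
by rewrite scalerDr addrACA.
Qed.

Lemma spanF_add (J1 J2 : finType) (u1 : J1 -> V) (u2 : J2 -> V) q0 q1 :
  spanF u1 q0 -> spanF u2 q1 ->
  spanF (fun j : J1 + J2 => match j with inl i => u1 i | inr i => u2 i end) (q0 + q1).
Proof.
move=> [c0 ->] [c1 ->]; exists (fun j => match j with inl i => c0 i | inr i => c1 i end).
by rewrite big_sumType.
Qed.

End SpanMore.

Section VectorSpan.
Context {R : realType}.
Local Notation vpoly := {ffun 'I_3 -> {mpoly R[3]}}.

Definition vunit (c : 'I_3) (p : {mpoly R[3]}) : vpoly := [ffun c' => if c' == c then p else 0].

Lemma spanF_vpoly (J : finType) (u : J -> {mpoly R[3]}) (v : vpoly) :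
  (forall c, spanF u (v c)) -> spanF (fun cj : 'I_3 * J => vunit cj.1 (u cj.2)) v.
Proof.
move=> /choice[a aE]; exists (fun cj => a cj.1 cj.2).
apply/ffunP => c; rewrite sum_ffunE aE.
rewrite -(pair_bigA _ (fun c' j => (a c' j *: vunit c' (u j)) c)) /= (bigD1 c) //=.
rewrite [X in _ + X]big1 ?addr0 => [|c' c'c].
  by apply: eq_bigr => j _; rewrite !ffunE eqxx.
by rewrite big1 // => j _; rewrite !ffunE eq_sym (negPf c'c) scaler0.
Qed.

Lemma lin_closed_vpoly (W : set {mpoly R[3]}) : lin_closed W ->
  lin_closed [set v : vpoly | forall c, W (v c)]%classic.
Proof.
move=> Wl; split=> [c|a v w Wv Ww c]; first by rewrite ffunE; case: Wl.
by rewrite !ffunE; apply: (proj2 Wl).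
Qed.

End VectorSpan.

Section Uniqueness.
Context {R : realType} {x : 'I_4 -> 'rV[R]_3} {F : @frames R}.
Context (xT : tetrahedron x) (hF : frames_of x F).
Variables (K A B C A3 B3 C3 : nat).
Local Notation k := (K.+1).
Local Notation r2 := (Smoothness (A%:Z - 1) (B%:Z - 1) (C%:Z - 1)).
Local Notation r3 := (Smoothness (A3%:Z - 1) (B3%:Z - 1) (C3%:Z - 1)).
Local Notation vpoly := {ffun 'I_3 -> {mpoly R[3]}}.
Local Notation bernstein := (@bernstein R x).
Local Notation vanish := (@vanish R x).
Local Notation zero_on := (@zero_on R x).
Local Notation edge_zero := (@edge_zero R x).
Implicit Types (v : vpoly) (e f g : {set 'I_4}).

Hypotheses (BA : (B <= A)%N) (Ak : (A <= k)%N) (Bk : (B <= k.+1)%N)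
  (CB : (C <= B)%N) (Ck : (C <= k.+1)%N)
  (BA3 : (B3 <= A3)%N) (AK3 : (A3 <= K)%N) (CB3 : (C3 <= B3)%N) (A3A : (A.-1 <= A3)%N).

Variable v : vpoly.
Local Notation null L := (all (fun l : dof => l v == 0) L).
Local Notation face f := (@vtx R x 2 f).
Hypothesis vP : VPol k%:Z v.
Hypothesis v0 : null (dofs x F k%:Z r2 r3).

Lemma vB c : bernstein k (v c).
Proof.
by case: (vP c) => [->|h]; [exact: bernstein0|apply: (bernstein_msize xT); lia].
Qed.

Lemma dotcB n : bernstein k (dotc v n).
Proof. by apply: bernstein_sum => c _; exact/bernsteinZ/vB. Qed.

Lemma divgB : bernstein K (divg v).
Proof.
apply: bernstein_sum => c _; have := bernstein_dderiv (delta_mx 0 c) (vB c).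
rewrite /dderiv (bigD1 c) //= mxE !eqxx scale1r big1 ?addr0 // => i /negPf ic.
by rewrite mxE ic andbF scale0r.
Qed.

Lemma vertex_in_Delta i : [set i]%SET \in Delta 0.
Proof. by rewrite mem_enum finset.inE cards1. Qed.

Lemma vtx_set1 i : @vtx R x 0 [set i]%SET ord0 = x i.
Proof. by rewrite /vtx enum_set1. Qed.

Lemma dofs_split : [/\ null (D1 x r2),
  null (D2 x r2 r3),
  null (D3 x F k%:Z r2),
  null (D4 x F k%:Z r2) &
  null (D5 x F k%:Z r2)] /\
 [/\ null (D6 x F k%:Z r3),
  null (D7 x F k%:Z r2),
  null (D8 x F k%:Z r2) &
  null (D9 x F k%:Z r3)] /\
  null (D10 x k%:Z r3) /\
  null (D11 x F k%:Z r2).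
Proof. by move: v0; rewrite /dofs !all_cat; do 10!(case/andP=> ->); move=> ->. Qed.

Lemma vertex_v i c : vanish [set i]%SET A (v c).
Proof.
apply: vertex_vanish => m mA; have [[/all_allpairsP h _ _ _ _] _] := dofs_split.
have := h [set i]%SET (m, c) (vertex_in_Delta i); rewrite vtx_set1 => h'.
apply/eqP/h'; apply: allpairs_f; last by rewrite mem_enum.
by apply: mem_partials => /=; lia.
Qed.

Lemma vertex_dotc i n : vanish [set i]%SET A (dotc v n).
Proof. by apply: vanish_sum => c; exact/vanishZ/vertex_v. Qed.

(** Derivatives of div v of order at most [A - 2] are combinations of derivatives of v covered by
    (D1); from order [max(A - 1, 0)] on, (D2) takes over. *)
Lemma vertex_divg i : vanish [set i]%SET A3 (divg v).
Proof.
apply: vertex_vanish => m mA; have [[/all_allpairsP h1 /all_allpairsP h2 _ _ _] _] := dofs_split.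
have [mA'|mA'] := ltnP (mdeg m).+1 A.
  rewrite /divg (raddf_sum (mderivm m)) ev_sum big1 // => c _ /=.
  rewrite -mderivmU1m -mderivmDm.
  have := h1 [set i]%SET ((U_(c) + m)%MM, c) (vertex_in_Delta i); rewrite vtx_set1 => h'.
  apply/eqP/h'; apply: allpairs_f; last by rewrite mem_enum.
  by apply: mem_partials; rewrite mdegD mdeg1 /=; lia.
have := h2 [set i]%SET m (vertex_in_Delta i); rewrite vtx_set1 => h'.
by apply/eqP/h'/mem_partials => /=; lia.
Qed.

Lemma pairing_moments_zero d (y : 'I_d.+1 -> 'rV[R]_3) (J : finType) (u : J -> {mpoly R[d]}) W
    (Phi : vpoly -> {mpoly R[3]}) :
  lin_closed W -> (W `<=` spanF u)%classic ->
  null (moments W (fun v => pairing y (Phi v))) ->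
  forall q, W q -> pairing y (Phi v) q = 0.
Proof. by move=> Wl Wu; apply: (moments_zero Wl Wu); exact: pairing_scalar. Qed.

Lemma normal_tangent d (y : 'I_d.+1 -> 'rV[R]_3) n t :
  normal_to y n -> tangent_to y t -> dotv n t = 0.
Proof.
move=> nN /submxP[D ->]; rewrite dotvC mulmx_sum_row dotv_suml big1 // => j _.
by rewrite dotvZl rowK dotvC nN mulr0.
Qed.

Lemma edge_frame e : e \in Delta 1 ->
  [/\ tangent_to (@vtx R x 1 e) (et F e), et F e != 0,
    dotv (en1 F e) (et F e) = 0 /\ dotv (en2 F e) (et F e) = 0,
    free [:: en1 F e; en2 F e] & frame3 (et F e) (en1 F e) (en2 F e) \in unitmx].
Proof.
move=> eD; have [nF _] := hF; have [eT t0 n1N n2N nf] := nF _ eD.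
have n1t := normal_tangent n1N eT; have n2t := normal_tangent n2N eT.
by split=> //; exact: frame3_unit.
Qed.

Lemma edge_divg e : e \in Delta 1 -> vanish e B3 (divg v).
Proof.
move=> eD; have [eT _ _ _ Bu] := edge_frame eD.
apply: (edge_vanish xT eD eT Bu divgB) => i l il.
apply: (edge_zero_dofs xT eD Bu divgB BA3) => //; first by lia.
  by move=> a _; exact: vertex_divg.
have [_ [[h _ _ _] _]] := dofs_split; move: h; rewrite /D6 all_flattenE => /all_allpairsP h.
have := h e (i, (i + l)%N) eD (mem_itriangle il); rewrite /dnormal /= addKn => /pairing_moments_zero.
move=> /(_ _ _ (@Pol_lin R 1 _) (@Pol_span R 1 _)) h' q qP; apply: h'.
by move: qP; congr (Pol _ q); lia.
Qed.

Lemma face_divg f : f \in Delta 2 -> vanish f C3 (divg v).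
Proof.
move=> fD; have [fN nn t1T t2T tf] := proj2 hF _ fD.
have n0 : fn F f != 0 by rewrite -dotv_eq0 nn oner_eq0.
have t1n := normal_tangent fN t1T; have t2n := normal_tangent fN t2T.
have Bu := frame3_unit n0 (etrans (dotvC _ _) t1n) (etrans (dotvC _ _) t2n) tf.
apply: (face_vanish xT fD t1T t2T Bu divgB) => j jC.
apply: (face_dof xT (M := K - j) (a := A3%:Z - 1 - j%:Z) (b := B3%:Z - 1 - j%:Z) fD).
  apply: (face_bubble xT (Sv := A3 - j) (Se := B3 - j) fD); [exact: bernstein_iter divgB| | |lia|lia].
  - by move=> i _; apply: vanish_iter; exact: vertex_divg.
  - by move=> e eD _; apply: vanish_iter; exact: edge_divg.
have [_ [[_ _ _ h] _]] := dofs_split; move: h; rewrite /D9 all_flattenE => /all_allpairsP h.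
have := h f j fD; rewrite irange_nat mem_iota => /(_ jC) /pairing_moments_zero.
move=> /(_ _ _ (@bubble_lin R _ _ _ _ _) (@bubble_span R _ _ _ _ _)) h' q qP; apply: h'.
by move: qP; congr (bubbleF _ _ _ q); lia.
Qed.

Lemma face_int_scalar d (y : 'I_d.+1 -> 'rV[R]_3) :
  scalar (fun q : {mpoly R[d]} => simplex_int y (fun s => q.@[s])).
Proof.
by move=> c p q; rewrite !simplex_intE linearP mulrDr mulrCA.
Qed.

Lemma D7_test f : f \in Delta 2 ->
  let W := [set q | exists q0 q1, [/\ @Pol R 2 0 q0,
    bubbleF0 (face f) k%:Z (A%:Z - 1) (B%:Z - 1) q1 & q = q0 + q1]]%classic in
  forall q, W q -> pairing (face f) (dotc v (fn F f)) q = 0.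
Proof.
move=> fD W; have [_ [[_ h _ _] _]] := dofs_split; move: h; rewrite /D7 all_flattenE all_map.
move=> /allP/(_ f); rewrite inE => /(_ fD) /=.
have Wl : lin_closed W.
  apply: lin_closed_add; first exact: Pol_lin.
  by apply: lin_closed_ker; [exact: bubble_lin|exact: face_int_scalar].
apply: (pairing_moments_zero (u := fun j => match j with
  inl i => 'X_[val i] | inr i => bubble_gen (@bary_std R 2) i end) Wl).
move=> _ [q0 [q1 [/Pol_span P0 [/bubble_span P1 _] ->]]].
exact: (spanF_add P0 P1).
Qed.

Lemma divg_eq0 : divg v = 0.
Proof.
have dB : bubbleT x K%:Z r3 (divg v).
  apply: (cell_bubble xT (Sv := A3) (Se := B3) (Sf := C3) divgB) => /=; try lia.
  - by move=> i; exact: vertex_divg.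
  - by move=> e; exact: edge_divg.
  - by move=> f; exact: face_divg.
have d0 : cell_int x (divg v) = 0.
  apply: (int_divg_eq0 xT hF vB) => f fD.
  have W1 : [set q | exists q0 q1, [/\ @Pol R 2 0 q0,
     bubbleF0 (face f) k%:Z (A%:Z - 1) (B%:Z - 1) q1 & q = q0 + q1]]%classic 1.
    exists 1, 0; rewrite addr0; split=> //; first by right; rewrite msize1.
    by split; [case: (@bubble_lin R 2 2 (@bary_std R 2) k%:Z [:: A%:Z - 1; B%:Z - 1])
      |exact: (scalar0 (face_int_scalar _))].
  have := D7_test fD W1; rewrite pairingE mulr1 => /eqP.
  by rewrite mulf_eq0 (gt_eqF (gram_vtx_gt0 xT fD isT)) /= => /eqP.
apply: (cell_eq0 xT); rewrite expr2.
have [_ [_ [h _]]] := dofs_split.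
have ll : scalar (fun q => cell_int x (divg v * q)).
  by move=> c p q; rewrite mulrDr -scalerAr cell_int_scalar.
have Wl : lin_closed (bubbleT0 x K%:Z r3).
  by apply: lin_closed_ker; [exact: bubble_lin|exact: cell_int_scalar].
have Ws : (bubbleT0 x K%:Z r3 `<=`
    spanF (@bubble_gen R 3 3 (bary x) K%:Z [:: rv r3; re r3; rf r3]))%classic.
  by move=> q [/bubble_span qB _].
have h' : all (fun l : dof => l v == 0)
    (moments (bubbleT0 x K%:Z r3) (fun v q => cell_int x (divg v * q))).
  by move: h; rewrite /D10 (_ : k%:Z - 1 = K%:Z) //; lia.
exact: (@moments_zero _ _ _ _ _ (fun v q => cell_int x (divg v * q)) v Wl Ws ll h' _ (conj dB d0)).
Qed.

Lemma edge_v e c : e \in Delta 1 -> vanish e B (v c).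
Proof.
move=> eD; have [eT t0 [n1t n2t] nf Bu] := edge_frame eD.
have [[_ _ h3 h4 h5] _] := dofs_split.
have W q i l : @Pol R 1 (k%:Z - 2 * A%:Z + (i + l)%N%:Z) q ->
    @Pol R 1 (k%:Z - 2 * (A%:Z - 1 + 1) + (i + l)%N%:Z) q.
  by congr (Pol _ q); lia.
have zt : edge_zero e (en1 F e) (en2 F e) B (dotc v (et F e)).
  move=> i l il; apply: (edge_zero_dofs xT eD Bu (dotcB (et F e)) BA) => //.
    by move=> a _; exact: vertex_dotc.
  move: h4; rewrite /D4 all_flattenE => /all_allpairsP h.
  have := h e (i, (i + l)%N) eD (mem_itriangle il); rewrite /dnormal /= addKn => /pairing_moments_zero.
  by move=> /(_ _ _ (@Pol_lin R 1 _) (@Pol_span R 1 _)) h' q qP; exact/h'/W.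
have z1 : edge_zero e (en1 F e) (en2 F e) B (dotc v (en1 F e)).
  move=> i l il; apply: (edge_zero_dofs xT eD Bu (dotcB (en1 F e)) BA) => //.
    by move=> a _; exact: vertex_dotc.
  move: h5; rewrite /D5 all_flattenE => /all_allpairsP h.
  have := h e (i, (i + l)%N) eD (mem_itriangle il); rewrite /dnormal /= addKn => /pairing_moments_zero.
  by move=> /(_ _ _ (@Pol_lin R 1 _) (@Pol_span R 1 _)) h' q qP; exact/h'/W.
have z2 : edge_zero e (en1 F e) (en2 F e) B (dotc v (en2 F e)).
  apply: (edge_zero_divfree xT eD eT Bu vB divg_eq0) => // j jB.
  have jB' : (j + 0 < B)%N by rewrite addn0.
  apply: (edge_zero_dofs xT eD Bu (dotcB (en2 F e)) BA Bk _ jB').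
    by move=> a _; exact: vertex_dotc.
  move: h3; rewrite /D3 all_flattenE => /all_allpairsP h.
  have := h e j eD; rewrite irange_nat mem_iota => /(_ jB) /pairing_moments_zero.
  move=> /(_ _ _ (@Pol_lin R 1 _) (@Pol_span R 1 _)) h' q /W qP; apply: h'.
  by rewrite addn0 in qP.
apply: (vanish_components Bu) => i; rewrite rowK.
case: ifP => _; first exact: (edge_vanish xT eD eT Bu (dotcB _)).
by case: ifP => _; exact: (edge_vanish xT eD eT Bu (dotcB _)).
Qed.

Lemma edge_dotc e n : e \in Delta 1 -> vanish e B (dotc v n).
Proof. by move=> eD; apply: vanish_sum => c; exact/vanishZ/edge_v. Qed.

Lemma face_dotc_bubble f n m j : f \in Delta 2 ->
  bubbleF (k - j)%N%:Z (A%:Z - 1 - j%:Z) (B%:Z - 1 - j%:Z)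
    (restr (face f) (iter j (dderiv n) (dotc v m))).
Proof.
move=> fD; apply: (face_bubble xT (Sv := A - j) (Se := B - j) fD);
  [exact: bernstein_iter (dotcB m)| | |lia|lia].
- by move=> i _; apply: vanish_iter; exact: vertex_dotc.
- by move=> e eD _; apply: vanish_iter; exact: edge_dotc.
Qed.

Lemma face_frame f : f \in Delta 2 ->
  [/\ dotv (fn F f) (fn F f) = 1, tangent_to (face f) (ft1 F f),
    tangent_to (face f) (ft2 F f) & free [:: ft1 F f; ft2 F f]] /\
  [/\ dotv (ft1 F f) (fn F f) = 0, dotv (ft2 F f) (fn F f) = 0 &
    frame3 (fn F f) (ft1 F f) (ft2 F f) \in unitmx].
Proof.
move=> fD; have [fN nn t1T t2T tf] := proj2 hF _ fD.
have n0 : fn F f != 0 by rewrite -dotv_eq0 nn oner_eq0.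
have t1n := etrans (dotvC _ _) (normal_tangent fN t1T).
have t2n := etrans (dotvC _ _) (normal_tangent fN t2T).
by split; split=> //; exact: frame3_unit.
Qed.

(** The constant test function shows that the trace has mean zero; being a bubble, it is then itself
    one of the test functions of mean zero. *)
Lemma face_vn f : f \in Delta 2 -> zero_on f (dotc v (fn F f)).
Proof.
move=> fD; apply: (zero_on_restr fD); set y := @vtx R x 2 f; set u := dotc v _.
have uB : bubbleF k%:Z (A%:Z - 1) (B%:Z - 1) (restr y u).
  have := face_dotc_bubble 0 (fn F f) 0 fD.
  by rewrite /= !(subn0, subr0).
have W q0 q1 : @Pol R 2 0 q0 -> bubbleF0 y k%:Z (A%:Z - 1) (B%:Z - 1) q1 ->
    pairing y u (q0 + q1) = 0.
  by move=> P0 P1; apply: (D7_test fD); exists q0, q1.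
have g0 := gram_vtx_gt0 xT fD isT.
have B0 : bubbleF0 y k%:Z (A%:Z - 1) (B%:Z - 1) 0.
  by split; [case: (@bubble_lin R 2 2 (@bary_std R 2) k%:Z [:: A%:Z - 1; B%:Z - 1])
      |exact: (scalar0 (face_int_scalar _))].
have u0 : Int (restr y u) = 0.
  have /W : @Pol R 2 0 1 by right; rewrite msize1.
  move=> /(_ 0 B0); rewrite addr0 pairingE mulr1 => /eqP.
  by rewrite mulf_eq0 (gt_eqF g0) /= => /eqP.
have /(W 0) : bubbleF0 y k%:Z (A%:Z - 1) (B%:Z - 1) (restr y u).
  by split=> //; rewrite simplex_intE u0 mulr0.
rewrite add0r pairingE -expr2 => E; have {}E := E (or_introl erefl).
by apply/Int_sqr_eq0/eqP; move/eqP: E; rewrite mulf_eq0 (gt_eqF g0).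
Qed.

Lemma face_vt f j : f \in Delta 2 -> (j < C)%N ->
  zero_on f (iter j (dderiv (fn F f)) (dotc v (ft1 F f))) /\
  zero_on f (iter j (dderiv (fn F f)) (dotc v (ft2 F f))).
Proof.
move=> fD jC; have [_ [[_ _ h _] _]] := dofs_split; move: h.
rewrite /D8 all_flattenE all_allpairsE => /allP/(_ f fD).
rewrite all_allpairsE irange_nat => /allP/(_ j); rewrite mem_iota => /(_ jC) /= /and3P[h1 h2 _].
have W q : bubbleF (k - j)%N%:Z (A%:Z - 1 - j%:Z) (B%:Z - 1 - j%:Z) q ->
    bubbleF (k%:Z - j%:Z) (A%:Z - 1 - j%:Z) (B%:Z - 1 - j%:Z) q.
  by congr (bubbleF _ _ _ q); lia.
have Wl := @bubble_lin R 2 2 (@bary_std R 2).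
have Ws := @bubble_span R 2 2 (@bary_std R 2).
split; apply: (face_dof xT fD (face_dotc_bubble _ _ _ fD)) => q /W qW.
  exact: (pairing_moments_zero (Wl _ _) (Ws _ _) h1 qW).
exact: (pairing_moments_zero (Wl _ _) (Ws _ _) h2 qW).
Qed.

Lemma face_v f c : f \in Delta 2 -> vanish f C (v c).
Proof.
move=> fD; have [[nn t1T t2T tf] [t1n t2n Bu]] := face_frame fD.
have fv := face_vanish xT fD t1T t2T Bu (dotcB _).
apply: (vanish_components Bu) => i; rewrite rowK.
case: ifP => _.
  apply: fv => j jC.
  apply: (face_zero_divfree xT fD t1T t2T vB divg_eq0 nn t1n t2n tf _ _ _ jC).
  - exact: face_vn.
  - by move=> l lC; case: (face_vt fD lC).
  - by move=> l lC; case: (face_vt fD lC).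
by case: ifP => _; apply: fv => j jC; case: (face_vt fD jC).
Qed.

Lemma v_bubbleDiv : bubbleDiv x F k%:Z r2 v.
Proof.
split=> [c|f fD s s0 s1].
  apply: (cell_bubble xT (Sv := A) (Se := B) (Sf := C) (vB c)) => /=; try lia.
  - by move=> i; exact: vertex_v.
  - by move=> e; exact: edge_v.
  - by move=> f; exact: face_v.
rewrite (affpt_gwt (gam_of (d := 2) (g := f))); apply: (face_vn fD); last exact: sum_gwt.
by move=> i ig; apply: gwt_out; rewrite (gset_gam_of fD).
Qed.

Lemma bubbleDiv_lin m r : lin_closed (bubbleDiv x F m r).
Proof.
split.
  split=> [c|f fD s s0 s1]; first by rewrite ffunE; case: (@bubble_lin R 3 3 (bary x) m [:: rv r; re r; rf r]).
  by rewrite /dotc big1 ?ev0 // => c _; rewrite ffunE scaler0.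
move=> a w w' [wB wn] [wB' wn']; split=> [c|f fD s s0 s1].
  rewrite !ffunE; apply: (proj2 (@bubble_lin R 3 3 (bary x) m [:: rv r; re r; rf r])); [exact: wB|exact: wB'].
by rewrite dotc_lin evD evZ wn // wn' // mulr0 addr0.
Qed.

Lemma kerdiv_lin m r : lin_closed [set w | bubbleDiv x F m r w /\ divg w = 0]%classic.
Proof.
split; first split; [by case: (bubbleDiv_lin m r)| |].
  by rewrite /divg big1 // => c _; rewrite ffunE mderiv0.
move=> a w w' [wB w0] [wB' w0']; split; first exact: (proj2 (bubbleDiv_lin m r)).
by rewrite divg_lin w0 w0' scaler0 addr0.
Qed.

Lemma bubbleDiv_span m r : (bubbleDiv x F m r `<=` spanF (fun cj =>
   vunit cj.1 (@bubble_gen R 3 3 (bary x) m [:: rv r; re r; rf r] cj.2)))%classic.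
Proof. by move=> w [wB _]; apply: spanF_vpoly => c; exact/bubble_span/wB. Qed.

Lemma dotp_scalar w : scalar (fun w' : vpoly => cell_int x (dotp w w')).
Proof.
move=> a w1 w2; rewrite -cell_int_scalar; congr cell_int.
rewrite /dotp scaler_sumr -big_split; apply: eq_bigr => c _.
by rewrite !ffunE mulrDr scalerAr.
Qed.

Lemma dofs_unisolvence : v = 0.
Proof.
have [_ [_ [_ h]]] := dofs_split.
have Ws : ([set w | bubbleDiv x F k%:Z r2 w /\ divg w = 0] `<=` spanF (fun cj =>
   vunit cj.1 (@bubble_gen R 3 3 (bary x) k%:Z [:: rv r2; re r2; rf r2] cj.2)))%classic.
  by move=> w [/bubbleDiv_span].
have := moments_zero (kerdiv_lin _ _) Ws (dotp_scalar v) h (conj v_bubbleDiv divg_eq0).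
rewrite cell_intE => /eqP; rewrite mulf_eq0 (gt_eqF (gram_cell_gt0 xT)) /= /dotp restr_sum => /eqP I0.
have E : \sum_c restr x (v c) ^+ 2 = 0.
  apply: Int_eq0 => [s _ _|].
    by rewrite meval_sum; apply: sumr_ge0 => c _; rewrite meval_exp sqr_ge0.
  by rewrite -[RHS]I0; congr Int; apply: eq_bigr => c _; rewrite restrM expr2.
apply/ffunP => c; rewrite ffunE; apply: (restr_cell_eq0 xT); apply: mpoly_eq0 => s.
have := congr1 (meval s) E; rewrite meval0 meval_sum => /psumr_eq0P E'.
apply/eqP; rewrite -sqrf_eq0 -meval_exp; apply/eqP/E' => // i _.
by rewrite meval_exp sqr_ge0.
Qed.

End Uniqueness.

(** * Counting lattice points of the simplex *)

Section LatticePoints.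
Local Open Scope nat_scope.

(** Nested sums over plain numbers: a permutation of the exponents is an exchange of summations, and
    what remains is linear arithmetic. The bound n is taken larger than the degree. *)
Definition cnt4 n (f : nat -> nat -> nat -> nat -> nat) : nat :=
  \sum_(a < n) \sum_(b < n) \sum_(c < n) \sum_(d < n) f a b c d.

Definition cnt3 n (f : nat -> nat -> nat -> nat) : nat :=
  \sum_(a < n) \sum_(b < n) \sum_(c < n) f a b c.

Lemma eq_cnt4 n f g : (forall a b c d, a < n -> b < n -> c < n -> d < n ->
  f a b c d = g a b c d) -> cnt4 n f = cnt4 n g.
Proof.
move=> fg; apply: eq_bigr => a _; apply: eq_bigr => b _.
by apply: eq_bigr => c _; apply: eq_bigr => d _; apply: fg.
Qed.

Lemma cnt4D n f g : cnt4 n (fun a b c d => f a b c d + g a b c d) = cnt4 n f + cnt4 n g.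
Proof.
rewrite /cnt4 -big_split; apply: eq_bigr => a _; rewrite -big_split; apply: eq_bigr => b _.
by rewrite -big_split; apply: eq_bigr => c _; rewrite -big_split.
Qed.

Lemma cnt4_01 n f : cnt4 n f = cnt4 n (fun a b c d => f b a c d).
Proof. by rewrite /cnt4 exchange_big. Qed.

Lemma cnt4_12 n f : cnt4 n f = cnt4 n (fun a b c d => f a c b d).
Proof. by apply: eq_bigr => a _; rewrite exchange_big. Qed.

Lemma cnt4_23 n f : cnt4 n f = cnt4 n (fun a b c d => f a b d c).
Proof. by apply: eq_bigr => a _; apply: eq_bigr => b _; rewrite exchange_big. Qed.

Lemma sum_ord_eq n (m : nat) : m < n -> \sum_(a < n) (val a == m : nat) = 1.
Proof.
move=> mn; rewrite (bigD1 (Ordinal mn)) //= eqxx big1 // => i.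
by rewrite -val_eqE /= => /negPf ->.
Qed.

Lemma sum_ord_interval n lo hi : hi < n ->
  \sum_(a < n) (lo <= a <= hi : nat) = hi.+1 - lo.
Proof.
move=> hn; have -> : hi.+1 = minn n hi.+1 by lia.
elim: n {hn} => [|n IH]; first by rewrite big_ord0 min0n.
rewrite big_ord_recr /= IH; case: (leqP lo n); case: (leqP n hi) => /=; lia.
Qed.

Lemma sum_ltn_eq B s : (s < B : nat) = \sum_(j < B) (s == j : nat).
Proof.
elim: B => [|B IH]; first by rewrite big_ord0.
rewrite big_ord_recr /= -IH; lia.
Qed.

Lemma sum_ord_add n j : j < n ->
  \sum_(c < n) \sum_(d < n) (c + d == j : nat) = j.+1.
Proof.
move=> jn; rewrite -[RHS]subn0 -(sum_ord_interval 0 jn).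
apply: eq_bigr => c _; rewrite leq0n /=; case: (leqP c j) => cj.
  by rewrite -[RHS](@sum_ord_eq n (j - c)); [apply: eq_bigr => d _ /=; lia|lia].
by rewrite big1 // => d _; lia.
Qed.

Lemma sum_ltn_add n B (G : nat -> nat) : B <= n ->
  \sum_(c < n) \sum_(d < n) (c + d < B) * G (c + d) = \sum_(j < B) j.+1 * G j.
Proof.
move=> Bn; transitivity (\sum_(c < n) \sum_(d < n) \sum_(j < B) (c + d == j) * G j).
  apply: eq_bigr => c _; apply: eq_bigr => d _; rewrite sum_ltn_eq big_distrl.
  by apply: eq_bigr => j _ /=; case: eqP => // ->.
under eq_bigr do rewrite exchange_big.
rewrite exchange_big; apply: eq_bigr => j _ /=.
rewrite -(@sum_ord_add n j); last exact: leq_trans (ltn_ord j) Bn.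
by rewrite big_distrl; apply: eq_bigr => c _; rewrite big_distrl.
Qed.

(* The exponents of the monomials that span B_m(T; r), where A, B and C stand
   for r^v + 1, r^e + 1 and r^f + 1; F3 is the analogue for a face. *)
Definition S4 m A B C a b c d : bool :=
  [&& a + b + c + d == m,
      [&& A <= b + c + d, A <= a + c + d, A <= a + b + d & A <= a + b + c],
      [&& B <= c + d, B <= b + d, B <= b + c, B <= a + d, B <= a + c & B <= a + b] &
      [&& C <= a, C <= b, C <= c & C <= d]].

Lemma S4P m A B C a b c d : reflect
  (a + b + c + d = m /\ [/\ A <= b + c + d, A <= a + c + d, A <= a + b + d & A <= a + b + c] /\
   [/\ B <= c + d, B <= b + d & B <= b + c] /\ [/\ B <= a + d, B <= a + c & B <= a + b] /\
   [/\ C <= a, C <= b, C <= c & C <= d]) (S4 m A B C a b c d).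
Proof.
apply: (iffP and4P).
  by move=> [/eqP -> /and4P[-> -> -> ->] /and5P[-> -> -> -> /andP[-> ->]] /and4P[-> -> -> ->]].
by move=> [-> [[-> -> -> ->] [[-> -> ->] [[-> -> ->] [-> -> -> ->]]]]]; rewrite eqxx.
Qed.

Lemma S4_01 m A B C a b c d : S4 m A B C b a c d = S4 m A B C a b c d.
Proof.
by apply/S4P/S4P => -[? [[? ? ? ?] [[? ? ?] [[? ? ?] [? ? ? ?]]]]]; do ! split; lia.
Qed.

Lemma S4_12 m A B C a b c d : S4 m A B C a c b d = S4 m A B C a b c d.
Proof.
by apply/S4P/S4P => -[? [[? ? ? ?] [[? ? ?] [[? ? ?] [? ? ? ?]]]]]; do ! split; lia.
Qed.

Lemma S4_23 m A B C a b c d : S4 m A B C a b d c = S4 m A B C a b c d.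
Proof.
by apply/S4P/S4P => -[? [[? ? ? ?] [[? ? ?] [[? ? ?] [? ? ? ?]]]]]; do ! split; lia.
Qed.

Definition F3 m A B a b c : bool :=
  [&& a + b + c == m, [&& A <= b + c, A <= a + c & A <= a + b] &
      [&& B <= a, B <= b & B <= c]].

(** Indicators of the layers along the boundary of the exponent simplex. In [nearE], s is the
    distance to an edge and u, w are those to its ends; in [nearF], d is the distance to a face, u,
    v, w are those to its vertices and p, q, r those to its edges. *)
Definition nearE A B (s u w : nat) : bool := [&& s < B, A <= u & A <= w].
Definition nearF A B C (d u v w p q r : nat) : bool :=
  [&& d < C, [&& A <= u, A <= v & A <= w] & [&& B <= p, B <= q & B <= r]].

Ltac decide_leq :=
  repeat match goal with |- context [leq ?p ?q] =>
    first [ (have -> : leq p q = true by lia) | (have -> : leq p q = false by lia)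
          | case: (leqP p q) => ? ] end.

(** An exponent is counted once, at a vertex, an edge, a face or in the interior: being near two
    vertices contradicts [2 * A <= m + 1], near two adjacent edges but not their vertex contradicts
    [2 * B <= A + 1], near two faces but not their edge contradicts [2 * C <= B + 1]. *)
Lemma near_partition m A B C a b c d :
  2 * C <= B + 1 -> 2 * B <= A + 1 -> 2 * A <= m + 1 -> a + b + c + d = m ->
  (b + c + d < A) + (a + c + d < A) + (a + b + d < A) + (a + b + c < A) +
  (nearE A B (c + d) (b + c + d) (a + c + d) + nearE A B (b + d) (b + c + d) (a + b + d) +
   nearE A B (b + c) (b + c + d) (a + b + c) + nearE A B (a + d) (a + c + d) (a + b + d) +
   nearE A B (a + c) (a + c + d) (a + b + c) + nearE A B (a + b) (a + b + d) (a + b + c)) +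
  (nearF A B C d (b + c + d) (a + c + d) (a + b + d) (c + d) (b + d) (a + d) +
   nearF A B C c (b + c + d) (a + c + d) (a + b + c) (c + d) (b + c) (a + c) +
   nearF A B C b (b + c + d) (a + b + d) (a + b + c) (b + d) (b + c) (a + b) +
   nearF A B C a (a + c + d) (a + b + d) (a + b + c) (a + d) (a + c) (a + b)) +
  S4 m A B C a b c d = 1.
Proof.
move=> CB BA Am E; rewrite /nearE /nearF /S4 E eqxx !ltnNge.
case: (leqP A (b + c + d)) => v0.
decide_leq; by [].
decide_leq; by [].
Qed.

(** Pairs of a bubble monomial and a face on which it does not vanish, that is, the scalar
    conditions imposed by v.n = 0; there are none unless C = 0. *)
Definition boundary_count n m A B C := cnt4 n (fun a b c d =>
  S4 m A B C a b c d * ((a == 0) + (b == 0) + (c == 0) + (d == 0))).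

Section Count.
Variables (n m A B C : nat).
Hypotheses (CB : 2 * C <= B + 1) (BA : 2 * B <= A + 1) (Am : 2 * A <= m + 1) (mn : m < n).

Definition on_simplex (f : nat -> nat -> nat -> nat -> nat) (a b c d : nat) : nat :=
  (a + b + c + d == m) * f a b c d.

Lemma eq_on_simplex f g :
  (forall a b c d, a + b + c + d = m -> f a b c d = g a b c d) ->
  cnt4 n (on_simplex f) = cnt4 n (on_simplex g).
Proof.
by move=> fg; apply: eq_cnt4 => a b c d *; rewrite /on_simplex; case: eqP => // /fg ->.
Qed.

Lemma on_simplex_01 f : cnt4 n (on_simplex f) = cnt4 n (on_simplex (fun a b c d => f b a c d)).
Proof.
rewrite cnt4_01; apply: eq_cnt4 => a b c d *; rewrite /on_simplex; congr (nat_of_bool (_ == _) * _).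
by lia.
Qed.

Lemma on_simplex_12 f : cnt4 n (on_simplex f) = cnt4 n (on_simplex (fun a b c d => f a c b d)).
Proof.
rewrite cnt4_12; apply: eq_cnt4 => a b c d *; rewrite /on_simplex; congr (nat_of_bool (_ == _) * _).
by lia.
Qed.

Lemma on_simplex_23 f : cnt4 n (on_simplex f) = cnt4 n (on_simplex (fun a b c d => f a b d c)).
Proof.
rewrite cnt4_23; apply: eq_cnt4 => a b c d *; rewrite /on_simplex; congr (nat_of_bool (_ == _) * _).
by lia.
Qed.

Lemma on_simplexD f g : cnt4 n (on_simplex (fun a b c d => f a b c d + g a b c d)) =
  cnt4 n (on_simplex f) + cnt4 n (on_simplex g).
Proof. by rewrite -cnt4D; apply: eq_cnt4 => a b c d *; rewrite /on_simplex mulnDr. Qed.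

Lemma count_vertex :
  cnt4 n (on_simplex (fun a b c d => b + c + d < A)) = cnt3 n (fun b c d => b + c + d < A).
Proof.
rewrite /cnt4 exchange_big; apply: eq_bigr => b _; rewrite exchange_big; apply: eq_bigr => c _.
rewrite exchange_big; apply: eq_bigr => d _; rewrite /on_simplex.
case: (ltnP (b + c + d) A) => h; last by rewrite big1 // => a _; rewrite muln0.
rewrite -[RHS]/1 -(@sum_ord_eq n (m - (b + c + d))); last by lia.
by apply: eq_bigr => a _ /=; lia.
Qed.

(** Here j is the distance to the edge. It splits in j + 1 ways between two coordinates, and
    [m + 1 + j - 2 * A] is the dimension of the polynomials of degree [m - 2 * A + j] on the edge,
    as in the edge moments. *)
Definition edge_count : nat := \sum_(j < B) j.+1 * (m + 1 + j - 2 * A).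

Lemma count_edge :
  cnt4 n (on_simplex (fun a b c d => nearE A B (c + d) (b + c + d) (a + c + d))) = edge_count.
Proof.
rewrite /edge_count -(@sum_ltn_add n B (fun j => m + 1 + j - 2 * A)); last by lia.
rewrite /cnt4.
under eq_bigr => a _ do rewrite exchange_big.
rewrite exchange_big; apply: eq_bigr => c _ /=.
under eq_bigr => a _ do rewrite exchange_big.
rewrite exchange_big; apply: eq_bigr => d _ /=.
rewrite /on_simplex /nearE; case: (ltnP (c + d) B) => h /=; last first.
  by rewrite mul0n big1 // => a _; rewrite big1 // => b _; rewrite muln0.
rewrite mul1n; transitivity (\sum_(a < n) (A - (c + d) <= a <= m - A : nat)).
  apply: eq_bigr => a _; case: (boolP (A - (c + d) <= a <= m - A)) => ha.
    rewrite -[RHS]/1 -(@sum_ord_eq n (m - (a + c + d))); last by lia.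
    by apply: eq_bigr => b _ /=; lia.
  by rewrite big1 // => b _; move: ha; lia.
rewrite sum_ord_interval; lia.
Qed.

(** Here j is the distance to the face; the summand counts the monomials of a face bubble space
    whose degree and orders are all lowered by j, as in the face moments. *)
Definition face_count : nat := \sum_(j < C) cnt3 n (F3 (m - j) (A - j) (B - j)).

Lemma count_face :
  cnt4 n (on_simplex (fun a b c d =>
    nearF A B C d (b + c + d) (a + c + d) (a + b + d) (c + d) (b + d) (a + d))) = face_count.
Proof.
rewrite /face_count /cnt4 /cnt3.
under eq_bigr => a _ do under eq_bigr => b _ do rewrite exchange_big.
under eq_bigr => a _ do rewrite exchange_big.
rewrite exchange_big /=.
have Cn : C <= n by lia.
rewrite (big_ord_widen n (fun j => \sum_(a < n) \sum_(b < n) \sum_(c < n)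
  F3 (m - j) (A - j) (B - j) a b c) Cn) [RHS]big_mkcond; apply: eq_bigr => d _ /=.
case: (ltnP d C) => dC; last first.
  rewrite big1 // => a _; rewrite big1 // => b _; rewrite big1 // => c _.
  by rewrite /on_simplex /nearF ltnNge dC muln0.
apply: eq_bigr => a _; apply: eq_bigr => b _; apply: eq_bigr => c _.
by rewrite /on_simplex /nearF /F3 dC /=; lia.
Qed.

Lemma count_partition : cnt4 n (fun a b c d => a + b + c + d == m) =
  4 * cnt3 n (fun b c d => b + c + d < A) + 6 * edge_count + 4 * face_count +
  cnt4 n (S4 m A B C).
Proof.
have -> : cnt4 n (S4 m A B C) = cnt4 n (on_simplex (S4 m A B C)).
  by apply: eq_cnt4 => a b c d *; rewrite /on_simplex /S4; case: eqP => _ /=; rewrite ?mul1n.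
transitivity (cnt4 n (on_simplex (fun _ _ _ _ => 1))).
  by apply: eq_cnt4 => a b c d *; rewrite /on_simplex muln1.
pose V (a b c d : nat) := (b + c + d < A : nat).
pose E a b c d := (nearE A B (c + d) (b + c + d) (a + c + d) : nat).
pose G a b c d := (nearF A B C d (b + c + d) (a + c + d) (a + b + d) (c + d) (b + d) (a + d) : nat).
rewrite (eq_on_simplex (g := fun a b c d =>
  (V a b c d + V b a c d + V c a b d + V d a b c) +
  (E a b c d + E a c b d + E a d b c + E b c a d + E b d a c + E c d a b) +
  (G a b c d + G a b d c + G a c d b + G b c d a) + S4 m A B C a b c d)); last first.
  move=> a b c d abcd; rewrite -(near_partition CB BA Am abcd) /V /E /G.
  congr (_ + _ + _ + _).
  - by congr (_ + _ + _ + _ + _ + _); congr (nat_of_bool (nearE _ _ _ _ _)); lia.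
  - by congr (_ + _ + _ + _); congr (nat_of_bool (nearF _ _ _ _ _ _ _ _ _ _)); lia.
rewrite !on_simplexD.
have eV : cnt4 n (on_simplex V) = cnt3 n (fun b c d => b + c + d < A) := count_vertex.
have eE : cnt4 n (on_simplex E) = edge_count := count_edge.
have eG : cnt4 n (on_simplex G) = face_count := count_face.
(* Each of the 4 + 6 + 4 layers is V, E or G up to a permutation of the coordinates; these
   permutations are composed from the three adjacent transpositions. *)
have s01 f : cnt4 n (on_simplex (fun a b c d => f b a c d)) = cnt4 n (on_simplex f).
  by rewrite [RHS]on_simplex_01.
have s12 f : cnt4 n (on_simplex (fun a b c d => f a c b d)) = cnt4 n (on_simplex f).
  by rewrite [RHS]on_simplex_12.
have s23 f : cnt4 n (on_simplex (fun a b c d => f a b d c)) = cnt4 n (on_simplex f).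
  by rewrite [RHS]on_simplex_23.
have p2013 f : cnt4 n (on_simplex (fun a b c d => f c a b d)) = cnt4 n (on_simplex f).
  by rewrite (s12 (fun a b c d => f b a c d)) s01.
have p3012 f : cnt4 n (on_simplex (fun a b c d => f d a b c)) = cnt4 n (on_simplex f).
  by rewrite (s23 (fun a b c d => f c a b d)) p2013.
have p0312 f : cnt4 n (on_simplex (fun a b c d => f a d b c)) = cnt4 n (on_simplex f).
  by rewrite (s23 (fun a b c d => f a c b d)) s12.
have p1203 f : cnt4 n (on_simplex (fun a b c d => f b c a d)) = cnt4 n (on_simplex f).
  by rewrite (s01 (fun a b c d => f a c b d)) s12.
have p1302 f : cnt4 n (on_simplex (fun a b c d => f b d a c)) = cnt4 n (on_simplex f).
  by rewrite (s01 (fun a b c d => f a d b c)) p0312.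
have p2301 f : cnt4 n (on_simplex (fun a b c d => f c d a b)) = cnt4 n (on_simplex f).
  by rewrite (s12 (fun a b c d => f b d a c)) p1302.
have p0231 f : cnt4 n (on_simplex (fun a b c d => f a c d b)) = cnt4 n (on_simplex f).
  by rewrite (s12 (fun a b c d => f a b d c)) s23.
have p1230 f : cnt4 n (on_simplex (fun a b c d => f b c d a)) = cnt4 n (on_simplex f).
  by rewrite (s01 (fun a b c d => f a c d b)) p0231.
rewrite (s01 V) (p2013 V) (p3012 V) (s12 E) (p0312 E) (p1203 E) (p1302 E) (p2301 E).
by rewrite (s23 G) (p0231 G) (p1230 G) eV eE eG; lia.
Qed.

Lemma count_faces : C = 0 -> boundary_count n m A B C = 4 * cnt3 n (F3 m A B).
Proof.
rewrite /boundary_count.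
move=> C0; pose G (a b c d : nat) := (S4 m A B C a b c d * (d == 0)).
have eG : cnt4 n (on_simplex G) = cnt3 n (F3 m A B).
  apply: eq_bigr => a _; apply: eq_bigr => b _; apply: eq_bigr => c _.
  have n0 : 0 < n by lia.
  rewrite (bigD1 (Ordinal n0)) //= big1 ?addn0 => [|d d0]; last first.
    by rewrite /on_simplex /G; move: d0; rewrite -val_eqE /= => /negPf ->; rewrite !muln0.
  rewrite /on_simplex /G eqxx muln1 /S4 /F3 C0 !addn0.
  case: eqP => // abc /=; rewrite mul1n; congr nat_of_bool; lia.
rewrite -(eq_cnt4 (f := on_simplex (fun a b c d => G a b c d + G a b d c + G a c d b + G b c d a))).
  rewrite !on_simplexD (on_simplex_23 (fun a b c d => G a b d c)) /=.
  rewrite (on_simplex_12 (fun a b c d => G a c d b)) (on_simplex_23 (fun a b c d => G a b d c)).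
  rewrite (on_simplex_01 (fun a b c d => G b c d a)) (on_simplex_12 (fun a b c d => G a c d b)).
  by rewrite (on_simplex_23 (fun a b c d => G a b d c)) eG; lia.
move=> a b c d _ _ _ _; rewrite /on_simplex /G.
have e1 : S4 m A B C a b d c = S4 m A B C a b c d by rewrite S4_23.
have e2 : S4 m A B C a c d b = S4 m A B C a b c d by rewrite S4_23 S4_12.
have e3 : S4 m A B C b c d a = S4 m A B C a b c d by rewrite S4_23 S4_12 S4_01.
rewrite e1 e2 e3; case: S4P => [[abcd _]|_]; last by rewrite !mul0n muln0.
by rewrite abcd eqxx !mul1n; lia.
Qed.

End Count.

End LatticePoints.

(** * Balancing exponents by unit moves *)

Section LatticePaths.
Local Open Scope nat_scope.

Section Exchange.
Implicit Types m d : 'X_{1..4}.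

Definition o1 : 'I_4 := Ordinal (isT : 1 < 4).
Definition o2 : 'I_4 := Ordinal (isT : 2 < 4).
Definition o3 : 'I_4 := Ordinal (isT : 3 < 4).

Lemma ord4_cases (P : 'I_4 -> Prop) : P ord0 -> P o1 -> P o2 -> P o3 -> forall i, P i.
Proof.
move=> P0 P1 P2 P3 [[|[|[|[|//]]]] i4].
- by rewrite (_ : Ordinal i4 = ord0) //; exact/val_inj.
- by rewrite (_ : Ordinal i4 = o1) //; exact/val_inj.
- by rewrite (_ : Ordinal i4 = o2) //; exact/val_inj.
- by rewrite (_ : Ordinal i4 = o3) //; exact/val_inj.
Qed.

Lemma big_ord4 (T : Type) (idx : T) (op : Monoid.law idx) (F : 'I_4 -> T) :
  \big[op/idx]_i F i = op (F ord0) (op (F o1) (op (F o2) (F o3))).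
Proof.
rewrite !big_ord_recl big_ord0 Monoid.mulm1.
by congr (op _ (op (F _) (op (F _) (F _)))); exact/val_inj.
Qed.

Definition S4m k A B C m := S4 k A B C (m ord0) (m o1) (m o2) (m o3).

Definition shift m i j : 'X_{1..4} := (m + U_(j) - U_(i))%MM.

Lemma shiftE m i j l : shift m i j l = m l + (j == l) - (i == l).
Proof. by rewrite mnmBE mnmDE !mnm1E. Qed.

(** Moving a unit from i to j changes the quadratic part by [4 (m j - m i + 1)] and the linear part
    by [j - i]. A gap of at least 2 gains 4, more than the linear part can lose; a gap of 1 leaves
    the linear part to decide, so that surplus units drift to low indices. *)
Definition energy m := \sum_(i < 4) (2 * m i * m i + i * m i).

Definition extremal m i j :=
  [/\ forall l, m l <= m i, forall l, m j <= m l & m j < m i].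

Variables (K A B C : nat).
Hypotheses (AK : 2 * A <= K.+2)
  (hABC : [\/ [/\ 1 <= C, 2 * C <= B & 2 * B <= A + 1],
             [/\ C = 0, 2 <= B & 2 * B <= A + 1] | [/\ C = 0, B <= 1 & 2 * B <= A]]).
Local Notation inner := (S4m K A.-1 B.-1 C.-1).

(** Since [inner] lowers every bound by one, adding a unit at j can only fail on subsimplices that
    contain j, whose distance it does not raise. There the minimality of [m j] contradicts the
    hypotheses: for C > 0, another coordinate equal to [C - 1] would force [m j = C - 1] too,
    against [2 * C <= B]; an edge from j to i at distance [B - 1] would leave too little distance to
    vertex i. The latter needs [2 <= B] or [2 * B <= A]: for A = B = 1, a power of a single
    coordinate would move onto an edge, which B = 1 forbids. Removing a unit at i then costs each
    bound at most one. *)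
Lemma shift_inner m i j : inner m -> extremal m i j ->
  inner (shift m i j) /\ S4m K.+1 A B C (m + U_(j))%MM.
Proof.
move=> /S4P mS [mi mj mij].
have h1 : 2 * C <= B by case: hABC => -[]; lia.
have h2 : 2 * B <= A + 1 by case: hABC => -[]; lia.
have h3 : 2 <= B \/ 2 * B <= A by case: hABC => -[]; lia.
rewrite /S4m !shiftE !mnmDE !mnm1E.
move: mS (mi ord0) (mi o1) (mi o2) (mi o3) (mj ord0) (mj o1) (mj o2) (mj o3) mij.
have E (i1 i2 : 'I_4) : (i1 == i2) = (val i1 == val i2) by [].
clear mi mj hABC.
move: j; apply: ord4_cases; move: i; apply: ord4_cases; rewrite !E /= ?addn0 ?subn0;
  move: (m ord0) (m o1) (m o2) (m o3) => a b c d;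
  move=> -[? [[? ? ? ?] [[? ? ?] [[? ? ?] [? ? ? ?]]]]] *;
  first [by exfalso; lia|by split; apply/S4P; do ! split; lia].
Qed.

Lemma shift_energy m i j : extremal m i j -> ((m j).+2 <= m i) || (j < i) ->
  energy (shift m i j) < energy m.
Proof.
move=> [_ _]; rewrite /energy !big_ord4 !shiftE.
have E (i1 i2 : 'I_4) : (i1 == i2) = (val i1 == val i2) by [].
move: j; apply: ord4_cases; move: i; apply: ord4_cases; rewrite !E /= ?addn0 ?subn0;
  move: (m ord0) (m o1) (m o2) (m o3) => a b c d; try lia;
  rewrite ?addn1 ?subn1; move=> h1 h2;
  do ! match goal with H : is_true (leq (S _) ?x) |- context [predn ?x] => destruct x as [|x] end;
  nia.
Qed.

(** Exponents as equal as possible, the surplus units being on the lowest indices: a normal form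
    determined by the degree, through its quotient and remainder by 4. *)
Definition settled m := [&& m o1 <= m ord0, m o2 <= m o1, m o3 <= m o2 & m ord0 <= (m o3).+1].

Lemma settledP m : settled m \/ exists i j, extremal m i j /\ (((m j).+2 <= m i) || (j < i)).
Proof.
(* As indices are below 4, these weights compare exponents first and indices next: among equal
   maxima i is the largest index, among equal minima j is the smallest, so that [j < i] holds
   whenever a tie allows it. *)
pose i := [arg max_(i > ord0 | true) (4 * m i + i)].
pose j := [arg min_(j < ord0 | true) (4 * m j + j)].
have [mi mj] : (forall l, 4 * m l + l <= 4 * m i + i) /\ (forall l, 4 * m j + j <= 4 * m l + l).
  split=> l; rewrite /i /j; first by case: arg_maxnP => // i' _ /(_ l isT).
  by case: arg_minnP => // j' _ /(_ l isT).
have [ij|] := boolP ((m j < m i) && (((m j).+2 <= m i) || (j < i))).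
  right; exists i, j; case/andP: ij => mij ->; split=> //; split=> // l.
    by have := mi l; have := ltn_ord l; have := ltn_ord i; lia.
  by have := mj l; have := ltn_ord l; have := ltn_ord j; lia.
move=> ij; left; apply/and4P; move: ij; move: (mi ord0) (mi o1) (mi o2) (mi o3) (mj ord0) (mj o1) (mj o2) (mj o3).
clear mi mj; move: (i) (j) => i0 j0.
move: j0; apply: ord4_cases; move: i0; apply: ord4_cases => /=;
  move: (m ord0) (m o1) (m o2) (m o3) => a b c d *; split; lia.
Qed.

Lemma settled_uniq m d : settled m -> settled d -> mdeg m = mdeg d -> m = d.
Proof.
rewrite !mdegE !big_ord4 /settled => /and4P[? ? ? ?] /and4P[? ? ? ?] /= E.
have [e0 e1 e2 e3] : [/\ m ord0 = d ord0, m o1 = d o1, m o2 = d o2 & m o3 = d o3].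
  by move: E; split; lia.
by apply/mnmP; exact: ord4_cases.
Qed.

(* Moving a unit from a maximal to a minimal exponent never leaves the inner
   index set, and balances the exponents: any two inner indices are linked. *)
Lemma inner_connected (lnk : 'X_{1..4} -> 'X_{1..4} -> Prop) :
  (forall m, lnk m m) -> (forall m d e, lnk m d -> lnk d e -> lnk m e) ->
  (forall m d, lnk m d -> lnk d m) ->
  (forall m i j, inner m -> extremal m i j -> lnk m (shift m i j)) ->
  forall m d, inner m -> inner d -> lnk m d.
Proof.
move=> lrefl ltrans lsym lstep.
have red m : inner m -> exists2 d, inner d /\ settled d & lnk m d.
  have [n] := ubnP (energy m); elim: n m => [//|n IH] m mn mS.
  have [ms|[i [j [mij h]]]] := settledP m; first by exists m.
  have [sS _] := shift_inner mS mij; have es := shift_energy mij h.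
  have [|d dS sd] := IH (shift m i j) _ sS; first exact: leq_trans es _.
  by exists d => //; apply: ltrans sd; exact: lstep.
move=> m d mS dS; have [m' [m'S m's] mm'] := red m mS; have [d' [d'S d's] dd'] := red d dS.
suff E : m' = d' by apply: ltrans mm' _; rewrite E; exact: lsym.
apply: settled_uniq => //; rewrite !mdegE !big_ord4.
by move/S4P: m'S => [+ _]; move/S4P: d'S => [+ _] /=; lia.
Qed.

End Exchange.

End LatticePaths.

(** * Exponents as tuples and as multi-indices *)

Section Tuples.
Variable n : nat.

(** Tuples of bounded numbers serve as index types because their cardinals are the nested sums
    [cnt4]; [mn4] passes to multi-indices. *)
Definition T4 := ('I_n * 'I_n * 'I_n * 'I_n)%type.
Definition onT4 (T : Type) (f : nat -> nat -> nat -> nat -> T) (t : T4) : T :=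
  f t.1.1.1 t.1.1.2 t.1.2 t.2.

Definition mn4 (t : T4) : 'X_{1..4} := [multinom onT4 (fun a b c d => nth 0%N [:: a; b; c; d] i) t | i < 4].

Lemma sum_T4 (f : nat -> nat -> nat -> nat -> nat) : (\sum_(t : T4) onT4 f t = cnt4 n f)%N.
Proof.
rewrite /cnt4 /onT4.
rewrite -(pair_bigA _ (fun (p : 'I_n * 'I_n * 'I_n) (d : 'I_n) => f p.1.1 p.1.2 p.2 d)) /=.
rewrite -(pair_bigA _ (fun (p : 'I_n * 'I_n) (c : 'I_n) => \sum_(d < n) f p.1 p.2 c d)%N) /=.
by rewrite -(pair_bigA _ (fun (a b : 'I_n) => \sum_(c < n) \sum_(d < n) f a b c d)%N).
Qed.

Lemma card_T4 (P : nat -> nat -> nat -> nat -> bool) :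
  #|[pred t | onT4 P t]| = cnt4 n (fun a b c d => P a b c d).
Proof. by rewrite -sum1_card big_mkcond -sum_T4; apply: eq_bigr => t _; rewrite /onT4 inE; case: (P _ _ _ _). Qed.

Lemma mn4E t (P : nat -> nat -> nat -> nat -> bool) :
  onT4 P t = P (mn4 t ord0) (mn4 t o1) (mn4 t o2) (mn4 t o3).
Proof. by rewrite !mnmE. Qed.

Lemma mn4_inj : injective mn4.
Proof.
move=> [[[a b] c] d] [[[a' b'] c'] d'] E.
have H i : mn4 (a, b, c, d) i = mn4 (a', b', c', d') i by rewrite E.
have := H ord0; have := H o1; have := H o2; have := H o3.
by rewrite !mnmE /onT4 /= => /val_inj -> /val_inj -> /val_inj -> /val_inj ->.
Qed.

Lemma mn4_exists m : (mdeg m < n)%N -> exists t, mn4 t = m.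
Proof.
move=> mn; have mi i : (m i < n)%N by rewrite (leq_ltn_trans _ mn) // mdegE (bigD1 i) //= leq_addr.
exists (Ordinal (mi ord0), Ordinal (mi o1), Ordinal (mi o2), Ordinal (mi o3)).
by apply/mnmP; apply: ord4_cases; rewrite mnmE.
Qed.

Definition T3 := ('I_n * 'I_n * 'I_n)%type.
Definition onT3 (T : Type) (f : nat -> nat -> nat -> T) (t : T3) : T := f t.1.1 t.1.2 t.2.

Definition mn3 (t : T3) : 'X_{1..3} := [multinom onT3 (fun a b c => nth 0%N [:: a; b; c] i) t | i < 3].

Lemma card_T3 (P : nat -> nat -> nat -> bool) :
  #|[pred t | onT3 P t]| = cnt3 n (fun a b c => P a b c).
Proof.
rewrite -sum1_card big_mkcond /cnt3.
transitivity (\sum_(t : T3) onT3 P t)%N.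
  by apply: eq_bigr => t _; rewrite /onT3 inE; case: (P _ _ _).
rewrite /onT3 -(pair_bigA _ (fun (p : 'I_n * 'I_n) (c : 'I_n) => P p.1 p.2 c : nat)) /=.
by rewrite -(pair_bigA _ (fun (a b : 'I_n) => \sum_(c < n) P a b c)%N).
Qed.

Definition p0 : 'I_3 := ord0.
Definition p1 : 'I_3 := Ordinal (isT : (1 < 3)%N).
Definition p2 : 'I_3 := Ordinal (isT : (2 < 3)%N).

Lemma big_ord3 (T : Type) (idx : T) (op : Monoid.law idx) (F : 'I_3 -> T) :
  \big[op/idx]_i F i = op (F p0) (op (F p1) (F p2)).
Proof.
rewrite !big_ord_recl big_ord0 Monoid.mulm1.
by congr (op _ (op (F _) (F _))); exact/val_inj.
Qed.

Lemma mn3E t (P : nat -> nat -> nat -> bool) :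
  onT3 P t = P (mn3 t p0) (mn3 t p1) (mn3 t p2).
Proof. by rewrite !mnmE. Qed.

Lemma mn3_exists m : (mdeg m < n)%N -> exists t, mn3 t = m.
Proof.
move=> mn; have mi i : (m i < n)%N by rewrite (leq_ltn_trans _ mn) // mdegE (bigD1 i) //= leq_addr.
exists (Ordinal (mi p0), Ordinal (mi p1), Ordinal (mi p2)).
apply/mnmP => -[[|[|[|//]]] i3]; rewrite mnmE /onT3 /=; congr (m _); exact/val_inj.
Qed.

End Tuples.

Section Distances.

(** A quantification over sets of vertices becomes one over four booleans, whose instances are
    linear inequalities between exponents. *)
Lemma dist_conditions4 (r : seq int) (m : 'X_{1..4}) :
  (forall g : {set 'I_4}, (0 < #|g| <= 3)%N ->
    nth (-1) r #|g|.-1 < (\sum_(i | i \notin g) m i)%N%:Z) <->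
  (forall b0 b1 b2 b3 : bool, (0 < b0 + b1 + b2 + b3 <= 3)%N ->
    nth (-1) r (b0 + b1 + b2 + b3)%N.-1 <
    (~~ b0 * m ord0 + ~~ b1 * m o1 + ~~ b2 * m o2 + ~~ b3 * m o3)%N%:Z).
Proof.
have cE (g : {set 'I_4}) : #|g| = ((ord0 \in g) + (o1 \in g) + (o2 \in g) + (o3 \in g))%N.
  rewrite -sum1_card big_mkcond big_ord4 /= !addnA.
  by do ! (congr (_ + _)%N); case: (_ \in _).
have dE (g : {set 'I_4}) : (\sum_(i | i \notin g) m i = (ord0 \notin g) * m ord0 +
    (o1 \notin g) * m o1 + (o2 \notin g) * m o2 + (o3 \notin g) * m o3)%N.
  rewrite big_mkcond big_ord4 /= !addnA.
  by do ! (congr (_ + _)%N); case: (_ \in _) => /=; rewrite ?mul1n.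
split=> H.
  move=> b0 b1 b2 b3; pose g := [set i : 'I_4 | nth false [:: b0; b1; b2; b3] i]%SET.
  by have := H g; rewrite cE dE !finset.inE.
by move=> g; rewrite cE dE; exact: H.
Qed.

Lemma dist_conditions3 (r : seq int) (m : 'X_{1..3}) :
  (forall g : {set 'I_3}, (0 < #|g| <= 2)%N ->
    nth (-1) r #|g|.-1 < (\sum_(i | i \notin g) m i)%N%:Z) ->
  (forall b0 b1 b2 : bool, (0 < b0 + b1 + b2 <= 2)%N ->
    nth (-1) r (b0 + b1 + b2)%N.-1 <
    (~~ b0 * m p0 + ~~ b1 * m p1 + ~~ b2 * m p2)%N%:Z).
Proof.
have cE (g : {set 'I_3}) : #|g| = ((p0 \in g) + (p1 \in g) + (p2 \in g))%N.
  rewrite -sum1_card big_mkcond big_ord3 /= !addnA.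
  by do ! (congr (_ + _)%N); case: (_ \in _).
have dE (g : {set 'I_3}) : (\sum_(i | i \notin g) m i = (p0 \notin g) * m p0 +
    (p1 \notin g) * m p1 + (p2 \notin g) * m p2)%N.
  rewrite big_mkcond big_ord3 /= !addnA.
  by do ! (congr (_ + _)%N); case: (_ \in _) => /=; rewrite ?mul1n.
move=> H b0 b1 b2; pose g := [set i : 'I_3 | nth false [:: b0; b1; b2] i]%SET.
by have := H g; rewrite cE dE !finset.inE.
Qed.

Lemma S4m_conditions (k A B C : nat) (m : 'X_{1..4}) :
  S4m k A B C m <-> mdeg m = k /\ forall g : {set 'I_4}, (0 < #|g| <= 3)%N ->
    nth (-1) [:: A%:Z - 1; B%:Z - 1; C%:Z - 1] #|g|.-1 < (\sum_(i | i \notin g) m i)%N%:Z.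
Proof.
rewrite dist_conditions4 mdegE big_ord4 /= !addnA /S4m.
move: (m ord0) (m o1) (m o2) (m o3) => a b c d; split.
  move=> /S4P[-> [[? ? ? ?] [[? ? ?] [[? ? ?] [? ? ? ?]]]]]; split=> // -[] [] [] [] //= _; lia.
move=> [E H]; apply/S4P; split=> //.
by do ! split;
  [ move: (H true false false false isT)
  | move: (H false true false false isT)
  | move: (H false false true false isT)
  | move: (H false false false true isT)
  | move: (H true true false false isT)
  | move: (H true false true false isT)
  | move: (H true false false true isT)
  | move: (H false true true false isT)
  | move: (H false true false true isT)
  | move: (H false false true true isT)
  | move: (H false true true true isT)
  | move: (H true false true true isT)
  | move: (H true true false true isT)
  | move: (H true true true false isT) ];
  rewrite /=; lia.
Qed.

(** The bounds a and b enter through implications because orders such as [r - j] may fall below -1,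
    where the natural bound is truncated to 0. *)
Lemma F3_conditions (k A B : nat) (a b : int) (m : 'X_{1..3}) : mdeg m = k ->
  (forall t : nat, a < t%:Z -> (A <= t)%N) -> (forall t : nat, b < t%:Z -> (B <= t)%N) ->
  (forall g : {set 'I_3}, (0 < #|g| <= 2)%N ->
    nth (-1) [:: a; b] #|g|.-1 < (\sum_(i | i \notin g) m i)%N%:Z) ->
  F3 k A B (m p0) (m p1) (m p2).
Proof.
rewrite mdegE big_ord3 /= !addnA; move=> E ha hb /dist_conditions3 H; rewrite /F3 E eqxx /=.
move: H; move: (m p0) (m p1) (m p2) => x y z H.
by apply/andP; split; apply/and3P; split; [apply: ha|apply: ha|apply: ha|apply: hb..];
  [ move: (H true false false isT) | move: (H false true false isT)
  | move: (H false false true isT) | move: (H false true true isT)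
  | move: (H true false true isT) | move: (H true true false isT) ];
  rewrite /= ?mul1n ?addn0.
Qed.

End Distances.

(** * Dimensions *)

Section BubbleDimensions.
Context {R : realType}.

Lemma bubbleF_span n k A B (a b : int) : (k < n)%N ->
  (forall t : nat, a < t%:Z -> (A <= t)%N) -> (forall t : nat, b < t%:Z -> (B <= t)%N) ->
  (@bubbleF R k%:Z a b `<=` spanF (fun t : {t : T3 n | onT3 (F3 k A B) t} =>
     \prod_i @bary_std R 2 i ^+ mn3 (val t) i))%classic.
Proof.
move=> kn ha hb; apply: lspan_sub; first exact: spanF_lin.
move=> _ [m [[mk] mg ->]].
have [t tm] : exists t : T3 n, mn3 t = m by apply: mn3_exists; rewrite mk.
have tF : onT3 (F3 k A B) t by rewrite mn3E tm; exact: F3_conditions ha hb mg.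
have := spanF_gen (fun t : {t : T3 n | onT3 (F3 k A B) t} =>
     \prod_i @bary_std R 2 i ^+ mn3 (val t) i) (exist _ t tF).
by rewrite /= tm.
Qed.

Lemma card_F3 n k A B : #|{: {t : T3 n | onT3 (F3 k A B) t}}| = cnt3 n (F3 k A B).
Proof. by rewrite card_sig card_T3. Qed.

Lemma card_S4 n k A B C :
  #|{: {t : T4 n | onT4 (S4 k A B C) t}}| = cnt4 n (S4 k A B C).
Proof. by rewrite card_sig card_T4. Qed.

End BubbleDimensions.

(** * Bernstein coefficients *)

Section Homogenization.
Context {R : realType} {x : 'I_4 -> 'rV[R]_3} (xT : tetrahedron x).
Local Notation poly3 := {mpoly R[3]}.
Local Notation poly4 := {mpoly R[4]}.
Local Notation bern := (@bern R x).
Local Notation bernstein := (@bernstein R x).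
Implicit Types (p q : poly3) (P : poly4).

(* Inverse of bern on forms of degree k: the coordinate c becomes the linear form
   \sum_i x i 0 c *: 'X_i, and \sum_i 'X_i, which bern maps to 1, makes up the degree. *)
Definition hom_mon k (m : 'X_{1..3}) : poly4 :=
  \prod_c (\sum_i x i 0 c *: 'X_i) ^+ m c * (\sum_i 'X_i) ^+ (k - mdeg m).

Definition hom k p : poly4 := \sum_(m : 'X_{1..3 < k.+1}) p@_m *: hom_mon k m.

Lemma hom_lin k c p q : hom k (c *: p + q) = c *: hom k p + hom k q.
Proof.
rewrite /hom scaler_sumr -big_split; apply: eq_bigr => m _ /=.
by rewrite mcoeffD mcoeffZ scalerDl scalerA.
Qed.

Lemma homog_prod_exp (I : finType) (e : I -> nat) (F : I -> poly4) :
  (forall i, F i \is 1.-homog) -> \prod_i F i ^+ e i \is (\sum_i e i).-homog.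
Proof.
move=> F1; elim/big_rec2: _ => [|i m p _ pm]; first exact: dhomog1.
by apply: dhomogM => //; have := dhomogMn (e i) (F1 i); rewrite mul1n.
Qed.

Lemma hom_mon_homog k m : (mdeg m <= k)%N -> hom_mon k m \is k.-homog.
Proof.
move=> mk; rewrite -{2}(subnKC mk) /hom_mon; apply: dhomogM.
  rewrite mdegE; apply: homog_prod_exp => c; apply: rpred_sum => i _.
  by apply: dhomogZ; rewrite dhomogX /= mdeg1.
have : \sum_i 'X_i \is [in R[4], 1.-homog].
  by apply: rpred_sum => i _; rewrite dhomogX /= mdeg1.
by move=> /(dhomogMn (k - mdeg m)); rewrite mul1n.
Qed.

Lemma hom_homog k p : hom k p \is k.-homog.
Proof.
apply: rpred_sum => m _; apply/dhomogZ/hom_mon_homog.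
by rewrite -ltnS; exact: bmdeg.
Qed.

Lemma bern_exp P e : bern (P ^+ e) = bern P ^+ e.
Proof. exact: rmorphXn. Qed.

Lemma bern_prod (I : Type) (r : seq I) (F : I -> poly4) :
  bern (\prod_(i <- r) F i) = \prod_(i <- r) bern (F i).
Proof. exact: rmorph_prod. Qed.

Lemma bern_hom k p : (msize p <= k.+1)%N -> bern (hom k p) = p.
Proof.
move=> pk; rewrite [RHS](mpolywE pk) /hom bern_sum; apply: eq_bigr => m _.
rewrite bernZ /hom_mon bernM bern_exp bern_sum; congr (_ *: _).
rewrite (eq_bigr _ (fun i _ => bernXU i)) sum_bary expr1n mulr1 bern_prod.
rewrite [RHS]mpolyXE_id; apply: eq_bigr => c _; rewrite bern_exp bern_sum; congr (_ ^+ _).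
rewrite (coordE xT c); apply: eq_bigr => i _; by rewrite bernZ bernXU.
Qed.

Lemma msize_bern k P : P \is k.-homog -> (msize (bern P) <= k.+1)%N.
Proof.
move=> Pk; rewrite (mpolyE P) bern_sum (leq_trans (msize_sum _ _ _)) //.
apply/bigmax_leqP_seq => m mP _; rewrite bernZ (leq_trans (msizeZ_le _ _)) // bernX.
have := @msize_prod_leq R 3 _ (index_enum _) (fun i : 'I_4 => (1 * m i)%N) _
     (fun i => msize_exp_leq (m i) (@msize_bary R x i)).
by rewrite (eq_bigr m) -?mdegE ?(homog_mdeg Pk mP) // => i _; rewrite mul1n.
Qed.

Lemma hom_bern k P : P \is k.-homog -> hom k (bern P) = P.
Proof.
move=> Pk; apply/eqP; rewrite -subr_eq0; apply/eqP/(bernstein_inj xT (k := k)).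
  by apply: rpredB => //; exact: hom_homog.
by rewrite bernB bern_hom ?subrr //; exact: msize_bern.
Qed.

(** The Bernstein coefficient in degree k as a linear functional on all polynomials, the form
    required by [kernel_codim]. *)
Definition bcoef k (m : 'X_{1..4}) p : R := (hom k p)@_m.

Lemma bcoef_scalar k m : scalar (bcoef k m).
Proof. by move=> c p q; rewrite /bcoef hom_lin mcoeffD mcoeffZ. Qed.

Lemma bcoef_bern k m P : P \is k.-homog -> bcoef k m (bern P) = P@_m.
Proof. by move=> Pk; rewrite /bcoef hom_bern. Qed.

Lemma bcoef_bernX k (m d : 'X_{1..4}) : mdeg d = k -> bcoef k m (bern 'X_[d]) = (d == m)%:R.
Proof. by move=> dk; rewrite bcoef_bern ?mcoeffX // dhomogX /= dk. Qed.

End Homogenization.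

Section Spaces.
Context {R : realType} {x : 'I_4 -> 'rV[R]_3} (xT : tetrahedron x).
Local Notation vpoly := {ffun 'I_3 -> {mpoly R[3]}}.
Local Notation bern := (@bern R x).
Local Notation bernstein := (@bernstein R x).
Variable n : nat.

Definition gen4 (t : T4 n) : {mpoly R[3]} := bern 'X_[mn4 t].

Lemma bubbleT_span k A B C : (k < n)%N ->
  (bubbleT x k%:Z (Smoothness (A%:Z - 1) (B%:Z - 1) (C%:Z - 1)) `<=`
   spanF (fun t : {t : T4 n | onT4 (S4 k A B C) t} => gen4 (val t)))%classic.
Proof.
move=> kn; apply: lspan_sub; first exact: spanF_lin.
move=> _ [m [[mk] mg ->]].
have [t tm] : exists t : T4 n, mn4 t = m by apply: mn4_exists; rewrite mk.
have tS : onT4 (S4 k A B C) t.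
  by rewrite mn4E tm; apply/S4m_conditions; split.
have := spanF_gen (fun t : {t : T4 n | onT4 (S4 k A B C) t} => gen4 (val t)) (exist _ t tS).
by rewrite /gen4 /= bernX tm.
Qed.

Lemma bubbleT_bernX k A B C m : S4m k A B C m ->
  bubbleT x k%:Z (Smoothness (A%:Z - 1) (B%:Z - 1) (C%:Z - 1)) (bern 'X_[m]).
Proof.
move=> /S4m_conditions[mk mg]; apply: lspan_gen; exists m; split=> //; first by rewrite mk.
exact: bernX.
Qed.

Lemma VPol_basis m : is_basis (@VPol R m) (lbasis (@VPol R m)).
Proof.
apply: (basis_exists (u := fun cj => vunit cj.1 ('X_[val (cj.2 : 'X_{1..3 < absz (m + 1)})]))).
  exact/lin_closed_vpoly/Pol_lin.
move=> v vP; apply: (spanF_vpoly (u := fun a : 'X_{1..3 < absz (m + 1)} => 'X_[val a])) => c.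
exact: (Pol_span (vP c)).
Qed.

(** The Bernstein monomials placed in one component each form a free family, the Bernstein
    coefficients of the components being dual to them. *)
Lemma ldim_VPol_geq k : (k < n)%N ->
  (3 * cnt4 n (fun a b c d => a + b + c + d == k) <= ldim (@VPol R k%:Z))%N.
Proof.
move=> kn.
pose I := {t : T4 n | onT4 (fun a b c d => a + b + c + d == k)%N t}.
have <- : #|{: 'I_3 * I}| = (3 * cnt4 n (fun a b c d => a + b + c + d == k)%N)%N.
  by rewrite card_prod card_ord card_sig card_T4.
have Ik (t : I) : mdeg (mn4 (val t)) = k.
  have := valP t; rewrite (mn4E (val t) (fun a b c d => a + b + c + d == k)%N).
  by rewrite mdegE big_ord4 /= !addnA => /eqP.
apply: (free_leq_ldim (f := fun ct : 'I_3 * I => vunit ct.1 (gen4 (val ct.2))) (VPol_basis _)); last first.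
  move=> [c t] c'; rewrite ffunE; case: eqP => _; last by left.
  right; have : (msize (gen4 (val t)) <= k.+1)%N.
    by apply: msize_bern; rewrite dhomogX /= Ik.
  by move: (msize _) => s /=; lia.
move=> a E [c t].
have := congr1 (fun v : vpoly => @bcoef R x k (mn4 (val t)) (v c)) E.
rewrite ffunE (scalar0 (@bcoef_scalar R x k _)) => <-.
have L : scalar (fun v : vpoly => @bcoef R x k (mn4 (val t)) (v c)).
  by move=> b v w; rewrite !ffunE bcoef_scalar.
rewrite (scalar_lincomb _ _ L) (bigD1 (c, t)) //= ffunE.
rewrite eqxx /gen4 (bcoef_bernX xT); last exact: Ik.
rewrite eqxx mulr1.
rewrite big1 ?addr0 // => -[c' t'] ct; rewrite ffunE /=.
case: eqP => [cc|_]; last by rewrite (scalar0 (@bcoef_scalar R x k _)) mulr0.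
rewrite (bcoef_bernX xT); last exact: Ik.
case: eqP => [/mn4_inj/val_inj tt|_]; last by rewrite mulr0.
by rewrite -cc tt eqxx in ct.
Qed.

End Spaces.

Lemma card_but_one (T : finType) (P : pred T) t0 : P t0 ->
  #|[pred t | P t]| = #|{: {t | P t && (t != t0)}}|.+1.
Proof.
move=> Pt0; rewrite (cardD1 t0) inE Pt0 add1n card_sig.
by congr _.+1; apply: eq_card => t; rewrite !inE andbC.
Qed.

Lemma mn4_eq n (t t' : T4 n) : (mn4 t == mn4 t') = (t == t').
Proof. exact: inj_eq (@mn4_inj _) _ _. Qed.

(** * Dimension of the divergence-free bubbles *)

Section Kernel.
Context {R : realType} {x : 'I_4 -> 'rV[R]_3} {F : @frames R}.
Context (xT : tetrahedron x) (hF : frames_of x F).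
Local Notation vpoly := {ffun 'I_3 -> {mpoly R[3]}}.
Local Notation bern := (@bern R x).
Local Notation bernstein := (@bernstein R x).
Local Notation grad := (@grad R x).
Local Notation zero_on := (@zero_on R x).
Local Notation bcoef := (@bcoef R x).
Local Notation gen4 := (@gen4 R x _).
Local Notation mfact := (@mfact R).
Implicit Types (v w : vpoly) (m : 'X_{1..4}).

Definition vfield (t : 'rV[R]_3) (p : {mpoly R[3]}) : vpoly := [ffun c => t 0 c *: p].

Lemma dotc_vfield t p n : dotc (vfield t p) n = dotv t n *: p.
Proof.
rewrite /dotc /dotv scaler_suml; apply: eq_bigr => c _.
by rewrite ffunE scalerA mulrC.
Qed.

Lemma divg_vfield t p : divg (vfield t p) = dderiv t p.
Proof. by apply: eq_bigr => c _; rewrite ffunE mderivZ. Qed.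

Lemma face_eq f : f \in Delta 2 -> exists l, f = (~: [set l])%SET.
Proof.
rewrite mem_enum finset.inE => /eqP fc.
have /eqP/cards1P[l lE] : #|(~: f)%SET| = 1%N.
  by have := cardsC f; rewrite fc card_ord; lia.
by exists l; rewrite -lE finset.setCK.
Qed.

Lemma bubbleT_bernstein (k : nat) r p : bubbleT x k%:Z r p -> bernstein k p.
Proof.
apply: lspan_sub; first by split=> [|a p1 p2 b1 b2];
  [exact: bernstein0|apply: bernsteinD => //; exact: bernsteinZ].
move=> _ [m [[mk] _ ->]]; exists 'X_[m]; last by rewrite bernX.
by rewrite dhomogX /= mk.
Qed.

Section Div.
Variables (K A B C : nat).
Hypotheses (AK : (2 * A <= K.+2)%N)
  (hABC : [\/ [/\ 1 <= C, 2 * C <= B & 2 * B <= A + 1]%N,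
             [/\ C = 0, 2 <= B & 2 * B <= A + 1]%N | [/\ C = 0, B <= 1 & 2 * B <= A]%N]).
Local Notation k := K.+1.
Local Notation n := K.+2.
Local Notation r2 := (Smoothness (A%:Z - 1) (B%:Z - 1) (C%:Z - 1)).
Local Notation Bdiv := (bubbleDiv x F k%:Z r2).
Local Notation inner := (S4m K A.-1 B.-1 C.-1).

Lemma Bdiv_trace v l m : Bdiv v -> m l = 0%N -> bcoef k m (dotc v (grad l)) = 0.
Proof.
move=> [vB vn] ml; have [fD [c gE]] := normal_grad xT l hF.
set f := (~: [set l])%SET in fD gE.
have zf : zero_on f (dotc v (fn F f)).
  apply: (zero_on_restr fD); apply: mpoly_eq0_simplex => s s0 s1.
  rewrite meval_restr; apply: vn => // [j|]; exact: ltW.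
have [P Pk PE] : bernstein k (dotc v (grad l)).
  by apply: bernstein_sum => c' _; apply/bernsteinZ/(bubbleT_bernstein (vB c')).
rewrite PE (bcoef_bern xT) //; apply: (homog_coef_on_face Pk (g := f)).
- exact: Delta_neq0 fD.
- move=> y yf y1; rewrite -(ev_bern_comb xT) // -PE gE.
  have -> : dotc v (c *: fn F f) = c *: dotc v (fn F f).
    by rewrite -[c *: fn F f]addr0 dotc_vlin dotc_v0 addr0.
  by rewrite evZ zf // mulr0.
- by rewrite /dist (big_pred1 l) // => i; rewrite !finset.inE negbK.
Qed.

(** The pairs counted by [boundary_count]: a monomial without the coordinate l does not vanish on
    the face opposite to vertex l. *)
Definition trace_idx := {tl : T4 n * 'I_4 | onT4 (S4 k A B C) tl.1 && (mn4 tl.1 tl.2 == 0%N)}.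

Lemma card_trace_idx : #|{: trace_idx}| = boundary_count n k A B C.
Proof.
rewrite /boundary_count card_sig -sum1_card big_mkcond -sum_T4.
rewrite -(pair_bigA _ (fun (t : T4 n) (l : 'I_4) =>
  if onT4 (S4 k A B C) t && (mn4 t l == 0%N) then 1%N else 0%N)) /=.
apply: eq_bigr => t _; rewrite big_ord4 /= !mnmE /onT4 /= !addnA.
case: (S4 _ _ _ _ _ _ _ _) => /=; last by [].
by rewrite mul1n; do ! (congr (_ + _)%N); case: (_ == 0%N).
Qed.

(** The condition attached to (t, l) is the coefficient at t of v times the gradient of the
    coordinate l. Its dual field is the monomial t directed along [x l - x s], where s is a
    coordinate that occurs in t: the gradient of any coordinate absent from t sees only [x l], not
    [x s]. *)
Lemma ldim_Bdiv : (ldim Bdiv + #|{: trace_idx}| <= 3 * cnt4 n (S4 k A B C))%N.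
Proof.
pose J := ('I_3 * {t : T4 n | onT4 (S4 k A B C) t})%type.
have <- : #|{: J}| = (3 * cnt4 n (S4 k A B C))%N.
  by rewrite card_prod card_ord card_S4.
(* Some coordinate that occurs in m; in degree k, which is positive, the default is never taken. *)
pose src m := odflt ord0 [pick i | m i != 0%N].
have srcP m : mdeg m = k -> m (src m) != 0%N.
  move=> mk; rewrite /src; case: pickP => // m0.
  have : mdeg m = 0%N by rewrite mdegE big1 // => i _; apply/eqP; have := m0 i; case: eqP.
  by rewrite mk.
pose z (tl : trace_idx) := let: (t, l) := val tl in
  vfield (x l - x (src (mn4 t))) (gen4 t).
have idxP (tl : trace_idx) : S4m k A B C (mn4 (val tl).1) /\ mn4 (val tl).1 (val tl).2 = 0%N.
  by case/andP: (valP tl); rewrite mn4E => ? /eqP.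
have degP (tl : trace_idx) : mdeg (mn4 (val tl).1) = k.
  by case: (idxP tl) => /S4m_conditions[].
apply: (@kernel_codim R _ J (fun cj => vunit cj.1 (gen4 (val cj.2)))
  [set v : vpoly | forall c, bubbleT x k%:Z r2 (v c)]%classic _ _
  (fun tl : trace_idx => fun v => bcoef k (mn4 (val tl).1) (dotc v (grad (val tl).2))) z).
- by move=> tl a v w; rewrite dotc_lin bcoef_scalar.
- move=> v vB; apply: (spanF_vpoly (u := fun t : {t : T4 n | onT4 (S4 k A B C) t} => gen4 (val t))) => c.
  exact: (bubbleT_span (ltnSn _) (vB c)).
- exact: bubbleDiv_lin.
- by move=> v [].
- by move=> tl v vB; apply: Bdiv_trace => //; case: (idxP tl).
- move=> tl c; case: (idxP tl); rewrite /z; case: (val tl) => t l /= tS _; rewrite ffunE.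
  by apply: lin_closedZ; [exact: bubble_lin|exact: bubbleT_bernX].
- move=> tl tl'; have := degP tl'; have := idxP tl; have := idxP tl'; rewrite -val_eqE /z.
  case: (val tl) (val tl') => t l [t' l'] /= [_ tl'0] [_ tl0] tk.
  rewrite dotc_vfield (scalarZ _ _ (@bcoef_scalar R x _ _)) /gen4 (bcoef_bernX xT) //.
  rewrite mn4_eq xpair_eqE eq_sym.
  case: eqP => [tt|_]; last by rewrite mulr0.
  rewrite mulr1 (dotv_grad_edge xT) -tt [l == src _](_ : _ = false) ?subr0 //.
  by apply/eqP => ls; have := srcP (mn4 t); rewrite -ls tl0 tt => /(_ tk).
Qed.

(* With this normalization, the field (x j - x i) lam^a / a! has the divergence
   nrm (a - U_(j)) - nrm (a - U_(i)). *)
Definition nrm m : {mpoly R[3]} := (mfact m)^-1 *: bern 'X_[m].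

Definition div_image : set {mpoly R[3]} := [set p | exists2 w, Bdiv w & divg w = p]%classic.

Lemma div_image_lin : lin_closed div_image.
Proof.
split.
  exists 0; first by case: (@bubbleDiv_lin R x F k%:Z r2).
  by rewrite /divg big1 // => c _; rewrite ffunE mderiv0.
move=> a _ _ [v vB <-] [w wB <-]; exists (a *: v + w); last exact: divg_lin.
exact: (proj2 (@bubbleDiv_lin R x F k%:Z r2)).
Qed.

(** On the face opposite to vertex l, either the coordinate l occurs in the monomial, which then
    vanishes there, or i and j are both vertices of the face and [x j - x i] is tangential. *)
Lemma bubbleDiv_edge_field m i j c : S4m k A B C m -> i != j -> m i != 0%N -> m j != 0%N ->
  Bdiv (vfield (x j - x i) (c *: bern 'X_[m])).
Proof.
move=> mS ij mi mj; split=> [c'|f fD s s0 s1].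
  rewrite ffunE; do 2![apply: lin_closedZ; first exact: bubble_lin].
  exact: bubbleT_bernX.
rewrite dotc_vfield !evZ; have [l fE] := face_eq fD.
have [ml|ml] := eqVneq (m l) 0%N; last first.
  have -> : ev (bern 'X_[m]) (affpt (@vtx R x 2 f) s) = 0; last by rewrite !mulr0.
  rewrite (ev_affpt_bern xT (gam_of (d := 2) (g := f))) mevalX (bigD1 l) //= gwt_out.
    by rewrite expr0n (negPf ml) mul0r.
  by rewrite (gset_gam_of fD) fE !finset.inE negbK.
have inf a : m a != 0%N -> a \in f.
  by move=> ma; rewrite fE !finset.inE; apply: contraNneq ma => ->; rewrite ml.
have [fN _ _ _ _] := proj2 hF _ fD.
have vtxE a : m a != 0%N -> exists b, x a = @vtx R x 2 f b.
  by move=> /inf; rewrite -{1}(gset_gam_of fD) => /imsetP[b _ ->]; exists b.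
have fN' b : dotv (@vtx R x 2 f b) (fn F f) = dotv (@vtx R x 2 f ord0) (fn F f).
  case: (unliftP ord0 b) => [b'|] -> //.
  have := fN b'; rewrite dotvC addrC -scaleN1r dotv_linl mulN1r => /eqP.
  by rewrite addrC subr_eq0 => /eqP.
have -> : dotv (x j - x i) (fn F f) = 0; last by rewrite mul0r.
have [[b ->] [b' ->]] := (vtxE j mj, vtxE i mi).
by rewrite addrC -scaleN1r dotv_linl mulN1r !fN' addNr.
Qed.

Lemma nrm_shift m i j : inner m -> extremal m i j -> div_image (nrm m - nrm (shift m i j)).
Proof.
move=> mS mij; have [_ aS] := shift_inner AK hABC mS mij.
case: (mij) => mi mj mlt; set a := (m + U_(j))%MM in aS *.
have ij : i != j by apply: contraTneq mlt => ->; rewrite ltnn.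
have aj : a j != 0%N by rewrite mnmDE mnm1E eqxx addn1.
have ai : a i != 0%N by rewrite mnmDE mnm1E [j == i]eq_sym (negPf ij) addn0 -lt0n (leq_ltn_trans _ mlt).
exists (vfield (x j - x i) ((mfact a)^-1 *: bern 'X_[a])).
  exact: bubbleDiv_edge_field.
have D l : a l != 0%N -> (mfact a)^-1 *: bern ('X_[a])^`M(l) = nrm (a - U_(l))%MM.
  move=> al; rewrite mderivX bernZ scalerA /nrm; congr (_ *: _).
  rewrite -(mfact_deriv al) invfM mulrAC mulVf ?mul1r //.
  by rewrite pnatr_eq0.
rewrite divg_vfield dderivZ (dderiv_edge_bern xT _ ij) bernB scalerBr (D j aj) (D i ai).
have -> : shift m i j = (a - U_(i))%MM by [].
by rewrite /a addmK.
Qed.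

Lemma nrm_linked m m' : inner m -> inner m' -> div_image (nrm m - nrm m').
Proof.
have Il := div_image_lin.
apply: (inner_connected AK hABC (lnk := fun m m' => div_image (nrm m - nrm m'))).
- by move=> a; rewrite subrr; case: Il.
- by move=> a b c ab bc; rewrite -(subrK (nrm b) (nrm a)) -addrA; exact: lin_closedD.
- by move=> a b ab; rewrite -opprB -scaleN1r; exact: lin_closedZ.
- exact: nrm_shift.
Qed.

(** At the inner exponents other than [t0], the normalized Bernstein coefficients of the divergence
    are dual to fields whose divergence is [nrm] of the exponent minus [nrm] of [t0]. The unit on
    the right pays for [t0]; it reflects the mean value, which is zero for every divergence of
    [Bdiv]. *)
Lemma ldim_kerdiv :
  (0 < cnt4 n (S4 K A.-1 B.-1 C.-1))%N ->
  (ldim [set w | Bdiv w /\ divg w = 0%R]%classic +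
   cnt4 n (S4 K A.-1 B.-1 C.-1) <= (ldim Bdiv).+1)%N.
Proof.
rewrite -card_T4 => /card_gt0P[t0 t0S].
have inn (t : T4 n) : onT4 (S4 K A.-1 B.-1 C.-1) t -> inner (mn4 t) by rewrite mn4E.
pose I := {t : T4 n | onT4 (S4 K A.-1 B.-1 C.-1) t && (t != t0)}.
have cI : #|[pred t : T4 n | onT4 (S4 K A.-1 B.-1 C.-1) t]| = #|{: I}|.+1 by exact: card_but_one.
rewrite cI addnS ltnS -[X in (_ <= X)%N]card_ord.
have Bb : is_basis Bdiv (lbasis Bdiv).
  exact: (basis_exists (@bubbleDiv_lin R x F k%:Z r2) (@bubbleDiv_span R x F k%:Z r2)).
have ex (t : I) : exists w, Bdiv w /\ divg w = nrm (mn4 (val t)) - nrm (mn4 t0).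
  have [tS _] := andP (valP t).
  by have [w] := nrm_linked (inn (val t) tS) (inn t0 t0S); exists w.
have /choice[z zP] := ex.
apply: (@kernel_codim R _ _ (fun i : 'I_(size (lbasis Bdiv)) => (lbasis Bdiv)`_i) Bdiv _ _
  (fun (t : I) v => mfact (mn4 (val t)) * bcoef K (mn4 (val t)) (divg v)) z).
- by move=> t a v w; rewrite divg_lin bcoef_scalar mulrDr mulrCA.
- exact: basis_span.
- exact: kerdiv_lin.
- by move=> v [].
- by move=> t v [_ ->]; rewrite (scalar0 (@bcoef_scalar R x _ _)) mulr0.
- by move=> t; case: (zP t).
- move=> t t'; case: (zP t') => _ ->.
  have [tS tt0] := andP (valP t); have [t'S _] := andP (valP t').
  have deg (s : T4 n) : onT4 (S4 K A.-1 B.-1 C.-1) s -> mdeg (mn4 s) = K.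
    by move=> sS; have /S4m_conditions[] := inn s sS.
  rewrite (scalarB _ _ (@bcoef_scalar R x _ _)) /nrm !(scalarZ _ _ (@bcoef_scalar R x _ _)).
  rewrite !(bcoef_bernX xT) ?deg // !mn4_eq [t0 == _]eq_sym (negPf tt0).
  rewrite mulr0 subr0 -val_eqE eq_sym; case: eqP => [->|_]; last by rewrite !mulr0.
  by rewrite mulr1 mulfV // mfact_neq0.
Qed.

Lemma ldim_kerdiv_bound :
  (0 < cnt4 n (S4 K A.-1 B.-1 C.-1))%N ->
  (ldim [set w | Bdiv w /\ divg w = 0%R]%classic +
   cnt4 n (S4 K A.-1 B.-1 C.-1) + boundary_count n k A B C <= (3 * cnt4 n (S4 k A B C)).+1)%N.
Proof.
move=> /ldim_kerdiv h; have := ldim_Bdiv; rewrite card_trace_idx; move: h.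
move: (ldim _) (ldim _) (boundary_count _ _ _ _ _) (cnt4 _ _) (cnt4 _ _) => a b c d e; lia.
Qed.

End Div.
End Kernel.

(** * The number of degrees of freedom *)

Section Linearity.
Context {R : realType} {x : 'I_4 -> 'rV[R]_3} {F : @frames R}.
Local Notation vpoly := {ffun 'I_3 -> {mpoly R[3]}}.

Definition lin_op (Phi : vpoly -> {mpoly R[3]}) :=
  forall a v w, Phi (a *: v + w) = a *: Phi v + Phi w.

Lemma lin_op_dotc n : lin_op (fun v => dotc v n).
Proof. by move=> a v w; exact: dotc_lin. Qed.

Lemma lin_op_iter n j Phi : lin_op Phi -> lin_op (fun v => iter j (dderiv n) (Phi v)).
Proof. by move=> Pl a v w; rewrite Pl iter_dderiv_lin. Qed.

Lemma lin_op_dnormal n1 n2 ij Phi : lin_op Phi -> lin_op (fun v => dnormal n1 n2 ij (Phi v)).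
Proof. by move=> Pl; do 2!apply: lin_op_iter. Qed.

Lemma ev_scalar Phi m a : lin_op Phi -> scalar (fun v => ev ((Phi v)^`M[m]) a).
Proof. by move=> Pl b v w; rewrite Pl linearP /= /ev mevalD mevalZ. Qed.

Lemma moments_pairing_scalar d (y : 'I_d.+1 -> 'rV[R]_3) W Phi : lin_op Phi ->
  AllP (fun l : dof => scalar l) (moments W (fun v => pairing y (Phi v))).
Proof.
move=> Pl; apply: AllP_map => q a v w.
by rewrite Pl !pairingE restr_lin mulrDl linearD -scalerAl linearZ mulrDr mulrCA.
Qed.

Lemma dofs_scalar k r2 r3 : AllP (fun l : dof => scalar l) (dofs x F k r2 r3).
Proof.
rewrite /dofs; do ! apply: AllP_cat.
- apply: AllP_allpairs => g [m c]; apply: ev_scalar => a v w.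
  by rewrite !ffunE.
- by apply: AllP_allpairs => g m; apply: ev_scalar => a v w; exact: divg_lin.
- apply/AllP_flatten/AllP_allpairs => e j; apply: moments_pairing_scalar.
  exact/lin_op_iter/lin_op_dotc.
- apply/AllP_flatten/AllP_allpairs => e ij; apply: moments_pairing_scalar.
  exact/lin_op_dnormal/lin_op_dotc.
- apply/AllP_flatten/AllP_allpairs => e ij; apply: moments_pairing_scalar.
  exact/lin_op_dnormal/lin_op_dotc.
- apply/AllP_flatten/AllP_allpairs => e ij; apply: moments_pairing_scalar.
  by apply: lin_op_dnormal => a v w; exact: divg_lin.
- by apply/AllP_flatten/AllP_map => f; apply: moments_pairing_scalar; exact: lin_op_dotc.
- apply/AllP_flatten/AllP_allpairs => f jt; apply: moments_pairing_scalar.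
  exact/lin_op_iter/lin_op_dotc.
- apply/AllP_flatten/AllP_allpairs => f j; apply: moments_pairing_scalar.
  by apply: lin_op_iter => a v w; exact: divg_lin.
- apply: AllP_map => q a v w; rewrite divg_lin mulrDl -scalerAl.
  exact: cell_int_scalar.
- apply: AllP_map => q a v w; rewrite -cell_int_scalar; congr cell_int.
  rewrite /dotp scaler_sumr -big_split; apply: eq_bigr => c _.
  by rewrite !ffunE mulrDl scalerAl.
Qed.

End Linearity.

Section Sizes.

Lemma size_flatten_map (S T : Type) (f : S -> seq T) s :
  size (flatten (map f s)) = (\sum_(i <- s) size (f i))%N.
Proof. by rewrite size_flatten /shape -map_comp sumnE big_map. Qed.

Lemma size_flatten_allpairs (S T U : Type) (f : S -> T -> seq U) (c : T -> nat) s t :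
  (forall x y, (size (f x y) <= c y)%N) ->
  (size (flatten (allpairs f s t)) <= size s * \sum_(y <- t) c y)%N.
Proof.
move=> fc; elim: s => //= x s IH; rewrite flatten_cat size_cat mulSn leq_add //.
by rewrite size_flatten_map leq_sum.
Qed.

Lemma size_Delta l : size (Delta l) = 'C(4, l.+1).
Proof. by rewrite -cardE card_draws card_ord. Qed.

Lemma irange_from lo n : irange lo%:Z (n%:Z - 1) = index_iota lo n.
Proof.
have -> : irange lo%:Z (n%:Z - 1) = [seq j <- irange 0 (n%:Z - 1) | (lo <= j)%N].
  by rewrite -filter_predI; apply: eq_filter => j /=; lia.
rewrite irange_nat; have [ln|nl] := leqP lo n.
  rewrite -(subnKC ln) iotaD filter_cat /index_iota addKn add0n.
  rewrite (eq_in_filter (a2 := pred0)) ?filter_pred0 => [|j]; last by rewrite mem_iota /=; lia.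
  by rewrite (eq_in_filter (a2 := predT)) ?filter_predT // => j; rewrite mem_iota /=; lia.
rewrite /index_iota (eqP (ltnW nl : lo >= n)%N).
by rewrite (eq_in_filter (a2 := pred0)) ?filter_pred0 // => j; rewrite mem_iota /=; lia.
Qed.

Definition cnt_lt n A := cnt3 n (fun a b c => (a + b + c < A)%N).

Lemma cnt_ltE n A : cnt_lt n A = (\sum_(0 <= j < A) cnt3 n (fun a b c => a + b + c == j))%N.
Proof.
rewrite big_mkord /cnt_lt /cnt3 [RHS]exchange_big; apply: eq_bigr => a _ /=.
rewrite [RHS]exchange_big; apply: eq_bigr => b _ /=.
by rewrite [RHS]exchange_big; apply: eq_bigr => c _ /=; rewrite sum_ltn_eq.
Qed.

Lemma size_partials_deg n j : (j < n)%N ->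
  (size [seq bmnm a | a : 'X_{1..3 < j.+1} <- enum predT & mdeg a == j] <=
   cnt3 n (fun a b c => a + b + c == j)%N)%N.
Proof.
move=> jn; rewrite size_map -card_T3.
have /choice[g gE] : forall a : 'X_{1..3 < j.+1}, exists t : T3 n, mn3 t = bmnm a.
  by move=> a; apply: mn3_exists; apply: leq_trans jn; exact: bmdeg.
rewrite -(size_map g) cardE; apply: uniq_leq_size.
  rewrite map_inj_uniq ?filter_uniq // => [|a b gab]; first by rewrite -enumT enum_uniq.
  by apply: val_inj; rewrite /= -!gE gab.
move=> t /mapP[a]; rewrite mem_filter => /andP[/eqP aj _] ->.
rewrite mem_enum inE (mn3E (g a) (fun a b c => a + b + c == j)%N) gE.
by apply/eqP; rewrite -[RHS]aj mdegE big_ord3 /= addnA.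
Qed.

Lemma size_partials n lo hi : (lo <= hi)%N -> (hi <= n)%N ->
  (size (partials lo%:Z (hi%:Z - 1)) + cnt_lt n lo <= cnt_lt n hi)%N.
Proof.
move=> lh hn; rewrite !cnt_ltE [leqRHS](big_cat_nat (n := lo)) //= addnC leq_add2l.
rewrite /partials irange_from size_flatten_map big_seq [leqRHS]big_seq.
by apply: leq_sum => j; rewrite mem_index_iota => /andP[_ jh]; apply: size_partials_deg; lia.
Qed.

Lemma ldim_Pol1 (R : realType) (m : int) (e : nat) : m + 1 = e%:Z ->
  (ldim (@Pol R 1 m) <= e)%N.
Proof.
move=> me; apply: leq_trans (ldim_leq_span (@Pol_span R 1 m)) _; rewrite me absz_nat.
have degE (a : 'X_{1..1 < e}) : (mdeg (val a) < e)%N by exact: bmdeg.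
rewrite -[leqRHS]card_ord.
apply: (@leq_card _ _ (fun a : 'X_{1..1 < e} => Ordinal (degE a))) => a b /(congr1 val) /= E.
apply/val_inj/mnmP => i; move: E; rewrite !mdegE !big_ord_recl !big_ord0 !addn0.
by rewrite !ord1.
Qed.

End Sizes.

(** * Arithmetic of the count *)

Section DofCounting.
Local Open Scope nat_scope.

(** Split [j + 1] as 1 + j. The first part counts (D3); in the second, replacing j by j + 1 gives
    the layer along an edge in degree K for orders lowered by one, as
    [K + 3 + j - 2 A = K + 1 + j - 2 (A - 1)]. *)
Lemma edge_identity K A B : 2 * B <= A + 1 ->
  \sum_(j < B) (K.+1 + 1 + j - 2 * A) + edge_count K A.-1 B.-1 = edge_count K.+1 A B.
Proof.
case: B => [|B] BA; first by rewrite /edge_count !big_ord0.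
rewrite /edge_count; under [RHS]eq_bigr do rewrite mulSn.
rewrite [RHS]big_split /=; congr (_ + _); rewrite [RHS]big_ord_recl mul0n add0n /=.
by apply: eq_bigr => j _; congr (_ * _); rewrite /= /bump /=; lia.
Qed.

Lemma face_identity n K A B C :
  face_count n K.+1 A B C.+1 = cnt3 n (F3 K.+1 A B) + face_count n K A.-1 B.-1 C.
Proof.
rewrite /face_count big_ord_recl !subn0; congr (_ + _).
apply: eq_bigr => j _; rewrite /= /bump /= add1n subSS.
have -> : A - j.+1 = A.-1 - j by lia.
by have -> : B - j.+1 = B.-1 - j by lia.
Qed.

Lemma S4_leq n m A B C A' B' C' : A <= A' -> B <= B' -> C <= C' ->
  cnt4 n (S4 m A' B' C') <= cnt4 n (S4 m A B C).
Proof.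
move=> AA BB CC; apply: leq_sum => a _; apply: leq_sum => b _.
apply: leq_sum => c _; apply: leq_sum => d _.
have [h|//] := boolP (S4 m A' B' C' a b c d); suff -> : S4 m A B C a b c d by [].
move/S4P: h => [? [[? ? ? ?] [[? ? ?] [[? ? ?] [? ? ? ?]]]]].
by apply/S4P; do ! split; lia.
Qed.

Section DofCount.
Variables (K A B C A3 B3 C3 : nat).
Local Notation n := K.+2.
Local Notation V := (fun r => cnt3 n (fun a b c => a + b + c < r)).

(** [P_K] is partitioned once with [r3] and once with [r2 - 1]; comparing the two replaces the
    counts of (D2), (D6), (D9) and (D10) by those of [r2 - 1]. [edge_identity] and [FI] merge these
    with (D3) and (D7), which leaves three times the partition of [P_(K + 1)] with [r2]. The unit
    that (D10) loses by the mean value cancels the one in the bound for (D11). *)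
Lemma dof_count s1 s2 s3 s4 s5 s6 s7 s8 s9 s10 s11 :
  [/\ 2 * C <= B + 1, 2 * B <= A + 1 & 2 * A <= K.+2] ->
  2 * C.-1 <= B.-1 + 1 ->
  [/\ 2 * C3 <= B3 + 1, 2 * B3 <= A3 + 1 & 2 * A3 <= K + 1] ->
  [/\ s1 <= 12 * V A, s2 + 4 * V A.-1 <= 4 * V A3,
      s3 <= 6 * \sum_(j < B) (K.+1 + 1 + j - 2 * A), s4 <= 6 * edge_count K.+1 A B &
      s5 <= 6 * edge_count K.+1 A B] ->
  [/\ s6 <= 6 * edge_count K A3 B3, s7 <= 4 * cnt3 n (F3 K.+1 A B),
      s8 <= 8 * face_count n K.+1 A B C & s9 <= 4 * face_count n K A3 B3 C3] ->
  s10 < cnt4 n (S4 K A3 B3 C3) ->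
  s11 + cnt4 n (S4 K A.-1 B.-1 C.-1) +
    boundary_count n K.+1 A B C <= (3 * cnt4 n (S4 K.+1 A B C)).+1 ->
  s1 + (s2 + (s3 + (s4 + (s5 + (s6 + (s7 + (s8 + (s9 + (s10 + s11))))))))) <=
  3 * cnt4 n (fun a b c d => a + b + c + d == K.+1).
Proof.
move=> [CB BA AK] CB' [CB3 BA3 AK3] [h1 h2 h3 h4 h5] [h6 h7 h8 h9] h10 h11.
have E1 := @count_partition n K.+1 A B C.
have E2 := @count_partition n K A3 B3 C3.
have E3 := @count_partition n K A.-1 B.-1 C.-1.
have EI := edge_identity K BA.
(* For C > 0 the layer j = 0 of [face_count] is the count of (D7) and the other layers are those of
   [r2 - 1]. For C = 0 the face layers are empty, and (D7) is paid by the conditions v.n = 0 in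
   [boundary_count]. *)
have FI : 4 * cnt3 n (F3 K.+1 A B) + 8 * face_count n K.+1 A B C + 4 * face_count n K A.-1 B.-1 C.-1 <=
  12 * face_count n K.+1 A B C + boundary_count n K.+1 A B C.
  case: C CB CB' {E1 E2 E3 h8 h11} => [|C'] CB CB'; last by rewrite face_identity /=; lia.
  rewrite count_faces ?/face_count /= ?big_ord0; lia.
move: E1 E2 E3 => /(_ CB BA _ _) E1 /(_ CB3 BA3 AK3 _) E2 /(_ CB' _ _ _) E3.
have {}E1 := E1 ltac:(lia) ltac:(lia); have {}E2 := E2 ltac:(lia).
have {}E3 := E3 ltac:(lia) ltac:(lia) ltac:(lia).
rewrite E1 -EI; rewrite -EI in h4 h5; rewrite E2 in E3.
move: E3 FI h1 h2 h3 h4 h5 h6 h7 h8 h9 h10 h11 {E1 E2 EI}.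
move: (boundary_count _ _ _ _ _) => ?.
do ! (move: (cnt4 _ _) => ?).
do ! (move: (cnt3 _ _) => ?).
do ! (move: (edge_count _ _ _) => ?).
do ! (move: (face_count _ _ _ _ _) => ?).
move: (\sum_(j < B) _) => ?; lia.
Qed.
End DofCount.

End DofCounting.

(** * Sizes of the families of degrees of freedom *)

Section DofSizes.
Context {R : realType} {x : 'I_4 -> 'rV[R]_3} {F : @frames R}.
Context (xT : tetrahedron x) (hF : frames_of x F).
Variables (K A B C A3 B3 C3 : nat).
Local Notation k := (K.+1).
Local Notation n := (K.+2).
Local Notation r2 := (Smoothness (A%:Z - 1) (B%:Z - 1) (C%:Z - 1)).
Local Notation r3 := (Smoothness (A3%:Z - 1) (B3%:Z - 1) (C3%:Z - 1)).
Hypotheses (An : (2 * A <= n)%N) (A3k : (2 * A3 <= k)%N) (A3A : (A.-1 <= A3)%N).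

Lemma size_D1 : (size (D1 x r2) <= 12 * cnt_lt n A)%N.
Proof.
rewrite /D1 size_allpairs size_Delta size_allpairs size_enum_ord.
have : (size (partials 0 (A%:Z - 1)) + cnt_lt n 0 <= cnt_lt n A)%N.
  by apply: size_partials; lia.
rewrite /=; move: (size _) (cnt_lt _ _) (cnt_lt _ _) => a b c; rewrite (_ : 'C(4, 1) = 4) //; lia.
Qed.

Lemma size_D2 : (size (D2 x r2 r3) + 4 * cnt_lt n A.-1 <= 4 * cnt_lt n A3)%N.
Proof.
rewrite /D2 size_allpairs size_Delta -mulnDr leq_mul2l /=.
have -> : Num.max (A%:Z - 1) 0 = (A.-1)%:Z by lia.
by apply: size_partials; lia.
Qed.

Lemma size_D3 : (size (D3 x F k%:Z r2) <= 6 * \sum_(j < B) (k + 1 + j - 2 * A))%N.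
Proof.
rewrite /D3 irange_nat -[6%N](size_Delta 1) -(big_mkord predT (fun j => k + 1 + j - 2 * A)%N).
rewrite /index_iota subn0; apply: size_flatten_allpairs => e j.
by rewrite size_moments; apply: ldim_Pol1 => /=; lia.
Qed.

Lemma size_itriangle (X : Type) (N m b : nat) (f : {set 'I_4} -> nat * nat -> seq X) :
  (forall e ij, (size (f e ij) <= m + ij.2 - b)%N) ->
  (size (flatten [seq f e ij | e <- Delta 1, ij <- itriangle (N%:Z - 1)]) <=
   6 * \sum_(j < N) j.+1 * (m + j - b))%N.
Proof.
move=> fm; apply: leq_trans (@size_flatten_allpairs _ _ _ f (fun ij => m + ij.2 - b)%N _ _ _) _.
  exact: fm.
rewrite size_Delta leq_mul2l /= /itriangle big_allpairs_dep irange_nat.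
rewrite -(big_mkord predT (fun j => j.+1 * (m + j - b))%N) /index_iota subn0.
rewrite leq_eqVlt; apply/orP; left; apply/eqP; apply: eq_bigr => j _.
rewrite (eq_bigr (fun _ => (m + j - b)%N)) => [|//].
by rewrite big_const_seq count_predT size_iota iter_addn_0 mulnC.
Qed.

Lemma size_D4 : (size (D4 x F k%:Z r2) <= 6 * edge_count k A B)%N.
Proof. by apply: size_itriangle => e ij; rewrite size_moments; apply: ldim_Pol1 => /=; lia. Qed.

Lemma size_D5 : (size (D5 x F k%:Z r2) <= 6 * edge_count k A B)%N.
Proof. by apply: size_itriangle => e ij; rewrite size_moments; apply: ldim_Pol1 => /=; lia. Qed.

Lemma size_D6 : (size (D6 x F k%:Z r3) <= 6 * edge_count K A3 B3)%N.
Proof. by apply: size_itriangle => e ij; rewrite size_moments; apply: ldim_Pol1 => /=; lia. Qed.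

(** For j > m the degree is negative and the space is zero, whereas [m - j] is truncated on the
    right-hand side. *)
Lemma ldim_bubbleF_shift (m : nat) j (S T : nat) : (m < n)%N ->
  (ldim (@bubbleF R (m%:Z - j%:Z) (S%:Z - 1 - j%:Z) (T%:Z - 1 - j%:Z)) <=
   cnt3 n (F3 (m - j) (S - j) (T - j)))%N.
Proof.
move=> mn; have [jm|mj] := leqP j m; last first.
  rewrite (leq_trans (ldim_leq_span (J := void) (u := fun=> 0) _)) ?card_void //.
  apply: lspan_sub; first exact: spanF_lin.
  by move=> v [d [dE _ _]]; exfalso; move: (mdeg d) dE => e; lia.
rewrite (_ : m%:Z - j%:Z = (m - j)%N%:Z) -?card_F3; last by lia.
by apply/ldim_leq_span/bubbleF_span => [|t|t]; lia.
Qed.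

Lemma size_D8 : (size (D8 x F k%:Z r2) <= 8 * face_count n k A B C)%N.
Proof.
rewrite /D8; apply: leq_trans (@size_flatten_allpairs _ _ _ _ (fun jt =>
  cnt3 n (F3 (k - jt.1) (A - jt.1) (B - jt.1))%N) _ _ _) _.
  by move=> f jt; rewrite size_moments; exact: ldim_bubbleF_shift.
rewrite size_Delta /face_count (_ : 'C(4, 3) = 4) // (_ : 8 = 4 * 2)%N // -mulnA leq_mul2l.
rewrite big_allpairs_dep irange_nat -(big_mkord predT (fun j => cnt3 n (F3 (k - j) (A - j) (B - j))%N)).
rewrite /index_iota subn0 big_distrr /=; apply: leq_sum => j _.
by rewrite !big_cons big_nil addn0 addnn mul2n.
Qed.

Lemma size_D9 : (size (D9 x F k%:Z r3) <= 4 * face_count n K A3 B3 C3)%N.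
Proof.
rewrite /D9; apply: leq_trans (@size_flatten_allpairs _ _ _ _ (fun j =>
  cnt3 n (F3 (K - j) (A3 - j) (B3 - j))%N) _ _ _) _.
  move=> f j; rewrite size_moments (_ : k%:Z - 1 = K%:Z); last by lia.
  exact: ldim_bubbleF_shift.
rewrite size_Delta (_ : 'C(4, 3) = 4) // leq_mul2l /= irange_nat.
rewrite /face_count -(big_mkord predT (fun j => cnt3 n (F3 (K - j) (A3 - j) (B3 - j))%N)).
by rewrite /index_iota subn0.
Qed.

Lemma Pol0_span d : (@Pol R d 0 `<=` spanF (fun _ : unit => 1))%classic.
Proof.
move=> p pm; exists (fun _ => p@_0); rewrite big_const card_unit /= addr0.
case: pm => [->|pm]; first by rewrite mcoeff0 scale0r.
rewrite [LHS]msize1_polyC ?alg_mpolyC //; by move: (msize p) pm => s; lia.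
Qed.

Lemma bubbleF_spanT : (@bubbleF R k%:Z (A%:Z - 1) (B%:Z - 1) `<=`
  spanF (fun t : {t : T3 n | onT3 (F3 k A B) t} => \prod_i @bary_std R 2 i ^+ mn3 (val t) i))%classic.
Proof. by apply: bubbleF_span => [|t|t]; lia. Qed.

(** Restricting to mean zero removes one generator of the bubble space and adding the constants
    restores one, so the count is that of the full bubble space. That space being nonzero, it has a
    monomial [j0], whose integral is positive, from which the means of the others can be
    corrected. *)
Lemma size_D7 : (1 <= ldim (@bubbleF R k%:Z (A%:Z - 1) (B%:Z - 1)))%N ->
  (size (D7 x F k%:Z r2) <= 4 * cnt3 n (F3 k A B))%N.
Proof.
move=> F1; rewrite /D7 size_flatten_map big_seq.
apply: (@leq_trans (\sum_(f <- Delta 2 | f \in Delta 2) cnt3 n (F3 k A B))); last first.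
  by rewrite -big_seq big_const_seq count_predT size_Delta iter_addn_0 mulnC.
apply: leq_sum => f fD; rewrite size_moments -card_F3.
set J := sig _; have J1 : (0 < #|{: J}|)%N.
  exact: leq_trans F1 (ldim_leq_span bubbleF_spanT).
have /card_gt0P[j0 _] := J1.
have l0 : simplex_int (@vtx R x 2 f)
    (fun s => (\prod_i @bary_std R 2 i ^+ mn3 (val j0) i).@[s]) != 0.
  rewrite simplex_intE gt_eqF // mulr_gt0 ?Int_bary_std_gt0 //.
  by rewrite (gram_vtx_gt0 xT fD).
have S1 := kernel_span (u := fun t : J => \prod_i @bary_std R 2 i ^+ mn3 (val t) i)
  (@face_int_scalar R 2 (@vtx R x 2 f)) l0.
apply: leq_trans (ldim_leq_span (J := (unit + {j : J | j != j0})%type) _) _.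
  move=> _ [q0 [q1 [q0P [q1B q1l] ->]]].
  apply: spanF_add (Pol0_span q0P) (S1 _ _); split=> //; exact: bubbleF_spanT.
by rewrite card_sum card_unit card_sig cardC1; move: J1; case: #|_|.
Qed.

(** The inequality is strict because a bubble monomial, whose integral is positive, exists and is
    lost in passing to mean zero. *)
Lemma size_D10 : (1 <= ldim (bubbleT x K%:Z r3))%N ->
  (size (D10 x k%:Z r3) < cnt4 n (S4 K A3 B3 C3))%N.
Proof.
move=> T1; rewrite /D10 size_moments (_ : k%:Z - 1 = K%:Z); last by lia.
have Sp := @bubbleT_span R x n K A3 B3 C3 (leqnSn _).
rewrite -card_S4; set J := sig _ in Sp *; have J1 : (0 < #|{: J}|)%N.
  exact: leq_trans T1 (ldim_leq_span Sp).
have /card_gt0P[j0 _] := J1.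
have l0 : cell_int x (@gen4 R x n (val j0)) != 0.
  rewrite cell_intE gt_eqF // mulr_gt0 ?gram_cell_gt0 //.
  rewrite -[Int _]/(@cellI R x 'X_[mn4 (val j0)]) (cellIX xT) divr_gt0 ?ltr0n ?fact_gt0 //.
  by apply: prodn_gt0 => i; rewrite fact_gt0.
have S1 := kernel_span (u := fun t : J => @gen4 R x n (val t)) (@cell_int_scalar R x) l0.
rewrite -(ltn_predK J1) ltnS.
apply: leq_trans (ldim_leq_span (J := {j : J | j != j0}) _) _.
  by move=> q [/Sp qS q0]; exact: (S1 _ (conj qS q0)).
by rewrite card_sig cardC1.
Qed.

Hypotheses (hABC : [\/ [/\ 1 <= C, 2 * C <= B & 2 * B <= A + 1]%N,
             [/\ C = 0, 2 <= B & 2 * B <= A + 1]%N | [/\ C = 0, B <= 1 & 2 * B <= A]%N])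
  (CB3 : (2 * C3 <= B3 + 1)%N) (BA3 : (2 * B3 <= A3 + 1)%N)
  (B3B : (B.-1 <= B3)%N) (C3C : (C.-1 <= C3)%N)
  (T1 : (1 <= ldim (bubbleT x K%:Z r3))%N)
  (F1 : (1 <= ldim (@bubbleF R k%:Z (A%:Z - 1) (B%:Z - 1)))%N).

Lemma size_dofs_leq :
  (size (dofs x F k%:Z r2 r3) <= 3 * cnt4 n (fun a b c d => a + b + c + d == k))%N.
Proof.
have [CB BA CB'] : [/\ 2 * C <= B + 1, 2 * B <= A + 1 & 2 * C.-1 <= B.-1 + 1]%N.
  by case: hABC => -[? ? ?]; split; lia.
have h10 := size_D10 T1.
(* The bubble exponents for [r3] are among those for [r2 - 1], and there is at least one of them. *)
have h11 : (0 < cnt4 n (S4 K A.-1 B.-1 C.-1))%N.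
  exact: leq_trans (leq_ltn_trans (leq0n _) h10) (@S4_leq n K _ _ _ _ _ _ A3A B3B C3C).
have {}h11 := ldim_kerdiv_bound xT hF An hABC h11.
rewrite /dofs !size_cat.
apply: (dof_count (A := A) (B := B) (C := C) (A3 := A3) (B3 := B3) (C3 := C3)) => //.
- by split=> //; lia.
- split; [exact: size_D1 | exact: size_D2 | exact: size_D3 | exact: size_D4 | exact: size_D5].
- split; [exact: size_D6 | exact: size_D7 | exact: size_D8 | exact: size_D9].
- by rewrite size_moments.
Qed.

Lemma dofs_unisolvent : unisolvent (@VPol R k%:Z) (dofs x F k%:Z r2 r3).
Proof.
have v0 v : VPol k%:Z v -> all (fun l : dof => l v == 0) (dofs x F k%:Z r2 r3) -> v = 0.
  move=> vP; have [CB BA] : (C <= B /\ 2 * B <= A + 1)%N.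
    by case: hABC => -[? ? ?]; split; lia.
  by apply: (dofs_unisolvence xT hF) => //; lia.
split=> //; apply/eqP; rewrite eqn_leq; apply/andP; split.
  exact: leq_trans size_dofs_leq (ldim_VPol_geq xT (ltnSn _)).
have Wl : lin_closed (@VPol R k%:Z) by exact/lin_closed_vpoly/Pol_lin.
by apply: (ldim_leq_functionals (VPol_basis _) Wl) => //; exact: dofs_scalar.
Qed.

End DofSizes.

Theorem lemma4p9 (R : realType) (x : 'I_4 -> 'rV[R]_3) (F : @frames R)
  (r2 r3 : smoothness) (k : int)
  (hT : tetrahedron x)
  (hF : frames_of x F)
  (hr2 : le_smoothness (Smoothness (-1) (-1) (-1)) r2)
  (hcases :
     [\/ [/\ 0 <= rf r2, 2 * rf r2 + 1 <= re r2 & 2 * re r2 <= rv r2],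
         [/\ rf r2 = -1, 1 <= re r2 & 2 * re r2 <= rv r2]
       | [/\ rf r2 = -1, re r2 = 0 \/ re r2 = -1 & 2 * re r2 + 1 <= rv r2]])
  (hr3 : valid_smoothness r3)
  (hr23 : le_smoothness (ominus1 r2) r3)
  (hk : Num.max (Num.max (2 * rv r2 + 1) (2 * rv r3 + 2)) 1 <= k)
  (hdimT : (1 <= ldim (bubbleT x (k - 1) r3))%N)
  (hdimF : (1 <= ldim (@bubbleF R k (rv r2) (re r2)))%N) :
  unisolvent (@VPol R k) (dofs x F k r2 r3).
Proof.
have [K kE] : exists K : nat, k = K.+1%:Z by exists (absz (k - 1)); lia.
case: r2 r3 hr2 hcases hr3 hr23 hk hdimT hdimF => [a b c] [a3 b3 c3].
rewrite /le_smoothness /valid_smoothness /ominus1 /=.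
move=> [a1 b1 c1] hcases [c31 b31 a31] [ha hb hc] hk.
(* Every order is at least -1, hence a natural number minus one; for the vertex and edge orders of
   [r3] this comes from validity. *)
have natE (z : int) : -1 <= z -> exists Z : nat, z = Z%:Z - 1 by exists (absz (z + 1)); lia.
have [A aE] := natE a a1; have [B bE] := natE b b1; have [C cE] := natE c c1.
have [A3 a3E] : exists Z : nat, a3 = Z%:Z - 1 by apply: natE; lia.
have [B3 b3E] : exists Z : nat, b3 = Z%:Z - 1 by apply: natE; lia.
have [C3 c3E] := natE c3 c31.
rewrite aE bE cE a3E b3E c3E kE in hcases c31 b31 a31 ha hb hc hk *.
rewrite (_ : K.+1%:Z - 1 = K%:Z); last by lia.
move=> hdimT hdimF.
apply: dofs_unisolvent => //; try lia.
case: hcases => -[h1 h2 h3]; [apply: Or31|apply: Or32|apply: Or33]; split; lia.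
Qed.
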